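(* Let $k,N\in\mathbb N$, let $\Omega\subset\mathbb R^k$ be open, let $\mathbb K\in\{\mathbb R,\mathbb C\}$, and let $f_1,\dots,f_N\colon\Omega\to\Omega$, $g_1,\dots,g_N\colon\Omega\to\mathbb K$, $h_0\colon\Omega\to\mathbb K$ be functions satisfying hypothesis (H) (with constants $K$ and $L$ as in (H)). Let $\psi$ be as in the context and assume $h_0\in L^{\psi,1}(\Omega,\mathbb K)$. Suppose there is a real constant $\alpha\in[0,\tfrac12)$ such that $$|g_n(x)|\le \alpha\min\Big\{\frac{|J_{f_n}(x)|}{KL},\frac1N\Big\}\quad\text{for all } n\in\{1,\dots,N\}\text{ and almost all }x\in\Omega.$$ Then the elementary solution of the equation $\varphi(x)=\sum_{n=1}^N g_n(x)\varphi(f_n(x))+h_0(x)$ in $L^{\psi,1}(\Omega,\mathbb K)$ exists, it is the unique solution of this equation in $L^{\psi,1}(\Omega,\mathbb K)$, and for every $j\in\mathbb N\cup\{0\}$ $$\Big\|\sum_{i=j}^\infty P^i h_0\Big\|_{L^{\psi,1}(\Omega,\mathbb K)}\le \frac{(2\alpha)^j}{1-2\alpha}\|h_0\|_{L^{\psi,1}(\Omega,\mathbb K)}.$$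
   Context: $\mu$ denotes $k$-dimensional Lebesgue measure. A Young function is a non-decreasing, left-continuous, convex $\Psi\colon[0,\infty)\to[0,\infty]$ with $\lim_{t\to0+}\Psi(t)=\Psi(0)=0$ and $\lim_{t\to\infty}\Psi(t)=\infty$. Fix a strictly increasing Young function $\psi\colon[0,\infty)\to[0,\infty)$ satisfying $\Delta_2$ globally (there is $d\in(1,\infty)$ with $\psi(2t)\le d\psi(t)$ for all $t>0$) and $\lim_{t\to0+}\psi(t)/t=\lim_{t\to\infty}t/\psi(t)=0$. Define $\tau(0)=0$ and $\tau(t)=1/\psi(1/t)$ for $t>0$; $\tau$ is a strictly increasing bijection of $[0,\infty)$, and $\tau^{-1}$ denotes its inverse (with $\tau^{-1}(\infty)=\infty$). For measurable $f\colon\Omega\to\mathbb K$ the distribution function is $\mu_f(s)=\mu(\{x\in\Omega:|f(x)|>s\})$. The Lorentz space $L^{\psi,1}(\Omega,\mathbb K)$ is the set of $f\in L^1_{\mathrm{loc}}(\Omega,\mathbb K)$ with $\|f\|_{L^{\psi,1}(\Omega,\mathbb K)}:=\int_0^\infty\tau^{-1}(\mu_f(s))\,ds<\infty$ (functions equal a.e. identified). Approximate differential: a linear map $A\colon\mathbb R^k\to\mathbb R^k$ is an approximate differential of a measurable $F\colon\Omega\to\mathbb R^k$ at $x_0$ if for every $\varepsilon>0$ the point $x_0$ is a density point of $\{x\in\Omega\setminus\{x_0\}:\|F(x)-F(x_0)-A(x-x_0)\|/\|x-x_0\|<\varepsilon\}$. $J_F(x)$ is the determinant of the approximate differential of $F$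 at $x$, set to $0$ where $F$ is not approximately differentiable. $F$ satisfies Luzin's condition N if it maps Lebesgue-null sets to Lebesgue-null sets. Hypothesis (H): $f_1,\dots,f_N$ are measurable, almost everywhere approximately differentiable and satisfy Luzin's condition N; for every $n$ and every null set $M\subset\mathbb R^k$, $f_n^{-1}(M)$ is null; there is $K\in\mathbb N$ such that for every $n$ the set $\{x\in\Omega:\operatorname{card} f_n^{-1}(x)>K\}$ is null; $g_1,\dots,g_N,h_0$ are measurable; and $L=\max\{l\in\{1,\dots,N\}: \mu(\bigcap_{i=1}^l f_{n_i}(\Omega))>0\text{ for some } n_1<\dots<n_l\}$. The operator $P$ is $P\psi=\sum_{n=1}^N g_n\cdot(\psi\circ f_n)$. The elementary solution of the equation in a normed function space $\mathcal F_0$ is the series $\sum_{i=0}^\infty P^i h_0$, when it converges in the norm of $\mathcal F_0$ to a function in $\mathcal F_0$ solving the equation. *)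

(* Defs.v *)
From HB Require Import structures.
From mathcomp Require Import all_boot all_order all_algebra.
From mathcomp Require Import all_classical all_reals all_analysis.
From mathcomp Require Import complex.
Import Order.TTheory GRing.Theory Num.Theory.
Import numFieldNormedType.Exports.

Set Implicit Arguments.
Unset Strict Implicit.
Unset Printing Implicit Defensive.

Local Open Scope ring_scope.
Local Open Scope classical_set_scope.

Section Defs.
Variable R : realType.

Definition enorm (k : nat) (x : 'rV[R]_k) : R :=
  Num.sqrt (\sum_(i < k) x 0 i ^+ 2).

Definition eball (k : nat) (x0 : 'rV[R]_k) (r : R) : set 'rV[R]_k :=
  [set x | enorm (x - x0) < r].

Definition box (k : nat) (a b : 'rV[R]_k) : set 'rV[R]_k :=
  [set x | forall i : 'I_k, a 0 i <= x 0 i < b 0 i].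

Definition box_vol (k : nat) (a b : 'rV[R]_k) : R :=
  \prod_(i < k) Num.max 0 (b 0 i - a 0 i).

Definition leb_outer (k : nat) (A : set 'rV[R]_k) : \bar R :=
  ereal_inf [set s | exists a b : nat -> 'rV[R]_k,
     A `<=` \bigcup_n box (a n) (b n) /\
     s = (\sum_(0 <= n <oo) (box_vol (a n) (b n))%:E)%E].

Definition leb_measurable (k : nat) (A : set 'rV[R]_k) : Prop :=
  forall T : set 'rV[R]_k,
    leb_outer T = (leb_outer (T `&` A) + leb_outer (T `&` ~` A))%E.

Definition leb_null (k : nat) (A : set 'rV[R]_k) : Prop := leb_outer A = 0%E.

Definition ae_on (k : nat) (Omega : set 'rV[R]_k) (P : 'rV[R]_k -> Prop) : Prop :=
  leb_null [set x | Omega x /\ ~ P x].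

(* Scalar field K (R or C): a normed Z-module over R (norm |.| : K -> R)
   together with its multiplication.                                   *)

Definition kopen (K : normedZmodType R) (U : set K) : Prop :=
  forall z, U z -> exists2 e : R, 0 < e & forall w, `|w - z| < e -> U w.

Definition kmeasurable (k : nat) (K : normedZmodType R)
    (Omega : set 'rV[R]_k) (u : 'rV[R]_k -> K) : Prop :=
  forall U : set K, kopen U -> leb_measurable (Omega `&` u @^-1` U).

Definition vmeasurable (k : nat) (Omega : set 'rV[R]_k)
    (F : 'rV[R]_k -> 'rV[R]_k) : Prop :=
  forall U : set 'rV[R]_k, open U -> leb_measurable (Omega `&` F @^-1` U).

Definition nn_integral (k : nat) (D : set 'rV[R]_k)
    (u : 'rV[R]_k -> \bar R) : \bar R :=
  ereal_sup [set v | exists s : seq (R * set 'rV[R]_k),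
     [/\ forall p, p \in s -> 0 <= p.1 /\ leb_measurable p.2 /\ p.2 `<=` D,
         forall x, D x -> ((\sum_(p <- s) p.1 * \1_(p.2) x)%:E <= u x)%E
       & v = (\sum_(p <- s) (p.1%:E * leb_outer p.2))%E]].

Definition L1loc (k : nat) (K : normedZmodType R)
    (Omega : set 'rV[R]_k) (u : 'rV[R]_k -> K) : Prop :=
  kmeasurable Omega u /\
  forall C : set 'rV[R]_k, compact C -> C `<=` Omega ->
    (nn_integral C (fun x => (`|u x|)%:E) < +oo)%E.

Definition young_function (psi : R -> R) : Prop :=
  (forall t, 0 <= t -> 0 <= psi t) /\
  (forall s t, 0 <= s -> s <= t -> psi s <= psi t) /\
  (forall t, 0 < t -> forall e, 0 < e -> exists2 d, 0 < d &
     forall u, t - d < u -> u <= t -> `|psi u - psi t| < e) /\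
  (forall s t l, 0 <= s -> 0 <= t -> 0 <= l <= 1 ->
     psi (l * s + (1 - l) * t) <= l * psi s + (1 - l) * psi t) /\
  psi 0 = 0 /\
  (forall e, 0 < e -> exists2 d, 0 < d &
     forall t, 0 < t -> t < d -> psi t < e) /\
  (forall M, exists T, forall t, T <= t -> M <= psi t).

Definition admissible_psi (psi : R -> R) : Prop :=
  [/\ young_function psi,
      (* strictly increasing *) forall s t, 0 <= s -> s < t -> psi s < psi t,
      (exists2 d, 1 < d & forall t, 0 < t -> psi (2 * t) <= d * psi t),
      (forall e, 0 < e -> exists2 d, 0 < d &
         forall t, 0 < t -> t < d -> psi t / t < e)
    &
      forall e, 0 < e -> exists T, forall t, T < t -> 0 < t -> t / psi t < e].

Definition tau (psi : R -> R) (t : R) : R :=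
  if t == 0 then 0 else (psi (t^-1))^-1.

Definition tau_inv (psi : R -> R) (u : \bar R) : \bar R :=
  match u with
  | r%:E => (xget 0 [set t | 0 <= t /\ tau psi t = r])%:E
  | +oo%E => +oo%E
  | -oo%E => 0%E
  end.

Definition distribution (k : nat) (K : normedZmodType R)
    (Omega : set 'rV[R]_k) (u : 'rV[R]_k -> K) (s : R) : \bar R :=
  leb_outer [set x | Omega x /\ s < `|u x|].

Definition lorentz_norm (psi : R -> R) (k : nat) (K : normedZmodType R)
    (Omega : set 'rV[R]_k) (u : 'rV[R]_k -> K) : \bar R :=
  (\int[lebesgue_measure]_(s in `[0%R, +oo[) tau_inv psi (distribution Omega u s))%E.

Definition in_Lpsi1 (psi : R -> R) (k : nat) (K : normedZmodType R)
    (Omega : set 'rV[R]_k) (u : 'rV[R]_k -> K) : Prop :=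
  L1loc Omega u /\ (lorentz_norm psi Omega u < +oo)%E.

(** x0 is a density point of A:
    mu(A /\ B(x0,r)) / mu(B(x0,r)) -> 1 as r -> 0+.  (The ratio is <= 1.) *)
Definition density_point (k : nat) (x0 : 'rV[R]_k) (A : set 'rV[R]_k) : Prop :=
  forall e, 0 < e -> exists2 d, 0 < d & forall r, 0 < r -> r < d ->
    ((1 - e)%:E * leb_outer (eball x0 r) <= leb_outer (A `&` eball x0 r))%E.

Definition approx_diff (k : nat) (Omega : set 'rV[R]_k)
    (F : 'rV[R]_k -> 'rV[R]_k) (x0 : 'rV[R]_k) (A : 'M[R]_k) : Prop :=
  forall e, 0 < e -> density_point x0
    [set x | Omega x /\ x <> x0 /\
       enorm (F x - F x0 - (x - x0) *m A) / enorm (x - x0) < e].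

Definition approx_differentiable (k : nat) (Omega : set 'rV[R]_k)
    (F : 'rV[R]_k -> 'rV[R]_k) (x0 : 'rV[R]_k) : Prop :=
  exists A, approx_diff Omega F x0 A.

Definition jacobian (k : nat) (Omega : set 'rV[R]_k)
    (F : 'rV[R]_k -> 'rV[R]_k) (x : 'rV[R]_k) : R :=
  match pselect (approx_differentiable Omega F x) with
  | left h => \det (projT1 (cid h))
  | right _ => 0
  end.

Definition luzin_N (k : nat) (Omega : set 'rV[R]_k)
    (F : 'rV[R]_k -> 'rV[R]_k) : Prop :=
  forall M, M `<=` Omega -> leb_null M -> leb_null (F @` M).

Definition null_preimages (k : nat) (Omega : set 'rV[R]_k)
    (F : 'rV[R]_k -> 'rV[R]_k) : Prop :=
  forall M, leb_null M -> leb_null (Omega `&` F @^-1` M).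

Definition many_preimages (k : nat) (Omega : set 'rV[R]_k)
    (F : 'rV[R]_k -> 'rV[R]_k) (K : nat) : set 'rV[R]_k :=
  [set x | Omega x /\ exists s : seq 'rV[R]_k,
     [/\ uniq s, size s = K.+1 & forall y, y \in s -> Omega y /\ F y = x]].

Definition images_cap (k N : nat) (Omega : set 'rV[R]_k)
    (f : 'I_N -> 'rV[R]_k -> 'rV[R]_k) (s : seq 'I_N) : set 'rV[R]_k :=
  [set y | forall n, n \in s -> (f n @` Omega) y].

Definition incr_tuple (N : nat) (s : seq 'I_N) : Prop :=
  sorted (fun a b : 'I_N => (a < b)%N) s /\ (0 < size s)%N.

Definition is_L (k N : nat) (Omega : set 'rV[R]_k)
    (f : 'I_N -> 'rV[R]_k -> 'rV[R]_k) (L : nat) : Prop :=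
  (exists s, [/\ incr_tuple s, size s = L & (0 < leb_outer (images_cap Omega f s))%E])
  /\ forall s, incr_tuple s -> (0 < leb_outer (images_cap Omega f s))%E ->
       (size s <= L)%N.

Definition hypH (k N : nat) (Kf : normedZmodType R) (Omega : set 'rV[R]_k)
    (f : 'I_N -> 'rV[R]_k -> 'rV[R]_k) (g : 'I_N -> 'rV[R]_k -> Kf)
    (h0 : 'rV[R]_k -> Kf) (K L : nat) : Prop :=
  (forall n, vmeasurable Omega (f n)) /\
  (forall n, ae_on Omega (approx_differentiable Omega (f n))) /\
  (forall n, luzin_N Omega (f n)) /\
  (forall n, null_preimages Omega (f n)) /\
  (forall n, leb_null (many_preimages Omega (f n) K)) /\
  (forall n, kmeasurable Omega (g n)) /\ kmeasurable Omega h0 /\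
  is_L Omega f L.

Definition opP (k N : nat) (Kf : normedZmodType R) (mul : Kf -> Kf -> Kf)
    (f : 'I_N -> 'rV[R]_k -> 'rV[R]_k) (g : 'I_N -> 'rV[R]_k -> Kf)
    (phi : 'rV[R]_k -> Kf) : 'rV[R]_k -> Kf :=
  fun x => \sum_(n < N) mul (g n x) (phi (f n x)).

Definition partial_sum (k N : nat) (Kf : normedZmodType R) (mul : Kf -> Kf -> Kf)
    (f : 'I_N -> 'rV[R]_k -> 'rV[R]_k) (g : 'I_N -> 'rV[R]_k -> Kf)
    (h0 : 'rV[R]_k -> Kf) (j m : nat) : 'rV[R]_k -> Kf :=
  fun x => \sum_(j <= i < j + m) iter i (opP mul f g) h0 x.

Definition solves (k N : nat) (Kf : normedZmodType R) (mul : Kf -> Kf -> Kf)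
    (Omega : set 'rV[R]_k)
    (f : 'I_N -> 'rV[R]_k -> 'rV[R]_k) (g : 'I_N -> 'rV[R]_k -> Kf)
    (h0 : 'rV[R]_k -> Kf) (phi : 'rV[R]_k -> Kf) : Prop :=
  ae_on Omega (fun x => phi x = opP mul f g phi x + h0 x).

Definition tail_converges (psi : R -> R) (k N : nat) (Kf : normedZmodType R)
    (mul : Kf -> Kf -> Kf) (Omega : set 'rV[R]_k)
    (f : 'I_N -> 'rV[R]_k -> 'rV[R]_k) (g : 'I_N -> 'rV[R]_k -> Kf)
    (h0 : 'rV[R]_k -> Kf) (j : nat) (T : 'rV[R]_k -> Kf) : Prop :=
  (fun m => lorentz_norm psi Omega (fun x => T x - partial_sum mul f g h0 j m x))
    @ \oo --> 0%E.

Definition theorem3p6_claim (Kf : normedZmodType R) (mul : Kf -> Kf -> Kf) : Prop :=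
  forall (k N : nat) (Omega : set 'rV[R]_k)
    (f : 'I_N -> 'rV[R]_k -> 'rV[R]_k) (g : 'I_N -> 'rV[R]_k -> Kf)
    (h0 : 'rV[R]_k -> Kf) (K L : nat) (psi : R -> R) (alpha : R),
  (0 < k)%N -> (0 < N)%N -> (0 < K)%N ->
  open Omega ->
  (forall n x, Omega x -> Omega (f n x)) ->
  hypH Omega f g h0 K L ->
  admissible_psi psi ->
  in_Lpsi1 psi Omega h0 ->
  0 <= alpha -> alpha < 2^-1 ->
  (forall n, ae_on Omega (fun x =>
     `|g n x| <= alpha * Num.min (`|jacobian Omega (f n) x| / (K * L)%:R) (N%:R^-1))) ->
  (exists phi, [/\ in_Lpsi1 psi Omega phi,
                   tail_converges psi mul Omega f g h0 0 phi
                 & solves mul Omega f g h0 phi])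
  /\
  (forall phi1 phi2, in_Lpsi1 psi Omega phi1 -> in_Lpsi1 psi Omega phi2 ->
     tail_converges psi mul Omega f g h0 0 phi1 ->
     solves mul Omega f g h0 phi2 ->
     ae_on Omega (fun x => phi1 x = phi2 x))
  /\
  (forall j : nat,
     (exists T, in_Lpsi1 psi Omega T /\ tail_converges psi mul Omega f g h0 j T) /\
     forall T, in_Lpsi1 psi Omega T -> tail_converges psi mul Omega f g h0 j T ->
       (lorentz_norm psi Omega T <=
          ((2 * alpha) ^+ j / (1 - 2 * alpha))%:E * lorentz_norm psi Omega h0)%E).

End Defs.

(* Main.v *)
Require Import Defs.
From HB Require Import structures.
From mathcomp Require Import all_boot all_order all_algebra fingroup perm complex.
From mathcomp Require Import all_classical all_reals all_analysis.
From mathcomp Require Import measurable_realfun ring lra.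
Import Order.TTheory GRing.Theory Num.Theory.
Import numFieldNormedType.Exports.

(** Write [phi] for the inverse of [tau] and [||f||] for the integral of
    [phi (mu_f)]. As [phi] need not be concave, [||.||] need not be subadditive;
    but [phi] is nondecreasing and [phi t / t] nonincreasing, so that, for
    [0 <= w <= M] and every [b > 0],
      [||h + w|| <= ||h|| + M phi(b) + (phi(b) / b) int w],
    because [h] and [h + w] have distribution functions which differ by a shift
    of at most [M] and by an area of at most [int w]. Let [||v||_*] be the
    infimum of [sum_j (M_j phi(b_j) + (phi(b_j) / b_j) int w_j)] over the
    decompositions [v <= sum_j w_j] into bounded layers [0 <= w_j <= M_j], so
    that [||h + v|| <= ||h|| + ||v||_*]. Cutting [v] along the levels [q ^ z],
    with [b_j] the measure of a level set, and letting [q] tend to [1] gives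
    [||v||_* <= 2 ||v||].

    The cost of a layer is linear in its [L^infty] bound and its [L^1] norm, and
    the operator [P] contracts both by [alpha]: the first because
    [|g_n| <= alpha / N], the second by the area formula (only the inequality is
    needed), because [|g_n| <= alpha |J_{f_n}| / (K L)] while a point of [Omega]
    is in at most [L] of the images [f_n(Omega)] and has at most [K] preimages
    in each. Hence [||P^i h_0||_* <= 2 alpha^i ||h_0||], which gives the
    convergence of the series, the estimates of its tails and, since a solution
    [v] differs from the partial sums by [P^i v], uniqueness.

    For the area inequality, almost all of [{J_f <> 0}] is covered by countably
    many measurable pieces on which [f] is Lipschitz and so close to an
    invertible rational matrix [A] that it expands volumes by nearly
    [|det A|]. *)

Set Implicit Arguments.
Unset Strict Implicit.
Unset Printing Implicit Defensive.

Local Open Scope ring_scope.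
Local Open Scope classical_set_scope.

Section extended_reals.
Context {R : realType}.
Local Open Scope ereal_scope.
Implicit Types (x y : \bar R) (u : (\bar R)^nat).

Lemma lee_mulgt1 x y : 0 <= y ->
  (forall r, (1 < r)%R -> x <= r%:E * y) -> x <= y.
Proof.
move=> y0 xry; have [x0|/ltW x0] := leP 0 x; last exact: le_trans y0.
apply/(lee_mul01Pr _ x0) => r /andP[r0 r1].
by rewrite -lee_pdivlMl//; apply: xry; rewrite invf_gt1.
Qed.

Lemma exprn_root_gt1 (r : R) n : (1 < r)%R -> exists2 q, (1 < q)%R & (q ^+ n.+1 = r)%R.
Proof.
move=> r1; exists (expR (ln r / n.+1%:R)); first by rewrite expR_gt1 divr_gt0// ln_gt0.
by rewrite -expRM_natr mulfVK// lnK// posrE (lt_trans ltr01).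
Qed.

Lemma lee_mulgt1X n x y : 0 <= y ->
  (forall q, (1 < q)%R -> x <= (q ^+ n.+1)%:E * y) -> x <= y.
Proof.
move=> y0 xqy; apply: lee_mulgt1 => // r /(exprn_root_gt1 n)[q q1 <-].
exact: xqy.
Qed.

Lemma nondecreasing_cvge_le u l n : nondecreasing_seq u -> u @ \oo --> l -> u n <= l.
Proof.
by move=> ndu ul; apply: (cvge_ge _ ul); exists n => // m /= nm; exact: ndu.
Qed.

Lemma cvge_exists_gt u l (t : R) : u @ \oo --> l -> t%:E < l ->
  exists n, t%:E < u n.
Proof.
move=> ul tl; apply: contrapT => /forallNP ut; move: tl; apply/negP.
by rewrite -leNgt; apply: (cvge_le _ ul); apply: nearW => n; rewrite leNgt; apply/negP.
Qed.

Lemma cvge0_squeeze u (v : (\bar R)^nat) : (forall n, 0 <= v n) -> (forall n, v n <= u n) ->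
  u @ \oo --> 0 -> v @ \oo --> 0.
Proof.
move=> v0 vu u0; apply: squeeze_cvge u0; last exact: cvg_cst.
by apply: nearW => n; rewrite v0 vu.
Qed.

Lemma cvge_le0_eq0 u x : 0 <= x -> (forall n, x <= u n) -> u @ \oo --> 0 -> x = 0.
Proof.
move=> x0 xu u0; apply/eqP; rewrite eq_le x0 andbT.
by apply: (cvge_ge _ u0); exact: nearW.
Qed.

End extended_reals.

(** * Lorentz functionals of quasi-concave functions *)

Section quasiconcave.
Context {R : realType}.

Record quasiconcave (phi : R -> R) : Prop := QuasiConcave {
  quasiconcave0 : phi 0 = 0;
  quasiconcave_gt0 : forall t, 0 < t -> 0 < phi t;
  quasiconcave_le : forall s t, 0 <= s -> s <= t -> phi s <= phi t;
  quasiconcave_ratio : forall a b, 0 < b -> b <= a -> phi a * b <= phi b * a;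
  quasiconcave_unbounded : forall M, exists2 t, 0 <= t & M <= phi t }.

Variable phi : R -> R.
Hypothesis qc : quasiconcave phi.

Lemma quasiconcave_slope_ge0 b : 0 < b -> 0 <= phi b / b.
Proof. by move=> b0; rewrite divr_ge0 ?ltW// quasiconcave_gt0. Qed.

Lemma quasiconcave_increment_slope b x c : 0 < b -> b <= x -> x <= c ->
  phi c - phi x <= (c - x) * (phi b / b).
Proof.
move=> b0 bx xc; have x0 : 0 < x by exact: lt_le_trans bx.
apply: (@le_trans _ _ ((c - x) * (phi x / x))).
  by rewrite mulrA ler_pdivlMr//; have := quasiconcave_ratio qc x0 xc; nra.
rewrite ler_wpM2l ?subr_ge0// ler_pdivrMr// mulrAC ler_pdivlMr//.
exact: quasiconcave_ratio.
Qed.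

Lemma quasiconcave_increment a b c : 0 < b -> 0 <= a -> a <= c ->
  phi c + phi (Num.min a b) <= phi a + phi (Num.min c b) + (c - a) * (phi b / b).
Proof.
move=> b0 a0 ac; have slope0 := quasiconcave_slope_ge0 b0.
have [cb|bc] := leP c b.
  by rewrite (min_idPl (le_trans ac cb)) addrC lerDl mulr_ge0// subr_ge0.
have [ab|ba] := leP a b; last first.
  by have := quasiconcave_increment_slope b0 (ltW ba) ac; lra.
have increment_b := quasiconcave_increment_slope b0 (lexx b) (ltW bc).
have : (c - b) * (phi b / b) <= (c - a) * (phi b / b) by rewrite ler_wpM2r// lerB.
lra.
Qed.

Local Open Scope ereal_scope.

Lemma quasiconcave_er_map_ge0 u : 0 <= u -> 0 <= er_map phi u.
Proof.
by case: u => //= r; rewrite !lee_fin -{2}(quasiconcave0 qc); exact: quasiconcave_le.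
Qed.

Lemma quasiconcave_er_map_gt0 u : 0 < u -> 0 < er_map phi u.
Proof. by case: u => //= r; rewrite !lte_fin; exact: quasiconcave_gt0. Qed.

Lemma quasiconcave_er_map_le u v : 0 <= u -> u <= v -> er_map phi u <= er_map phi v.
Proof.
case: u => [r| |] //; case: v => [s| |] //=; rewrite ?lee_fin ?leey //.
exact: quasiconcave_le.
Qed.

Lemma quasiconcave_er_map_increment (u v d : \bar R) (b : R) :
  (0 < b)%R -> 0 <= u -> u <= v -> 0 <= d -> v <= u + d ->
  er_map phi v + er_map phi (mine u b%:E) <=
  er_map phi u + er_map phi (mine v b%:E) + d * (phi b / b)%:E.
Proof.
move=> b0 u0 uv d0 vud.
have slope0 : (0 < phi b / b)%R by rewrite divr_gt0// quasiconcave_gt0.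
have min0 : 0 <= er_map phi (mine v b%:E).
  by apply: quasiconcave_er_map_ge0; rewrite le_min (le_trans u0)//= lee_fin ltW.
have slope_d0 : 0 <= d * (phi b / b)%:E by rewrite mule_ge0// lee_fin ltW.
case: u u0 uv vud => [u| |]// u0 uv vud; last first.
  by rewrite /= !addye ?leey// gt_eqF// (lt_le_trans ltNy0).
case: d d0 vud slope_d0 => [d| |]// d0 vud slope_d0; last first.
  rewrite gt0_mulye ?lte_fin// addey ?leey// gt_eqF//.
  by rewrite (lt_le_trans ltNy0)// adde_ge0// quasiconcave_er_map_ge0.
case: v uv vud min0 => [v| |]// uv vud _; rewrite -!EFin_min /= -EFinM -!EFinD lee_fin.
rewrite !lee_fin in u0 d0 uv; rewrite -EFinD lee_fin in vud.
apply: (le_trans (quasiconcave_increment b0 u0 uv)).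
by rewrite lerD2l (ler_wpM2r (ltW slope0))// lerBlDl.
Qed.

Lemma quasiconcave_er_map_lim_le (u : (\bar R)^nat) l c : (forall n, 0 <= u n) ->
  u @ \oo --> l -> (forall n, er_map phi (u n) <= c) -> er_map phi l <= c.
Proof.
move=> u0 ul uc; have l0 : 0 <= l by apply: cvge_ge ul; exact: nearW.
have c0 : 0 <= c by apply: le_trans (uc 0%N); exact: quasiconcave_er_map_ge0.
have below (t : R) : (0 <= t)%R -> t%:E < l -> (phi t)%:E <= c.
  move=> t0 /(cvge_exists_gt ul)[n tn]; apply: le_trans (uc n).
  by apply: (quasiconcave_er_map_le (u := t%:E)) => //; exact: ltW.
case: l l0 below {ul} => [r| |]// l0 below.
  move: l0; rewrite lee_fin le_eqVlt => /predU1P[<-|r0].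
    by rewrite /= (quasiconcave0 qc).
  apply/lee_mul01Pr; first by rewrite /= lee_fin ltW// quasiconcave_gt0.
  move=> q /andP[q0 q1]; have qr0 : (0 < q * r)%R by rewrite mulr_gt0.
  have qr : (q * r < r)%R by rewrite gtr_pMl.
  apply: le_trans (below (q * r)%R (ltW qr0) _); last by rewrite lte_fin.
  rewrite /= -EFinM lee_fin -(ler_pM2r r0) mulrAC mulrC mulrA.
  by have := quasiconcave_ratio qc qr0 (ltW qr); lra.
case: c c0 below {uc} => [c| |]// c0 below.
have [t t0 ct] := quasiconcave_unbounded qc (c + 1)%R.
have := below t t0 (ltry _); rewrite lee_fin => /(le_trans ct).
by rewrite gerDl ler10.
Qed.

Lemma cvg_quasiconcave_er_map (u : (\bar R)^nat) l : (forall n, 0 <= u n) ->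
  nondecreasing_seq u -> u @ \oo --> l ->
  er_map phi (u n) @[n --> \oo] --> er_map phi l.
Proof.
move=> u0 ndu ul.
have ndphi : nondecreasing_seq (er_map phi \o u).
  by move=> m n mn; apply: quasiconcave_er_map_le => //; exact: ndu.
have sup_cvg := ereal_nondecreasing_cvgn ndphi.
rewrite (_ : er_map phi l = ereal_sup (range (er_map phi \o u)))//.
apply/eqP; rewrite eq_le; apply/andP; split.
  by apply: (quasiconcave_er_map_lim_le u0 ul) => n; apply: ereal_sup_ubound; exists n.
apply: ge_ereal_sup => _ [n _ <-] /=; apply: quasiconcave_er_map_le => //.
exact: nondecreasing_cvge_le.
Qed.

End quasiconcave.

Section real_line.
Context {R : realType}.
Local Open Scope ereal_scope.
Local Notation leb := (@lebesgue_measure R).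

Lemma nonincreasing_emeasurable (f : R -> \bar R) :
  (forall s t, (s <= t)%R -> f t <= f s) -> measurable_fun [set: R] f.
Proof.
move=> fni; apply: (measurability _ (ErealGenOInfty.measurableE R)).
move=> /= _ [_ [r ->] <-].
rewrite setTI; apply: is_interval_measurable => s t/=.
rewrite !in_itv/= !andbT => fs ft u /andP[su ut].
by rewrite in_itv/= andbT (lt_le_trans ft)// fni.
Qed.

Lemma ge0_integral_itvy_shift (f : R -> \bar R) (M : R) : measurable_fun setT f ->
  (forall s, 0 <= f s) ->
  \int[leb]_(s in `[M, +oo[) f (s - M)%R = \int[leb]_(s in `[0%R, +oo[) f s.
Proof.
move=> mf f0.
pose shift : R -> measurableTypeR R := fun s => (s - M)%R.
have mshift : measurable_fun [set: R] shift by exact: measurable_funB.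
rewrite (_ : `[M, +oo[%classic = shift @^-1` `[0%R, +oo[); last first.
  by apply/seteqP; split => s /=; rewrite !in_itv/= !andbT subr_ge0.
transitivity (\int[pushforward leb shift]_(y in `[0%R, +oo[) f y).
  by rewrite ge0_integral_pushforward//; exact: measurable_funTS.
apply: eq_measure_integral => //= A mA _.
apply/esym/lebesgue_measure_unique => //= _ [[a b]] _ <-.
rewrite /pushforward (_ : shift @^-1` _ = `](a + M)%R, (b + M)%R]%classic); last first.
  by apply/seteqP; split => s /=; rewrite !in_itv/= /shift ltrBrDr lerBlDr.
rewrite !lebesgue_measure_itv/= !lte_fin ltrD2r; case: ifPn => // _.
by rewrite -!EFinD; congr EFin; ring.
Qed.

Lemma integral_cst_itv0 (c : \bar R) (M : R) (b : bool) : (0 <= M)%R ->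
  \int[leb]_(s in [set` Interval (BLeft 0%R) (BSide b M)]) c = M%:E * c.
Proof.
move=> M0; rewrite integral_cst//.
rewrite [X in _ * X](lebesgue_measure_itv (Interval (BLeft 0%R) (BSide b M)))/= lte_fin.
case: ltP => [_|M0']; first by rewrite sube0 muleC.
by rewrite (@le_anti _ _ M 0%R) ?M0 ?M0'// mul0e mule0.
Qed.

End real_line.

Section distribution_integral.
Context d (T : measurableType d) {R : realType}.
Variable mu : {measure set T -> \bar R}.
Local Open Scope ereal_scope.
Local Notation leb := (@lebesgue_measure R).
Implicit Types (v w h : T -> \bar R) (F : \bar R -> \bar R).

Definition distr w (s : R) : \bar R := mu [set x | s%:E < w x].

Lemma distr_ge0 w s : 0 <= distr w s. Proof. exact: measure_ge0. Qed.

Lemma measurable_superlevel w s : measurable_fun setT w ->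
  measurable [set x | s%:E < w x].
Proof.
by move=> mw; rewrite -[X in measurable X]setTI; exact: emeasurable_fun_o_infty.
Qed.

Lemma distr_nonincreasing w s t : measurable_fun setT w -> (s <= t)%R ->
  distr w t <= distr w s.
Proof.
move=> mw st; apply: le_measure; rewrite ?inE//; try exact: measurable_superlevel.
by move=> x /=; apply: le_lt_trans; rewrite lee_fin.
Qed.

Lemma distr_ae_le v w s : measurable_fun setT v -> measurable_fun setT w ->
  {ae mu, forall x, v x <= w x} -> distr v s <= distr w s.
Proof.
move=> mv mw [N [mN N0 vwN]]; have mws := measurable_superlevel s mw.
rewrite -[leRHS]adde0 -[X in _ + X](N0 : mu N = 0).
apply: le_trans (measureU2 mu mws mN).
apply: le_measure; rewrite ?inE//; [exact: measurable_superlevel|exact: measurableU|].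
move=> x /= sv; have [vw|/negP vw] := boolP (v x <= w x); last by right; exact: vwN.
by left => /=; exact: lt_le_trans vw.
Qed.

Lemma distrD_le h w (M s : R) : measurable_fun setT h -> measurable_fun setT w ->
  (forall x, 0 <= w x <= M%:E) -> distr (h \+ w) s <= distr h (s - M).
Proof.
move=> mh mw wM; apply: le_measure; rewrite ?inE; try exact: measurable_superlevel.
  by apply: measurable_superlevel; exact: emeasurable_funD.
move=> x /= shw; rewrite EFinB lteBlDr//; apply: (lt_le_trans shw).
by rewrite leeD2l//; case/andP: (wM x).
Qed.

Record ge0_nondecreasing F : Prop := Ge0Nondecreasing {
  ge0_nondecreasing_ge0 : forall x, 0 <= x -> 0 <= F x;
  ge0_nondecreasing_le : forall x y, 0 <= x -> x <= y -> F x <= F y }.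

Definition distr_integral F w := \int[leb]_(s in `[0%R, +oo[) F (distr w s).

Variable F : \bar R -> \bar R.
Hypothesis ndF : ge0_nondecreasing F.

Lemma comp_distr_ge0 w s : 0 <= F (distr w s).
Proof. by apply: (ge0_nondecreasing_ge0 ndF); exact: distr_ge0. Qed.

Hint Resolve comp_distr_ge0 : core.

Lemma comp_distr_nonincreasing w s t : measurable_fun setT w -> (s <= t)%R ->
  F (distr w t) <= F (distr w s).
Proof.
move=> mw st; apply: (ge0_nondecreasing_le ndF); first exact: distr_ge0.
exact: distr_nonincreasing.
Qed.

Lemma measurable_comp_distr w : measurable_fun setT w ->
  measurable_fun setT (fun s => F (distr w s)).
Proof.
by move=> mw; apply: nonincreasing_emeasurable => s t; exact: comp_distr_nonincreasing.
Qed.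

Lemma distr_integral_ge0 w : 0 <= distr_integral F w.
Proof. by apply: integral_ge0. Qed.

Lemma distr_integral_ae_le v w : measurable_fun setT v -> measurable_fun setT w ->
  {ae mu, forall x, v x <= w x} -> distr_integral F v <= distr_integral F w.
Proof.
move=> mv mw vw; apply: ge0_le_integral => //.
- by apply: measurable_funTS; exact: measurable_comp_distr.
- by apply: measurable_funTS; exact: measurable_comp_distr.
- by move=> s _; apply: (ge0_nondecreasing_le ndF); [exact: distr_ge0|exact: distr_ae_le].
Qed.

Lemma distr_integral_markov w s : measurable_fun setT w -> (0 <= s)%R ->
  s%:E * F (distr w s) <= distr_integral F w.
Proof.
move=> mw s0.
have mFw D : measurable_fun D (fun t => F (distr w t)).
  by apply: measurable_funTS; exact: measurable_comp_distr.
apply: (@le_trans _ _ (\int[leb]_(t in `[0%R, s]) F (distr w t))).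
  rewrite -(@integral_cst_itv0 _ _ _ false)//.
  apply: ge0_le_integral => //; first exact: mFw.
  by move=> t; rewrite /= in_itv/= => /andP[_ ts]; exact: comp_distr_nonincreasing.
apply: ge0_subset_integral => //; first exact: mFw.
by move=> t /=; rewrite !in_itv/= andbT => /andP[].
Qed.

Lemma distr_integralD_le h w (M : R) C : measurable_fun setT h ->
  measurable_fun setT w -> (forall x, 0 <= w x <= M%:E) -> (0 <= M)%R ->
  (forall x, 0 <= x -> F x <= C) ->
  distr_integral F (h \+ w) <= M%:E * C + distr_integral F h.
Proof.
move=> mh mw wM M0 FC.
have mhw : measurable_fun setT (h \+ w) by exact: emeasurable_funD.
have mF v D : measurable_fun setT v -> measurable_fun D (fun s => F (distr v s)).
  by move=> mv; apply: measurable_funTS; exact: measurable_comp_distr.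
have -> : distr_integral F (h \+ w) =
    \int[leb]_(s in `[0%R, M[ `|` `[M, +oo[) F (distr (h \+ w) s).
  by rewrite -itv_bndbnd_setU ?bnd_simp.
rewrite ge0_integral_setU//; first last.
- apply/disj_setPS => s /= []; rewrite !in_itv/= andbT => /andP[_ sM].
  by rewrite leNgt sM.
- exact: mF.
apply: leeD.
  rewrite -(@integral_cst_itv0 _ _ _ true)//; apply: ge0_le_integral => //.
  - exact: mF.
  - by move=> s _; apply: FC; exact: distr_ge0.
rewrite [leRHS]/distr_integral.
rewrite -(ge0_integral_itvy_shift M (measurable_comp_distr mh) (comp_distr_ge0 h)).
apply: ge0_le_integral => //.
- exact: mF.
- apply: measurable_funTS; apply: nonincreasing_emeasurable => s t st.
  by apply: comp_distr_nonincreasing => //; rewrite lerB.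
- by move=> s _; apply: (ge0_nondecreasing_le ndF); [exact: distr_ge0|exact: distrD_le].
Qed.

End distribution_integral.

Section superlevel_areas.
Context d (T : measurableType d) {R : realType}.
Variable mu : {sigma_finite_measure set T -> \bar R}.
Local Open Scope ereal_scope.
Local Notation leb := (@lebesgue_measure R).
Implicit Types (w h : T -> \bar R).

Lemma integral_ysection_xsection (A : set (T * R)) : measurable A ->
  \int[leb]_s mu (ysection A s) = \int[mu]_x leb (xsection A x).
Proof.
move=> mA; have := indic_fubini_tonelli mu leb mA.
by rewrite indic_fubini_tonelli_FE// indic_fubini_tonelli_GE.
Qed.

Lemma measurable_lt_graph (D : set (T * R)) w : measurable D -> measurable_fun setT w ->
  measurable (D `&` [set z | (z.2)%:E < w z.1]).
Proof.
move=> mD mw; apply: measurable_lte => //.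
  by apply: measurable_funTS; apply/measurable_EFinP; exact: measurable_snd.
by apply: measurable_funTS; exact: measurableT_comp.
Qed.

Definition shell h w : set (T * R) := [set z | h z.1 <= (z.2)%:E < h z.1 + w z.1].

Definition shell_measure h w (s : R) := mu (ysection (shell h w) s).

Lemma measurable_shell h w : measurable_fun setT h -> measurable_fun setT w ->
  measurable (shell h w).
Proof.
move=> mh mw; rewrite (_ : shell h w =
    ([set: T * R] `\` [set z | (z.2)%:E < h z.1]) `&` [set z | (z.2)%:E < (h \+ w) z.1]).
  apply: (measurable_lt_graph (w := h \+ w)); last exact: emeasurable_funD.
  apply: measurableD => //; rewrite -[X in measurable X]setTI.
  exact: measurable_lt_graph.
apply/seteqP; split => z; rewrite /shell /=; first by rewrite leNgt => /andP[/negP].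
by move=> [[_ /negP]]; rewrite -leNgt => -> ->.
Qed.

Lemma measurable_shell_measure h w : measurable_fun setT h -> measurable_fun setT w ->
  measurable_fun setT (shell_measure h w).
Proof. by move=> mh mw; apply: measurable_fun_ysection; exact: measurable_shell. Qed.

Lemma distr_le_shell h w s : measurable_fun setT h -> measurable_fun setT w ->
  distr mu (h \+ w) s <= distr mu h s + shell_measure h w s.
Proof.
move=> mh mw; have mhs := measurable_superlevel s mh.
have mshell := measurable_ysection s (measurable_shell mh mw).
apply: (le_trans _ (measureU2 mu mhs mshell)).
apply: le_measure; rewrite ?inE; last 1 first.
- move=> x /= shw; have [hs|sh] := leP (h x) s%:E; last by left.
  by right; rewrite /ysection /= inE /shell /= hs.
- by apply: measurable_superlevel; exact: emeasurable_funD.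
- exact: measurableU.
Qed.

Lemma integral_shell_measure_le h w : measurable_fun setT h -> measurable_fun setT w ->
  (forall x, 0 <= h x) -> (forall x, 0 <= w x) ->
  \int[leb]_(s in `[0%R, +oo[) shell_measure h w s <= \int[mu]_x w x.
Proof.
move=> mh mw h0 w0; have mA := measurable_shell mh mw.
apply: (@le_trans _ _ (\int[leb]_s shell_measure h w s)).
  by apply: ge0_subset_integral => //; exact: measurable_shell_measure.
rewrite integral_ysection_xsection//; apply: ge0_le_integral => //.
  exact: measurable_fun_xsection.
move=> x _; rewrite (_ : xsection _ x = [set s | h x <= s%:E < h x + w x]); last first.
  by apply/seteqP; split => s; rewrite /xsection /= inE.
have := h0 x; case: (h x) => [r| |]// r0; last first.
  by rewrite [X in leb X](_ : _ = set0) ?measure0//; apply/seteqP; split.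
have := w0 x; case: (w x) => [t| |]// t0; last by rewrite leey.
rewrite (_ : [set s | _] = `[r, (r + t)%R[%classic); last first.
  by apply/seteqP; split => s /=; rewrite in_itv/= -EFinD !lee_fin lte_fin.
rewrite [leLHS](lebesgue_measure_itv (Interval (BLeft r) (BLeft (r + t)%R)))/= lte_fin.
by case: ifPn => // _; rewrite -EFinD addrAC subrr add0r.
Qed.

End superlevel_areas.

Section lorentz.
Context d (T : measurableType d) {R : realType}.
Variable mu : {sigma_finite_measure set T -> \bar R}.
Variable phi : R -> R.
Hypothesis qc : quasiconcave phi.
Local Open Scope ereal_scope.
Local Notation leb := (@lebesgue_measure R).
Implicit Types (v w h : T -> \bar R).

Definition lorentz w : \bar R := distr_integral mu (er_map phi) w.

Lemma ge0_nondecreasing_er_map : ge0_nondecreasing (er_map phi).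
Proof.
by split; [exact: quasiconcave_er_map_ge0|exact: quasiconcave_er_map_le].
Qed.

Lemma ge0_nondecreasing_er_map_min b : (0 < b)%R ->
  ge0_nondecreasing (fun u => er_map phi (mine u b%:E)).
Proof.
move=> b0; have min0 u : 0 <= u -> 0 <= mine u b%:E.
  by rewrite le_min lee_fin (ltW b0) andbT.
split=> [u|u v] /min0 u0; first exact: quasiconcave_er_map_ge0.
by move=> uv; apply: quasiconcave_er_map_le => //; rewrite le_min !ge_min uv lexx orbT.
Qed.

Lemma lorentz_ge0 w : 0 <= lorentz w.
Proof. exact: (distr_integral_ge0 _ ge0_nondecreasing_er_map). Qed.

Lemma lorentz_ae_le v w : measurable_fun setT v -> measurable_fun setT w ->
  {ae mu, forall x, v x <= w x} -> lorentz v <= lorentz w.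
Proof. exact: (distr_integral_ae_le ge0_nondecreasing_er_map). Qed.

Lemma lorentz_markov w s : measurable_fun setT w -> (0 <= s)%R ->
  s%:E * er_map phi (distr mu w s) <= lorentz w.
Proof. exact: (distr_integral_markov _ ge0_nondecreasing_er_map). Qed.

Lemma lorentz0 : lorentz (cst 0) = 0.
Proof.
apply: integral0_eq => s; rewrite /= in_itv/= andbT => s0.
rewrite /distr (_ : [set _ | _] = set0) ?measure0 /= ?(quasiconcave0 qc)//.
by apply/seteqP; split => x //=; rewrite lte_fin ltNge s0.
Qed.

Lemma cvg_distr (w : nat -> T -> \bar R) l s :
  (forall n, measurable_fun setT (w n)) -> (forall x, nondecreasing_seq (w ^~ x)) ->
  (forall x, w n x @[n --> \oo] --> l x) ->
  distr mu (w n) s @[n --> \oo] --> distr mu l s.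
Proof.
move=> mw ndw wl; rewrite /distr.
have -> : [set x | s%:E < l x] = \bigcup_n [set x | s%:E < w n x].
  apply/seteqP; split => x /=; first by move=> /(cvge_exists_gt (wl x))[n sn]; exists n.
  by move=> [n _ /= /lt_le_trans]; apply; exact: (nondecreasing_cvge_le n (ndw x)).
apply: nondecreasing_cvg_mu.
- by move=> n; exact: measurable_superlevel.
- by apply: bigcup_measurable => n _; exact: measurable_superlevel.
- by move=> m n mn; apply/subsetPset => x /= /lt_le_trans; apply; exact: ndw.
Qed.

Lemma cvg_lorentz (w : nat -> T -> \bar R) l :
  (forall n, measurable_fun setT (w n)) -> (forall x, nondecreasing_seq (w ^~ x)) ->
  (forall x, w n x @[n --> \oo] --> l x) ->
  lorentz (w n) @[n --> \oo] --> lorentz l.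
Proof.
move=> mw ndw wl.
have nd_distr s : nondecreasing_seq (fun n => distr mu (w n) s).
  by move=> m n mn; apply: distr_ae_le => //; apply: aeW => x; exact: ndw.
have -> : lorentz l = \int[leb]_(s in `[0%R, +oo[)
    limn (fun n => er_map phi (distr mu (w n) s)).
  apply: eq_integral => s _; apply/esym/cvg_lim => //.
  have := cvg_quasiconcave_er_map qc _ (nd_distr s) (cvg_distr mw ndw wl).
  by apply=> n; exact: distr_ge0.
apply: cvg_monotone_convergence => //.
- move=> n; apply: measurable_funTS.
  exact: (measurable_comp_distr _ ge0_nondecreasing_er_map).
- by move=> n s _; exact: (comp_distr_ge0 _ ge0_nondecreasing_er_map).
- move=> s _ m n mn; apply: (quasiconcave_er_map_le qc); first exact: distr_ge0.
  exact: nd_distr.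
Qed.

Definition lorentz_trunc b w : \bar R :=
  distr_integral mu (fun u => er_map phi (mine u b%:E)) w.

Lemma lorentz_trunc_fin_num h (b : R) : measurable_fun setT h -> (0 < b)%R ->
  lorentz h < +oo -> lorentz_trunc b h \is a fin_num.
Proof.
move=> mh b0 hfin; have nd_trunc := ge0_nondecreasing_er_map_min b0.
rewrite ge0_fin_numE ?distr_integral_ge0//.
apply: le_lt_trans hfin; apply: ge0_le_integral => //.
- by move=> s _; exact: (comp_distr_ge0 _ nd_trunc).
- by apply: measurable_funTS; exact: (measurable_comp_distr _ nd_trunc).
- apply: measurable_funTS; exact: (measurable_comp_distr _ ge0_nondecreasing_er_map).
- move=> s _; apply: (quasiconcave_er_map_le qc); last by rewrite ge_min lexx.
  by rewrite le_min distr_ge0 lee_fin ltW.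
Qed.

Lemma lorentz_truncD_le h w (M b : R) : measurable_fun setT h ->
  measurable_fun setT w -> (forall x, 0 <= w x <= M%:E) -> (0 <= M)%R -> (0 < b)%R ->
  lorentz_trunc b (h \+ w) <= lorentz_trunc b h + (M * phi b)%:E.
Proof.
move=> mh mw wM M0 b0; rewrite addeC EFinM.
apply: (distr_integralD_le _ (ge0_nondecreasing_er_map_min b0)) => // u u0.
apply: (quasiconcave_er_map_le qc (v := b%:E)); last by rewrite ge_min lexx orbT.
by rewrite le_min u0 lee_fin ltW.
Qed.

Lemma lorentzD_shell_le h w (b : R) : measurable_fun setT h ->
  measurable_fun setT w -> (forall x, 0 <= w x) -> (0 < b)%R ->
  lorentz (h \+ w) + lorentz_trunc b h <=
  lorentz h + lorentz_trunc b (h \+ w) +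
  (phi b / b)%:E * \int[leb]_(s in `[0%R, +oo[) shell_measure mu h w s.
Proof.
move=> mh mw w0 b0; have slope0 := quasiconcave_slope_ge0 qc b0.
have mhw : measurable_fun setT (h \+ w) by exact: emeasurable_funD.
have nd := ge0_nondecreasing_er_map; have nd_trunc := ge0_nondecreasing_er_map_min b0.
rewrite /lorentz_trunc; set trunc := (fun u => er_map _ _) in nd_trunc *.
have mF F v : ge0_nondecreasing F -> measurable_fun setT v ->
    measurable_fun (`[0%R, +oo[ : set R) (fun s => F (distr mu v s)).
  by move=> ndF mv; apply: measurable_funTS; exact: measurable_comp_distr.
have mshell : measurable_fun (`[0%R, +oo[ : set R) (shell_measure mu h w).
  by apply: measurable_funTS; exact: measurable_shell_measure.
have F0 F v s : ge0_nondecreasing F -> 0 <= F (distr mu v s).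
  by move=> ndF; exact: comp_distr_ge0.
rewrite -ge0_integralZl// -!ge0_integralD//; try by
  [exact: mF|move=> s _; exact: F0|move=> s _; rewrite mule_ge0
  |exact: measurable_funeM|apply: emeasurable_funD; exact: mF
  |move=> s _; apply: adde_ge0; exact: F0].
apply: ge0_le_integral => //.
- by move=> s _; apply: adde_ge0; exact: F0.
- by apply: emeasurable_funD; exact: mF.
- apply: emeasurable_funD; last exact: measurable_funeM.
  by apply: emeasurable_funD; exact: mF.
- move=> s _; rewrite (muleC _ (shell_measure _ _ _ _)).
  apply: (quasiconcave_er_map_increment qc b0).
  + exact: distr_ge0.
  + by apply: distr_ae_le => //; apply: aeW => x /=; exact: leeDl.
  + exact: measure_ge0.
  + exact: distr_le_shell.
Qed.

(* Truncating [phi] at [b] separates the effect of a shift of the distribution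
   function by at most [M] from that of an area of at most [\int w]. *)
Lemma lorentzD_layer_le h w (M b : R) :
  measurable_fun setT h -> measurable_fun setT w ->
  (forall x, 0 <= h x) -> (forall x, 0 <= w x <= M%:E) ->
  (0 <= M)%R -> (0 < b)%R ->
  lorentz (h \+ w) <=
  lorentz h + ((M * phi b)%:E + (phi b / b)%:E * \int[mu]_x w x).
Proof.
move=> mh mw h0 wM M0 b0; have w0 x : 0 <= w x by case/andP: (wM x).
have slope0 := quasiconcave_slope_ge0 qc b0.
have [->|hfin] := eqVneq (lorentz h) +oo.
  rewrite addye ?leey// gt_eqF// (lt_le_trans ltNy0)// adde_ge0//.
    by rewrite lee_fin mulr_ge0// ltW// (quasiconcave_gt0 qc).
  by rewrite mule_ge0// integral_ge0.
have trunc_fin : lorentz_trunc b h \is a fin_num.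
  by apply: lorentz_trunc_fin_num => //; rewrite ltey.
rewrite -(leeD2rE _ _ trunc_fin).
apply: le_trans (lorentzD_shell_le mh mw w0 b0) _.
rewrite [leRHS]addeAC [leRHS]addeA -[X in _ <= X + _]addeA; apply: leeD.
  by rewrite leeD2l// lorentz_truncD_le.
by rewrite lee_wpmul2l// integral_shell_measure_le.
Qed.

End lorentz.

Section lorentz_series.
Context d (T : measurableType d) {R : realType}.
Variable mu : {sigma_finite_measure set T -> \bar R}.
Variable phi : R -> R.
Hypothesis qc : quasiconcave phi.
Local Open Scope ereal_scope.
Local Notation lorentz := (lorentz mu phi).
Implicit Types (h : T -> \bar R) (v : nat -> T -> \bar R).

Lemma lorentzD_nneseries_le h v (c : nat -> \bar R) :
  measurable_fun setT h -> (forall x, 0 <= h x) ->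
  (forall j, measurable_fun setT (v j)) -> (forall j x, 0 <= v j x) ->
  (forall j, 0 <= c j) ->
  (forall j g, measurable_fun setT g -> (forall x, 0 <= g x) ->
     lorentz (g \+ v j) <= lorentz g + c j) ->
  lorentz (fun x => h x + \sum_(0 <= j <oo) v j x) <=
  lorentz h + \sum_(0 <= j <oo) c j.
Proof.
move=> mh h0 mv v0 c0 addv; pose S n x := h x + \sum_(0 <= j < n) v j x.
have mS n : measurable_fun setT (S n).
  by apply: emeasurable_funD => //; exact: emeasurable_sum.
have S0 n x : 0 <= S n x by rewrite adde_ge0// sume_ge0.
have S_le n : lorentz (S n) <= lorentz h + \sum_(0 <= j < n) c j.
  elim: n => [|n IHn].
    rewrite big_nil adde0 (_ : S 0%N = h)//.
    by apply/funext => x; rewrite /S big_nil adde0.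
  have -> : S n.+1 = S n \+ v n.
    by apply/funext => x; rewrite /S big_nat_recr//= addeA.
  by rewrite big_nat_recr//= addeA (le_trans (addv n _ _ _))// leeD2r.
apply: (cvge_le _ (cvg_lorentz qc mS _ _)).
- apply: nearW => n; apply: (le_trans (S_le n)); rewrite leeD2l//.
  by apply: nneseries_lim_ge => j _ _; exact: c0.
- move=> x m n mn; rewrite /S leeD2l//.
  by apply: lee_sum_nneg_natr => // j _ _; exact: v0.
- move=> x; apply: cvgeD; [|exact: cvg_cst|].
    by rewrite ge0_adde_def// inE// nneseries_ge0.
  by apply: is_cvg_nneseries => *; exact: v0.
Qed.

End lorentz_series.

Section lorentz_finite.
Context d (T : measurableType d) {R : realType}.
Variable mu : {sigma_finite_measure set T -> \bar R}.
Variable phi : R -> R.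
Hypothesis qc : quasiconcave phi.
Local Open Scope ereal_scope.
Local Notation distr := (distr mu).
Local Notation lorentz := (lorentz mu phi).
Implicit Types (w : T -> \bar R).

Lemma lorentz_distr_lty w s : measurable_fun setT w -> lorentz w < +oo ->
  (0 < s)%R -> distr w s < +oo.
Proof.
move=> mw wfin s0; rewrite ltNge; apply/negP; rewrite leye_eq => /eqP dy.
have := lorentz_markov mu qc mw (ltW s0).
by rewrite dy /= gt0_muley ?lte_fin// leye_eq => /eqP wy; rewrite wy ltxx in wfin.
Qed.

Lemma lorentz_lty_ae w : measurable_fun setT w -> lorentz w < +oo ->
  {ae mu, forall x, w x < +oo}.
Proof.
move=> mw wfin.
have mwy : measurable [set x | w x = +oo].
  by rewrite -[X in measurable X]setTI; apply: (mw measurableT [set +oo]).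
exists [set x | w x = +oo]; split => //; last first.
  by move=> x /= /negP; rewrite -leNgt leye_eq => /eqP.
apply/eqP; rewrite eq_le measure_ge0 andbT leNgt; apply/negP.
move=> /(quasiconcave_er_map_gt0 qc) phi_gt0.
have markov n : n%:R%:E * er_map phi (mu [set x | w x = +oo]) <= lorentz w.
  apply: le_trans (lorentz_markov mu qc mw (ler0n _ n)).
  rewrite lee_wpmul2l ?lee_fin// (quasiconcave_er_map_le qc)//.
  apply: le_measure; rewrite ?inE//; first exact: measurable_superlevel.
  by move=> x /= ->; rewrite ltry.
have wfn : lorentz w \is a fin_num by rewrite ge0_fin_numE// lorentz_ge0.
case: (er_map phi _) phi_gt0 markov => [p| |]// p0 markov; last first.
  by have := markov 1%N; rewrite mul1e leye_eq => /eqP wy; rewrite wy in wfn.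
rewrite lte_fin in p0.
have := markov (Num.bound (fine (lorentz w) / p)); apply/negP.
rewrite -ltNge -(fineK wfn) -EFinM lte_fin -ltr_pdivrMr// archi_boundP//.
by rewrite divr_ge0 ?fine_ge0 ?lorentz_ge0// ltW.
Qed.

Lemma lorentz_eq0_ae w : measurable_fun setT w -> lorentz w = 0 ->
  {ae mu, forall x, w x <= 0}.
Proof.
move=> mw w0.
have distr0 n : distr w n.+1%:R^-1 = 0.
  have s0 : (0 < n.+1%:R^-1 :> R)%R by rewrite invr_gt0.
  apply/eqP; rewrite eq_le distr_ge0 andbT leNgt; apply/negP.
  move=> /(quasiconcave_er_map_gt0 qc) phi_gt0.
  have := lorentz_markov mu qc mw (ltW s0); rewrite w0.
  by rewrite leNgt mule_gt0// lte_fin.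
apply: (@negligibleS _ _ _ mu (\bigcup_n [set x | n.+1%:R^-1%:E < w x])); last first.
  apply: negligible_bigcup => n; apply/negligibleP; last exact: distr0.
  exact: measurable_superlevel.
move=> x /= /negP; rewrite -ltNge.
case wx : (w x) => [r| |]// r0; last by exists 0%N => //=; rewrite wx ltry.
rewrite lte_fin in r0.
exists (Num.bound r^-1) => //=; rewrite wx lte_fin invf_plt ?posrE//.
by rewrite (lt_trans (archi_boundP _)) ?invr_ge0 ?(ltW r0)// ltr_nat.
Qed.

End lorentz_finite.

Section layer_norm.
Context d (T : measurableType d) {R : realType}.
Variable mu : {sigma_finite_measure set T -> \bar R}.
Variable phi : R -> R.
Hypothesis qc : quasiconcave phi.
Local Open Scope ereal_scope.
Local Notation lorentz := (lorentz mu phi).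
Implicit Types (v h : T -> \bar R) (w : nat -> T -> \bar R) (M b : nat -> R).

Record layering v w M b : Prop := Layering {
  measurable_layer : forall j, measurable_fun setT (w j);
  layer_bounds : forall j x, 0 <= w j x <= (M j)%:E;
  layer_height_ge0 : forall j, (0 <= M j)%R;
  layer_scale_gt0 : forall j, (0 < b j)%R;
  layering_majorizes : {ae mu, forall x, v x <= \sum_(0 <= j <oo) w j x} }.

Definition layer_cost w M b j : \bar R :=
  (M j * phi (b j))%:E + (phi (b j) / b j)%:E * \int[mu]_x w j x.

Definition layer_norm v : \bar R :=
  ereal_inf [set c | exists w M b,
    layering v w M b /\ c = \sum_(0 <= j <oo) layer_cost w M b j].

Lemma layer_ge0 v w M b j x : layering v w M b -> 0 <= w j x.
Proof. by move=> vw; case/andP: (layer_bounds vw j x). Qed.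

Lemma layer_cost_ge0 v w M b j : layering v w M b -> 0 <= layer_cost w M b j.
Proof.
move=> vw; have b0 := layer_scale_gt0 vw j.
apply: adde_ge0; last first.
  apply: mule_ge0; first by rewrite lee_fin quasiconcave_slope_ge0.
  by apply: integral_ge0 => x _; exact: layer_ge0 vw.
by rewrite lee_fin mulr_ge0 ?(layer_height_ge0 vw)// ltW// (quasiconcave_gt0 qc).
Qed.

Lemma layer_norm_le v w M b : layering v w M b ->
  layer_norm v <= \sum_(0 <= j <oo) layer_cost w M b j.
Proof. by move=> vw; apply: ereal_inf_lbound; exists w, M, b. Qed.

Lemma le_layer_norm v x :
  (forall w M b, layering v w M b -> x <= \sum_(0 <= j <oo) layer_cost w M b j) ->
  x <= layer_norm v.
Proof. by move=> vx; apply: le_ereal_inf_tmp => _ [w [M [b [/vx vw ->]]]]. Qed.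

Lemma layer_norm_ge0 v : 0 <= layer_norm v.
Proof.
apply: le_layer_norm => w M b vw; apply: nneseries_ge0 => j _ _.
exact: layer_cost_ge0 vw.
Qed.

Lemma layer_norm_ae_le u v : {ae mu, forall x, u x <= v x} ->
  layer_norm u <= layer_norm v.
Proof.
move=> uv; apply: le_layer_norm => w M b vw; apply: layer_norm_le.
split; [exact: measurable_layer vw|exact: layer_bounds vw
  |exact: layer_height_ge0 vw|exact: layer_scale_gt0 vw|].
by apply: filterS2 uv (layering_majorizes vw) => x; exact: le_trans.
Qed.

Lemma lorentzD_layer_norm_le h v : measurable_fun setT h -> measurable_fun setT v ->
  (forall x, 0 <= h x) -> (forall x, 0 <= v x) ->
  lorentz (h \+ v) <= lorentz h + layer_norm v.
Proof.
move=> mh mv h0 v0.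
have [hfin|hy] := boolP (lorentz h \is a fin_num); last first.
  rewrite ge0_fin_numE ?lorentz_ge0// -leNgt leye_eq in hy; rewrite (eqP hy).
  by rewrite addye ?leey// gt_eqF// (lt_le_trans ltNy0)// layer_norm_ge0.
rewrite -leeBlDl//; apply: le_layer_norm => w M b vw; rewrite leeBlDl//.
have w0 j x : 0 <= w j x by exact: layer_ge0 vw.
apply: le_trans (lorentzD_nneseries_le (c := layer_cost w M b) qc mh h0
  (measurable_layer vw) w0 _ _).
- apply: (lorentz_ae_le qc); first exact: emeasurable_funD.
    apply: emeasurable_funD => //; apply: ge0_emeasurable_sum => // j _.
    exact: measurable_layer vw j.
  by apply: filterS (layering_majorizes vw) => x vx /=; exact: leeD2l.
- by move=> j; exact: layer_cost_ge0 vw.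
- move=> j g mg g0; exact: (lorentzD_layer_le _ qc mg (measurable_layer vw j) g0
    (layer_bounds vw j) (layer_height_ge0 vw j) (layer_scale_gt0 vw j)).
Qed.

Lemma lorentz_le_layer_norm v : measurable_fun setT v -> (forall x, 0 <= v x) ->
  lorentz v <= layer_norm v.
Proof.
move=> mv v0; rewrite -[leRHS]add0e -(lorentz0 mu qc).
apply: le_trans (lorentzD_layer_norm_le (measurable_cst _) mv _ v0) => //.
by rewrite (_ : cst 0 \+ v = v)//; apply/funext => x; rewrite /= add0e.
Qed.

Lemma integral_layer_le v w M b j (A : set T) (a : R) : layering v w M b ->
  measurable A -> mu A <= a%:E -> (0 < a)%R ->
  \int[mu]_(x in A) w j x <= (a / phi a)%:E * layer_cost w M b j.
Proof.
move=> vw mA Aa a0; have b0 := layer_scale_gt0 vw j; have M0 := layer_height_ge0 vw j.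
have mw := measurable_layer vw j; have w0 x : 0 <= w j x by exact: layer_ge0 vw.
have pa := quasiconcave_gt0 qc a0; have pb := quasiconcave_gt0 qc b0.
have ratio0 : (0 <= a / phi a)%R by rewrite divr_ge0// ltW.
have [ab|ba] := leP a (b j).
  apply: (@le_trans _ _ ((a / phi a)%:E * (M j * phi (b j))%:E)); last first.
    rewrite lee_wpmul2l ?lee_fin// leeDl// mule_ge0 ?integral_ge0//.
    by rewrite lee_fin quasiconcave_slope_ge0.
  apply: (@le_trans _ _ ((M j)%:E * mu A)).
    rewrite -integral_cst//; apply: ge0_le_integral => //.
      exact: measurable_funTS.
    by move=> x _; case/andP: (layer_bounds vw j x).
  apply: (@le_trans _ _ ((M j)%:E * a%:E)); first by rewrite lee_wpmul2l// lee_fin.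
  rewrite -!EFinM lee_fin mulrCA ler_wpM2l// mulrAC ler_pdivlMr// ler_wpM2l ?(ltW a0)//.
  exact: (quasiconcave_le qc (ltW a0)).
apply: (@le_trans _ _ ((a / phi a)%:E *
    ((phi (b j) / b j)%:E * \int[mu]_x w j x))); last first.
  by rewrite lee_wpmul2l ?lee_fin// leeDr// lee_fin mulr_ge0// ltW.
apply: (@le_trans _ _ (\int[mu]_x w j x)); first exact: ge0_subset_integral.
rewrite muleA -EFinM -[leLHS]mul1e lee_wpmul2r ?integral_ge0// lee_fin.
rewrite mulf_div ler_pdivlMr ?mulr_gt0// mul1r.
by have := quasiconcave_ratio qc b0 (ltW ba); rewrite [(a * _)%R]mulrC.
Qed.

Lemma layer_norm_lty_integral v A : measurable_fun setT v -> (forall x, 0 <= v x) ->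
  layer_norm v < +oo -> measurable A -> mu A < +oo -> \int[mu]_(x in A) v x < +oo.
Proof.
move=> mv v0 /ereal_inf_lt[_ [w [M [b [vw ->]]]]] cost_fin mA Afin.
pose a := (fine (mu A) + 1)%R.
have a0 : (0 < a)%R by rewrite ltr_wpDl// fine_ge0.
have Aa : mu A <= a%:E by rewrite -[leLHS]fineK ?ge0_fin_numE// lee_fin lerDl.
have mw j : measurable_fun A (w j) by apply: measurable_funTS; exact: measurable_layer vw j.
have w0 j x : 0 <= w j x by exact: layer_ge0 vw.
apply: (@le_lt_trans _ _ (\int[mu]_(x in A) \sum_(0 <= j <oo) w j x)).
  apply: ae_ge0_le_integral => //; first exact: measurable_funTS.
  - by move=> x _; apply: nneseries_ge0.
  - by apply: ge0_emeasurable_sum.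
  - by apply: filterS (layering_majorizes vw).
rewrite integral_nneseries//.
have cost0 j : 0 <= layer_cost w M b j by exact: layer_cost_ge0 vw.
apply: (@le_lt_trans _ _ (\sum_(0 <= j <oo) (a / phi a)%:E * layer_cost w M b j)).
  apply: lee_nneseries => [j _ _|j _]; first exact: integral_ge0.
  exact: integral_layer_le vw mA Aa a0.
by rewrite nneseriesZl// lte_mul_pinfty// lee_fin divr_ge0 ?ltW// quasiconcave_gt0.
Qed.

End layer_norm.

HB.instance Definition _ := isPointed.Build int 0.

Lemma card_int : ([set: int] #= [set: nat])%card.
Proof.
apply: eq_card_nat; first exact: countableP.
by apply/infiniteP/pcard_leTP/injPex; exists Posz => // m n _ _ [].
Qed.

Section geometric_grid.
Context {R : realType}.
Local Open Scope ereal_scope.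
Local Notation leb := (@lebesgue_measure R).

Record geometric_grid (lam : R) (p : nat -> R) : Prop := GeometricGrid {
  grid_gt0 : forall n, (0 < p n)%R;
  grid_cover : forall s, (0 < s)%R -> exists n, (p n / lam < s <= p n)%R;
  grid_disjoint : trivIset setT (fun n => `](p n / lam)%R, p n]%classic) }.

Lemma geometric_grid_exists (lam : R) : (1 < lam)%R -> exists p, geometric_grid lam p.
Proof.
move=> lam1; have lam0 : (0 < lam)%R by apply: lt_trans lam1.
have ln0 : (0 < ln lam)%R by exact: ln_gt0.
have /card_esym/card_set_bijP[z [_ z_inj z_surj]] := card_int.
exists (fun n => expR (ln lam * (z n)%:~R)).
have ceilE n s : (0 < s)%R ->
    (expR (ln lam * (z n)%:~R) / lam < s <= expR (ln lam * (z n)%:~R))%R =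
    (((z n - 1)%:~R < ln s / ln lam) && (ln s / ln lam <= (z n)%:~R))%R.
  move=> s0; rewrite -[X in (_ / X)%R](lnK lam0) -expRB -{1 2}(lnK s0) ltr_expR ler_expR.
  rewrite ltr_pdivlMr// ler_pdivrMr// rmorphB /= mulrBl mul1r.
  by rewrite [((z n)%:~R * _)%R]mulrC.
split; first by move=> n; exact: expR_gt0.
- move=> s s0; have [n _ zn] := z_surj (Num.ceil (ln s / ln lam)) I.
  by exists n; rewrite ceilE// zn; exact: real_ceil_itv (num_real _).
- apply/trivIsetP => m n _ _ /eqP mn; apply/seteqP; split => // s.
  rewrite /= !in_itv/= => -[ms ns]; apply: mn; apply: z_inj; rewrite ?inE//.
  have s0 : (0 < s)%R.
    by case/andP: ms => + _; apply: lt_trans; rewrite divr_gt0 ?expR_gt0.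
  move: ms ns; rewrite !ceilE// => /ceil_def <- /ceil_def <-; exact: erefl.
Qed.

Lemma lebesgue_measure_lt_superlevel (y : \bar R) : 0 <= y ->
  leb [set s | (0 < s)%R /\ s%:E < y] = y.
Proof.
case: y => [r| |]// r0; last first.
  rewrite (_ : [set s | _] = `]0%R, +oo[%classic); last first.
    by apply/seteqP; split => s /=; rewrite in_itv/= andbT ?ltry => // -[].
  by rewrite [LHS](lebesgue_measure_itv (Interval (BRight 0%R) +oo%O))/= ltry.
rewrite (_ : [set s | _] = `]0%R, r[%classic); last first.
  by apply/seteqP; split => s /=; rewrite in_itv/= lte_fin; [move=> [-> ->]|move/andP].
rewrite [LHS](lebesgue_measure_itv (Interval (BRight 0%R) (BLeft r)))/= lte_fin.
rewrite lee_fin le_eqVlt in r0.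
by case/predU1P: r0 => [<-|->]; rewrite ?ltxx// sube0.
Qed.

Lemma geometric_grid_majorizes lam p (y : \bar R) : (1 < lam)%R ->
  geometric_grid lam p -> 0 <= y ->
  y <= \sum_(0 <= n <oo) if (p n)%:E < y then ((lam - 1) * p n)%:E else 0.
Proof.
move=> lam1 pP y0; have lam0 : (0 < lam)%R by apply: lt_trans lam1.
pose J n : set R := if (p n)%:E < y then `]p n, (lam * p n)%R]%classic else set0.
have lebJ n : leb (J n) = if (p n)%:E < y then ((lam - 1) * p n)%:E else 0.
  rewrite /J; case: ifPn => _; last exact: measure0.
  rewrite [LHS](lebesgue_measure_itv (Interval (BRight (p n)) (BRight (lam * p n)%R))).
  rewrite /= lte_fin ltr_pMl ?(grid_gt0 pP)// lam1 -EFinB; congr EFin; ring.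
rewrite -{1}(lebesgue_measure_lt_superlevel y0) -(eq_eseriesr (fun n _ => lebJ n)).
apply: measure_sigma_subadditive.
- by move=> n; rewrite /J; case: ifP.
- rewrite (_ : [set s | _] = `]0%R, +oo[%classic `&` [set s | s%:E < y]).
    apply: measurableI => //; rewrite -[X in measurable X]setTI.
    by apply: emeasurable_fun_infty_o => //; exact/measurable_EFinP.
  by apply/seteqP; split => s; rewrite /= in_itv/= andbT.
- move=> s [s0 sy]; have [n /andP[ps sp]] := grid_cover pP (divr_gt0 s0 lam0).
  have {}ps : (p n < s)%R by rewrite -(ltr_pM2r (x := lam^-1))// invr_gt0.
  exists n => //; rewrite /J ifT; last by apply: lt_trans sy; rewrite lte_fin.
  by rewrite /= in_itv/= ps mulrC -ler_pdivrMr.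
Qed.

End geometric_grid.

Section layer_norm_lorentz.
Context d (T : measurableType d) {R : realType}.
Variable mu : {sigma_finite_measure set T -> \bar R}.
Variable phi : R -> R.
Hypothesis qc : quasiconcave phi.
Local Open Scope ereal_scope.
Local Notation leb := (@lebesgue_measure R).
Local Notation distr := (distr mu).
Local Notation lorentz := (lorentz mu phi).
Local Notation layer_norm := (layer_norm mu phi).

Section staircase.
Variables (v : T -> \bar R) (lam : R) (p : nat -> R).
Hypothesis mv : measurable_fun setT v.
Hypothesis v0 : forall x, 0 <= v x.
Hypothesis v_fin : lorentz v < +oo.
Hypothesis lam1 : (1 < lam)%R.
Hypothesis pP : geometric_grid lam p.

Definition stair_height n : R :=
  if distr v (p n) == 0 then 0%R else ((lam - 1) * p n)%R.

(* The scale of a null layer is irrelevant, as its height is zero. *)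
Definition stair_scale n : R :=
  if distr v (p n) == 0 then 1%R else fine (distr v (p n)).

Definition stair n (x : T) : \bar R :=
  (stair_height n * \1_[set y | ((p n)%:E < v y)%E] x)%:E.

Let p0 n : (0 < p n)%R. Proof. exact: (grid_gt0 pP). Qed.

Let lam0 : (0 < lam)%R. Proof. exact: lt_trans lam1. Qed.

Let distr_fin n : distr v (p n) \is a fin_num.
Proof. by rewrite ge0_fin_numE ?distr_ge0//; exact: (lorentz_distr_lty qc). Qed.

Lemma stair_height_ge0 n : (0 <= stair_height n)%R.
Proof.
by rewrite /stair_height; case: ifP => // _; rewrite mulr_ge0 ?subr_ge0 ?ltW.
Qed.

Lemma stair_scale_gt0 n : (0 < stair_scale n)%R.
Proof.
rewrite /stair_scale; case: ifPn => // distr_neq0; rewrite fine_gt0//.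
by rewrite lt_def distr_neq0 distr_ge0/= -ge0_fin_numE ?distr_ge0 ?distr_fin.
Qed.

Lemma measurable_stair n : measurable_fun setT (stair n).
Proof.
apply/measurable_EFinP; apply: measurable_funM => //.
by apply: measurable_indic; exact: measurable_superlevel.
Qed.

Lemma layering_stair : layering mu v stair stair_height stair_scale.
Proof.
split; [exact: measurable_stair| |exact: stair_height_ge0|exact: stair_scale_gt0|].
  move=> n x; rewrite !lee_fin mulr_ge0 ?stair_height_ge0//= indicE.
  by case: (_ \in _); rewrite ?mulr1 ?mulr0// stair_height_ge0.
pose null n := if distr v (p n) == 0 then [set x | (p n)%:E < v x] else set0.
have null_negl : mu.-negligible (\bigcup_n null n).
  apply: negligible_bigcup => n; rewrite /null; case: ifPn => [/eqP distr0|_].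
    by apply/negligibleP; first exact: measurable_superlevel.
  exact: negligible_set0.
apply: negligibleS null_negl => x /= /negP; rewrite -ltNge => stair_lt.
apply: contrapT => not_null; move: stair_lt; apply/negP; rewrite -leNgt.
apply: (le_trans (geometric_grid_majorizes lam1 pP (v0 x))).
apply: lee_nneseries => n _.
  by case: ifP => // _; rewrite lee_fin mulr_ge0 ?subr_ge0 ?ltW.
rewrite /stair indicE /stair_height; case: ifPn => [pv|_]; last first.
  by rewrite lee_fin mulr_ge0//; case: ifP => // _; rewrite mulr_ge0 ?subr_ge0 ?ltW.
rewrite mem_set// mulr1; case: ifPn => // distr0.
by case: not_null; exists n => //; rewrite /null distr0.
Qed.

Lemma stair_cost_le n :
  layer_cost mu phi stair stair_height stair_scale n <=
  (2 * lam)%:E * \int[leb]_(s in `](p n / lam)%R, p n]) er_map phi (distr v s).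
Proof.
have phi_distr0 s : 0 <= er_map phi (distr v s).
  exact: (comp_distr_ge0 _ (ge0_nondecreasing_er_map qc)).
have int_stair : \int[mu]_x stair n x = (stair_height n)%:E * distr v (p n).
  rewrite /stair; under eq_integral do rewrite EFinM.
  have mlevel := measurable_superlevel (p n) mv.
  rewrite ge0_integralZl ?lee_fin ?stair_height_ge0//.
    by rewrite integral_indic// setIT.
  by apply/measurable_EFinP; exact: measurable_indic.
rewrite /layer_cost int_stair.
have [distr0|distr_neq0] := boolP (distr v (p n) == 0).
  rewrite /stair_height distr0 mul0r mul0e mule0 add0e mule_ge0 ?integral_ge0//.
  by rewrite lee_fin mulr_ge0// ltW.
have distrE : distr v (p n) = (stair_scale n)%:E.
  by rewrite /stair_scale (negbTE distr_neq0) fineK.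
rewrite distrE -!EFinM -EFinD /stair_height (negbTE distr_neq0).
have b0 := stair_scale_gt0 n; set b := stair_scale n in b0 distrE *.
have -> : ((lam - 1) * p n * phi b + phi b / b * ((lam - 1) * p n * b) =
    2 * lam * ((p n - p n / lam) * phi b))%R by field; rewrite !gt_eqF.
rewrite EFinM lee_wpmul2l ?lee_fin ?mulr_ge0 ?(ltW lam0)//.
have -> : ((p n - p n / lam) * phi b)%:E =
    \int[leb]_(s in `](p n / lam)%R, p n]) (cst (phi b)%:E) s.
  rewrite integral_cst; last exact: measurable_itv.
  rewrite [X in _ = _ * X](lebesgue_measure_itv
    (Interval (BRight (p n / lam)%R) (BRight (p n)))).
  by rewrite /= lte_fin ltr_pdivrMr// ltr_pMr// lam1 -EFinB -EFinM mulrC.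
apply: ge0_le_integral => //.
- by move=> s _; rewrite lee_fin ltW// (quasiconcave_gt0 qc).
- apply: measurable_funTS; exact: (measurable_comp_distr _ (ge0_nondecreasing_er_map qc)).
- move=> s; rewrite /= in_itv/= => /andP[_ sp].
  rewrite -[leLHS]/(er_map phi b%:E) -distrE; apply: (quasiconcave_er_map_le qc).
    exact: distr_ge0.
  exact: distr_nonincreasing.
Qed.

Lemma layer_norm_stair_le : layer_norm v <= (2 * lam)%:E * lorentz v.
Proof.
apply: (le_trans (layer_norm_le phi layering_stair)).
have phi_distr0 s : 0 <= er_map phi (distr v s).
  exact: (comp_distr_ge0 _ (ge0_nondecreasing_er_map qc)).
have mphi D : measurable_fun D (fun s => er_map phi (distr v s)).
  apply: measurable_funTS.
  exact: (measurable_comp_distr _ (ge0_nondecreasing_er_map qc)).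
have lam20 : 0 <= (2 * lam)%:E by rewrite lee_fin mulr_ge0// ltW.
apply: (le_trans (lee_nneseries _ (fun n _ => stair_cost_le n))).
  by move=> n _ _; exact: (layer_cost_ge0 qc n layering_stair).
rewrite nneseriesZl => [|n _]; last exact: integral_ge0.
rewrite lee_wpmul2l// -ge0_integral_bigcup//; [|exact: mphi|exact: (grid_disjoint pP)].
apply: ge0_subset_integral => //.
- by apply: bigcup_measurable => n _; exact: measurable_itv.
- exact: mphi.
move=> s [n _]; rewrite /= !in_itv/= andbT => /andP[ps _].
by apply/ltW; apply: lt_trans ps; rewrite divr_gt0.
Qed.

End staircase.

Lemma layer_norm_le_lorentz v : measurable_fun setT v -> (forall x, 0 <= v x) ->
  layer_norm v <= 2%:E * lorentz v.
Proof.
move=> mv v0; have lorentz_v0 := lorentz_ge0 mu qc v.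
have [->|v_fin] := eqVneq (lorentz v) +oo; first by rewrite gt0_muley ?leey// lte_fin.
apply: lee_mulgt1 => [|lam lam1]; first by rewrite mule_ge0.
have [p pP] := geometric_grid_exists lam1.
rewrite muleA -EFinM mulrC; apply: layer_norm_stair_le pP => //.
by rewrite ltey.
Qed.

Lemma lorentzD_le h v : measurable_fun setT h -> measurable_fun setT v ->
  (forall x, 0 <= h x) -> (forall x, 0 <= v x) ->
  lorentz (h \+ v) <= lorentz h + 2%:E * lorentz v.
Proof.
move=> mh mv h0 v0; apply: (le_trans (lorentzD_layer_norm_le _ qc mh mv h0 v0)).
by rewrite leeD2l// layer_norm_le_lorentz.
Qed.

End layer_norm_lorentz.

Section transfer.
Context d (T : measurableType d) {R : realType}.
Variable mu : {sigma_finite_measure set T -> \bar R}.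
Variables (N : nat) (F : 'I_N -> T -> T) (a : 'I_N -> T -> R).
Hypothesis mF : forall n, measurable_fun setT (F n).
Hypothesis ma : forall n, measurable_fun setT (a n).
Hypothesis a0 : forall n x, 0 <= a n x.
Local Open Scope ereal_scope.
Local Notation leb := (@lebesgue_measure R).
Implicit Types (w : T -> \bar R).

Definition transfer w x := \sum_(n < N) (a n x)%:E * w (F n x).

Lemma transfer_ge0 w x : (forall y, 0 <= w y) -> 0 <= transfer w x.
Proof. by move=> w0; apply: sume_ge0 => n _; rewrite mule_ge0 ?lee_fin. Qed.

Lemma measurable_transfer w : measurable_fun setT w ->
  measurable_fun setT (transfer w).
Proof.
move=> mw; apply: emeasurable_sum => n; apply: emeasurable_funM.
  exact/measurable_EFinP.
exact: measurableT_comp.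
Qed.

Definition subgraph w : set (T * R) := [set z | (0 < z.2)%R /\ (z.2)%:E < w z.1].

Lemma measurable_subgraph w : measurable_fun setT w -> measurable (subgraph w).
Proof.
move=> mw; rewrite (_ : subgraph w = [set z | (0 < z.2)%R] `&` [set z | (z.2)%:E < w z.1]).
  apply: (measurable_lt_graph (w := w)) => //.
  rewrite (_ : [set _ | _] = [set: T] `*` `]0%R, +oo[%classic).
    exact: measurableX.
  by apply/seteqP; split => z /=; rewrite in_itv/= andbT // => -[].
by apply/seteqP; split.
Qed.

Lemma lebesgue_measure_xsection_subgraph w x : 0 <= w x ->
  leb (xsection (subgraph w) x) = w x.
Proof.
move=> /lebesgue_measure_lt_superlevel wx; rewrite -[RHS]wx; congr (leb _).
by apply/seteqP; split => s; rewrite /xsection /= inE.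
Qed.

Lemma measurable_indic_subgraph w : measurable_fun setT w ->
  measurable_fun setT (fun z : T * R => (\1_(subgraph w) (z.1, z.2))%:E : \bar R).
Proof.
move=> mw; apply/measurable_EFinP; rewrite (_ : (fun z => _) = \1_(subgraph w)).
  by apply: measurable_indic; exact: measurable_subgraph.
by apply/funext => -[].
Qed.

Definition transfer_subgraph w (z : T * R) : \bar R :=
  transfer (fun y => (\1_(subgraph w) (y, z.2))%:E) z.1.

Lemma measurable_transfer_subgraph w : measurable_fun setT w ->
  measurable_fun setT (transfer_subgraph w).
Proof.
move=> /measurable_indic_subgraph mind.
apply: emeasurable_sum => n; apply: emeasurable_funM.
  by apply/measurable_EFinP; exact: measurableT_comp.
apply: (measurableT_comp mind (g := fun z => (F n z.1, z.2))).
by apply: measurable_fun_pair => //; exact: measurableT_comp.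
Qed.

Lemma transfer_layer_cake w x : measurable_fun setT w -> (forall x, 0 <= w x) ->
  transfer w x = \int[leb]_s transfer_subgraph w (x, s).
Proof.
move=> mw w0.
have mind y : measurable_fun [set: R] (fun s => (\1_(subgraph w) (y, s))%:E : \bar R).
  exact: (measurable_fun_pair2 y (measurable_indic_subgraph mw)).
rewrite /transfer_subgraph /transfer /= ge0_integral_sum//; last 2 first.
- by move=> n; apply: measurable_funeM; exact: mind.
- by move=> n s _; rewrite mule_ge0 ?lee_fin.
have int_indic y : \int[leb]_s (\1_(subgraph w) (y, s))%:E = w y.
  rewrite -[RHS]lebesgue_measure_xsection_subgraph//.
  exact: (congr1 (@^~ y) (indic_fubini_tonelli_FE leb (measurable_subgraph mw))).
apply: eq_bigr => n _; rewrite -int_indic -ge0_integralZl ?lee_fin//.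
exact: mind.
Qed.

Lemma integral_transfer_le w (c : R) : measurable_fun setT w -> (forall x, 0 <= w x) ->
  (0 <= c)%R ->
  (forall A, measurable A ->
     \int[mu]_x transfer (fun y => (\1_A y)%:E) x <= c%:E * mu A) ->
  \int[mu]_x transfer w x <= c%:E * \int[mu]_x w x.
Proof.
move=> mw w0 c0 transfer_indic; have mG := measurable_subgraph mw.
have mf := measurable_transfer_subgraph mw.
have f0 z : 0 <= transfer_subgraph w z by apply: transfer_ge0 => y; rewrite lee_fin.
have -> : \int[mu]_x w x = \int[leb]_s mu (ysection (subgraph w) s).
  rewrite integral_ysection_xsection//; apply: eq_integral => x _.
  by rewrite lebesgue_measure_xsection_subgraph.
under eq_integral do rewrite (transfer_layer_cake _ mw w0).
rewrite (fubini_tonelli (m1 := mu) (m2 := leb) (transfer_subgraph w))//.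
rewrite -ge0_integralZl//; last exact: measurable_fun_ysection.
apply: ge0_le_integral => //.
- by move=> s _; apply: integral_ge0.
- exact: (measurable_fun_fubini_tonelli_G (m1 := mu) (transfer_subgraph w)).
- by apply: measurable_funeM; exact: measurable_fun_ysection.
move=> s _; apply: le_trans (transfer_indic _ (measurable_ysection s mG)).
rewrite le_eqVlt; apply/orP; left; apply/eqP; apply: eq_integral => x _.
apply: eq_bigr => n _; congr (_ * _%:E).
by rewrite /= !indicE mem_ysection.
Qed.

End transfer.

Section layer_norm_transfer.
Context d (T : measurableType d) {R : realType}.
Variable mu : {sigma_finite_measure set T -> \bar R}.
Variable phi : R -> R.
Hypothesis qc : quasiconcave phi.
Variables (N : nat) (F : 'I_N -> T -> T) (a : 'I_N -> T -> R) (alpha : R).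
Hypothesis N_gt0 : (0 < N)%N.
Hypothesis alpha_ge0 : 0 <= alpha.
Hypothesis mF : forall n, measurable_fun setT (F n).
Hypothesis nullF : forall n A, mu.-negligible A -> mu.-negligible (F n @^-1` A).
Hypothesis ma : forall n, measurable_fun setT (a n).
Hypothesis a_bounds : forall n x, 0 <= a n x <= alpha / N%:R.
Local Open Scope ereal_scope.
Hypothesis transfer_L1 : forall u : T -> \bar R, measurable_fun setT u ->
  (forall x, 0 <= u x) -> \int[mu]_x transfer F a u x <= alpha%:E * \int[mu]_x u x.
Implicit Types (v : T -> \bar R) (w : nat -> T -> \bar R) (M b : nat -> R).

Let a0 n x : (0 <= a n x)%R. Proof. by case/andP: (a_bounds n x). Qed.

Lemma transfer_le_bound (u : T -> \bar R) (B : R) x : (forall y, 0 <= u y <= B%:E) ->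
  transfer F a u x <= (alpha * B)%:E.
Proof.
move=> uB; apply: (@le_trans _ _ (\sum_(n < N) (alpha / N%:R * B)%:E)).
  apply: lee_sum => n _; rewrite EFinM; apply: lee_pmul => //.
  - by rewrite lee_fin.
  - by case/andP: (uB (F n x)).
  - by rewrite lee_fin; case/andP: (a_bounds n x).
  - by case/andP: (uB (F n x)).
rewrite sumEFin lee_fin sumr_const card_ord -[leLHS]mulr_natr mulrAC mulfVK//.
by rewrite pnatr_eq0 -lt0n.
Qed.

Lemma layering_transfer v w M b : layering mu v w M b ->
  layering mu (transfer F a v) (fun j => transfer F a (w j)) (fun j => alpha * M j)%R b.
Proof.
move=> vw; have w0 j x : 0 <= w j x by exact: layer_ge0 vw.
split; last 1 first.
- have vwF : {ae mu, forall x n, v (F n x) <= \sum_(0 <= j <oo) w j (F n x)}.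
    by apply: filter_forall => n; exact: (nullF n (layering_majorizes vw)).
  apply: filterS vwF => x vwx; rewrite /transfer nneseries_sum; last first.
    by move=> n j _; rewrite mule_ge0 ?lee_fin.
  by apply: lee_sum => n _; rewrite nneseriesZl// lee_wpmul2l ?lee_fin.
- by move=> j; apply: measurable_transfer => //; exact: measurable_layer vw j.
- by move=> j x; rewrite transfer_ge0//= transfer_le_bound//; exact: layer_bounds vw j.
- by move=> j; rewrite mulr_ge0// (layer_height_ge0 vw).
- exact: layer_scale_gt0 vw.
Qed.

Lemma layer_cost_transfer_le v w M b j : layering mu v w M b ->
  layer_cost mu phi (fun j => transfer F a (w j)) (fun j => alpha * M j)%R b j <=
  alpha%:E * layer_cost mu phi w M b j.
Proof.
move=> vw; have b0 := layer_scale_gt0 vw j; have M0 := layer_height_ge0 vw j.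
have w0 x : 0 <= w j x by exact: layer_ge0 vw.
have slope0 : 0 <= (phi (b j) / b j)%:E by rewrite lee_fin quasiconcave_slope_ge0.
have height0 : 0 <= (M j * phi (b j))%:E.
  by rewrite lee_fin mulr_ge0// ltW// (quasiconcave_gt0 qc).
have area0 : 0 <= (phi (b j) / b j)%:E * \int[mu]_x w j x.
  by rewrite mule_ge0// integral_ge0.
rewrite /layer_cost (ge0_muleDr _ height0 area0).
rewrite -EFinM mulrA leeD2l// muleCA lee_wpmul2l// transfer_L1//.
exact: measurable_layer vw j.
Qed.

Lemma layer_norm_transfer_le v : layer_norm mu phi v < +oo ->
  layer_norm mu phi (transfer F a v) <= alpha%:E * layer_norm mu phi v.
Proof.
move=> v_fin.
have le_cost w M b : layering mu v w M b -> layer_norm mu phi (transfer F a v) <=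
    alpha%:E * \sum_(0 <= j <oo) layer_cost mu phi w M b j.
  move=> vw; have aw := layering_transfer vw; apply: (le_trans (layer_norm_le _ aw)).
  rewrite -nneseriesZl => [|j _]; last exact: (layer_cost_ge0 qc j vw).
  apply: lee_nneseries => [j _ _|j _]; first exact: (layer_cost_ge0 qc j aw).
  exact: layer_cost_transfer_le vw.
have [alpha0|alpha0] := ltP 0%R alpha.
  rewrite -lee_pdivrMl//; apply: le_layer_norm => w M b /le_cost.
  by rewrite lee_pdivrMl.
move: v_fin => /ereal_inf_lt[_ [w [M [b [/le_cost + _]]]] _].
by rewrite (@le_anti _ _ alpha 0%R) ?alpha0 ?alpha_ge0// !mul0e.
Qed.

End layer_norm_transfer.

(** * Lebesgue measure *)

Section double_series.
Local Open Scope ereal_scope.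

Lemma nneseries_pairing : exists2 f : nat -> nat * nat,
  (forall p, exists i, f i = p) &
  forall (R : realType) (g : nat -> nat -> \bar R), (forall i j, 0 <= g i j) ->
    \sum_(0 <= i <oo) g (f i).1 (f i).2 =
    \sum_(0 <= i <oo) \sum_(0 <= j <oo) g i j.
Proof.
have /card_esym/card_set_bijP[f [_ f_inj f_surj]] := card_nat2.
exists f => [p|R g g0]; first by have [i _ <-] := f_surj p I; exists i.
transitivity (\esum_(i in [set: nat]) \esum_(j in [set: nat]) g i j); last first.
  rewrite [RHS]nneseries_esumT; last by move=> i; apply: nneseries_ge0.
  by apply: eq_esum => i _; rewrite [RHS]nneseries_esumT.
rewrite nneseries_esumT// esum_esum// (_ : [set: nat] `*`` _ = setT); last first.
  by apply/seteqP; split.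
by rewrite (@reindex_esum _ _ _ [set: nat] [set: nat * nat] f).
Qed.

End double_series.

Section lebesgue_outer.
Context {R : realType} (k : nat).
Local Notation V := 'rV[R]_k.+1.
Implicit Types (a b x : V) (A : set V).
Local Open Scope ereal_scope.

Lemma box_vol_ge0 a b : (0 <= box_vol a b)%R.
Proof. by apply: prodr_ge0 => i _; rewrite le_max lexx. Qed.

Lemma box_vol_xx a : box_vol a a = 0%R.
Proof. by rewrite /box_vol big_ord_recl subrr maxxx mul0r. Qed.

Lemma leb_outer_ge0 A : 0 <= leb_outer A.
Proof.
apply: le_ereal_inf_tmp => _ [a [b [_ ->]]]; apply: nneseries_ge0 => n _ _.
by rewrite lee_fin box_vol_ge0.
Qed.

Lemma leb_outer_cover A (a b : nat -> V) : A `<=` \bigcup_n box (a n) (b n) ->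
  leb_outer A <= \sum_(0 <= n <oo) (box_vol (a n) (b n))%:E.
Proof. by move=> Aab; apply: ereal_inf_lbound; exists a, b. Qed.

Lemma leb_outer_fin_cover (I : eqType) (s : seq I) A (a b : I -> V) :
  (forall x, A x -> exists2 i, i \in s & box (a i) (b i) x) ->
  leb_outer A <= \sum_(i <- s) (box_vol (a i) (b i))%:E.
Proof.
move=> As.
pose a' n := nth 0%R (map a s) n; pose b' n := nth 0%R (map b s) n.
apply: (@le_trans _ _ (\sum_(0 <= n <oo) (box_vol (a' n) (b' n))%:E)).
  apply: leb_outer_cover => x /As[i si abx]; exists (index i s) => //.
  by rewrite /a' /b' !(nth_map i) ?index_mem// nth_index.
have vol0 n : (size s <= n)%N -> box_vol (a' n) (b' n) = 0%R.
  by move=> sn; rewrite /a' /b' !nth_default ?size_map// box_vol_xx.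
rewrite (nneseries_split 0 (size s)); last by move=> n _; rewrite lee_fin box_vol_ge0.
rewrite add0n [X in _ + X]eseries0 ?adde0; last by move=> n sn _; rewrite vol0.
rewrite /a' /b' {As a' b' vol0}; elim: s => [|i s IHs]; first by rewrite !big_nil.
rewrite [leRHS]big_cons -[size (i :: s)]/(size s).+1 big_nat_recl//=.
exact: leeD2l.
Qed.

Lemma leb_outer_box a b : leb_outer (box a b) <= (box_vol a b)%:E.
Proof.
have := @leb_outer_fin_cover _ [:: tt] (box a b) (fun=> a) (fun=> b).
by rewrite big_seq1; apply => x abx; exists tt.
Qed.

Lemma leb_outer_set0 : leb_outer (@set0 V) = 0.
Proof.
apply/eqP; rewrite eq_le leb_outer_ge0 andbT.
have := @leb_outer_fin_cover unit [::] set0 (fun=> 0%R) (fun=> 0%R).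
by rewrite big_nil; apply.
Qed.

Lemma le_leb_outer : {homo @leb_outer R k.+1 : A B / A `<=` B >-> A <= B}.
Proof.
move=> A B AB; apply: le_ereal_inf_tmp => _ [a [b [Bab ->]]].
by apply: leb_outer_cover; exact: subset_trans Bab.
Qed.

Lemma leb_outer_eq0 A : leb_outer A <= 0 -> leb_outer A = 0.
Proof. by move=> A0; apply/eqP; rewrite eq_le A0 leb_outer_ge0. Qed.

Lemma leb_outer_approx A (e : R) : (0 < e)%R -> leb_outer A < +oo ->
  exists a b : nat -> V, A `<=` \bigcup_n box (a n) (b n) /\
    \sum_(0 <= n <oo) (box_vol (a n) (b n))%:E <= leb_outer A + e%:E.
Proof.
move=> e0 Afin.
have Afn : leb_outer A \is a fin_num by rewrite ge0_fin_numE// leb_outer_ge0.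
have [_ [a [b [Aab ->]]] /ltW cost] := lb_ereal_inf_adherent e0 Afn.
by exists a, b.
Qed.

Lemma leb_outer_sigma_subadditive : sigma_subadditive (@leb_outer R k.+1).
Proof.
move=> A; have [[i ioo]|] := pselect (exists i, leb_outer (A i) = +oo).
  rewrite (eseries_pinfty _ _ ioo) ?leey// => n _.
  by rewrite -ltNye (lt_le_trans _ (leb_outer_ge0 _)).
rewrite -forallNE => Aoo.
have Afin n : leb_outer (A n) < +oo by rewrite ltey; apply/eqP; exact: Aoo.
apply/lee_addgt0Pr => e e0.
apply: (le_trans _ (epsilon_trick _ _ (ltW e0))); last first.
  by move=> n; exact: leb_outer_ge0.
have coverA n : exists ab : (nat -> V) * (nat -> V),
    A n `<=` \bigcup_j box (ab.1 j) (ab.2 j) /\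
    \sum_(0 <= j <oo) (box_vol (ab.1 j) (ab.2 j))%:E <=
    leb_outer (A n) + (e / (2 ^ n.+1)%:R)%:E.
  have en : (0 < e / (2 ^ n.+1)%:R)%R by rewrite divr_gt0// ltr0n expn_gt0.
  by have [a [b ab]] := leb_outer_approx en (Afin n); exists (a, b).
have [ab abP] := choice coverA.
have [f f_surj f_sum] := nneseries_pairing.
apply: (@le_trans _ _ (\sum_(0 <= i <oo)
    (box_vol ((ab (f i).1).1 (f i).2) ((ab (f i).1).2 (f i).2))%:E)).
  apply: leb_outer_cover => x [n _] /(abP n).1[j _ abx].
  by have [i fi] := f_surj (n, j); exists i => //; rewrite fi.
rewrite (f_sum R (fun i j => (box_vol ((ab i).1 j) ((ab i).2 j))%:E)); last first.
  by move=> i j; rewrite lee_fin box_vol_ge0.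
apply: lee_nneseries => [i _ _|i _]; last exact: (abP i).2.
by apply: nneseries_ge0 => j _ _; rewrite lee_fin box_vol_ge0.
Qed.

HB.instance Definition _ := isOuterMeasure.Build R V (@leb_outer R k.+1)
  leb_outer_set0 leb_outer_ge0 le_leb_outer leb_outer_sigma_subadditive.

Definition leb_space : Type := caratheodory_type (@leb_outer R k.+1).

HB.instance Definition _ := Pointed.on leb_space.
HB.instance Definition _ :=
  Measurable.copy leb_space (caratheodory_type (@leb_outer R k.+1)).

Definition leb_measure : set leb_space -> \bar R := @leb_outer R k.+1.
HB.instance Definition _ := isMeasure.Build _ leb_space R leb_measure
  (@caratheodory_measure0 R V (@leb_outer R k.+1))
  (@caratheodory_measure_ge0 R V (@leb_outer R k.+1))
  (@caratheodory_measure_sigma_additive R V (@leb_outer R k.+1)).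

Lemma negligible_leb_nullP A : leb_measure.-negligible A <-> leb_null A.
Proof.
split=> [[B [mB B0 AB]]|A0].
  by apply: leb_outer_eq0; rewrite -B0; exact: le_leb_outer.
exists A; split => //; apply: le_caratheodory_measurable => X /=.
have -> : leb_outer (X `&` A) = 0.
  by apply: leb_outer_eq0; rewrite -A0; apply: le_leb_outer => x [].
by rewrite add0e; apply: le_leb_outer => x [].
Qed.

Lemma measurable_leb_null A : leb_null A -> measurable (A : set leb_space).
Proof. by move=> /negligible_leb_nullP; exact: measure_is_complete_caratheodory. Qed.

Lemma box_vol_split a b i (c : R) :
  (box_vol a (\row_j if j == i then Num.min (b 0 j) c else b 0 j) +
   box_vol (\row_j if j == i then Num.max (a 0 j) c else a 0 j) b <= box_vol a b)%R.
Proof.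
rewrite /box_vol (bigD1 i)//= [X in (_ + X)%R](bigD1 i)//= [leRHS](bigD1 i)//= !mxE eqxx.
rewrite (eq_bigr (fun j => Num.max 0 (b 0 j - a 0 j))%R); last first.
  by move=> j /negbTE ji; rewrite mxE ji.
rewrite [X in (_ + _ * X)%R](eq_bigr (fun j => Num.max 0 (b 0 j - a 0 j))%R); last first.
  by move=> j /negbTE ji; rewrite mxE ji.
rewrite -mulrDl ler_wpM2r//; first by apply: prodr_ge0 => j _; rewrite le_max lexx.
move: (a ord0 i) (b ord0 i) => u v; rewrite /Num.max /Num.min.
by do ![case: ltP => ?]; lra.
Qed.

Lemma measurable_halfspace i (c : R) :
  measurable ([set x | x 0 i < c] : set leb_space)%R.
Proof.
apply: le_caratheodory_measurable => X /=.
have [->|Xfin] := eqVneq (leb_outer X) +oo; first by rewrite leey.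
apply/lee_addgt0Pr => e e0; rewrite -ltey in Xfin.
have [a [b [Xab]]] := leb_outer_approx e0 Xfin; apply: le_trans.
pose b' n : V := (\row_j if j == i then Num.min (b n 0 j) c else b n 0 j)%R.
pose a' n : V := (\row_j if j == i then Num.max (a n 0 j) c else a n 0 j)%R.
apply: (@le_trans _ _ (\sum_(0 <= n <oo) (box_vol (a n) (b' n))%:E +
   \sum_(0 <= n <oo) (box_vol (a' n) (b n))%:E)).
  apply: leeD; apply: leb_outer_cover => x [Xx /= xc];
    have [n _ abx] := Xab _ Xx; exists n => // j; rewrite mxE.
    case: eqP => [->|_]; last exact: abx.
    by have /andP[-> bx] := abx i; rewrite lt_min bx xc.
  case: eqP => [->|_]; last exact: abx.
  have /andP[ax ->] := abx i; rewrite ge_max ax andbT /= leNgt.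
  exact/negP.
rewrite -nneseriesD; try by move=> n _ _; rewrite lee_fin box_vol_ge0.
apply: lee_nneseries => [n _ _|n _]; rewrite -EFinD lee_fin.
  by rewrite addr_ge0// box_vol_ge0.
exact: box_vol_split.
Qed.

Lemma measurable_box a b : measurable (box a b : set leb_space).
Proof.
have -> : box a b = \bigcap_(i in [set: 'I_k.+1])
    ([set x | x 0 i < b 0 i] `&` ~` [set x | x 0 i < a 0 i])%R.
  apply/seteqP; split => x.
    by move=> abx i _; have /andP[ax bx] := abx i; split => //=; apply/negP; rewrite -leNgt.
  by move=> abx i; have [/= -> /negP] := abx i I; rewrite -leNgt => ->.
apply: fin_bigcap_measurable => // i _; apply: measurableI.
  exact: measurable_halfspace.
by apply: measurableC; exact: measurable_halfspace.
Qed.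

End lebesgue_outer.

Lemma prodr_addr_le {R : realType} (I : Type) (s : seq I) (l : I -> R) (e : R) :
  0 < e -> exists2 t, 0 < t & \prod_(i <- s) (l i + t) <= \prod_(i <- s) l i + e.
Proof.
move=> e0; pose p := \prod_(i <- s) ((l i)%:P + 'X).
have pE t : p.[t] = \prod_(i <- s) (l i + t).
  by rewrite horner_prod; apply: eq_bigr => i _; rewrite !hornerE.
have /cvgrPdist_le /(_ e e0) /nbhs_ballP[r /= r0 near_p] := @continuous_horner R p 0.
exists (r / 2); first by rewrite divr_gt0.
have : ball (0 : R) r (r / 2).
  by rewrite /ball /= sub0r normrN gtr0_norm ?divr_gt0// ltr_pdivrMr//; lra.
move=> /near_p; rewrite !pE; under eq_bigr do rewrite addr0.
by rewrite distrC ler_norml => /andP[_]; lra.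
Qed.

Section lebesgue_topology.
Context {R : realType} (k : nat).
Local Notation V := 'rV[R]_k.+1.
Local Notation leb_space := (@leb_space R k).
Local Notation leb_measure := (@leb_measure R k).
Implicit Types (a b x : V) (U C : set V).

Lemma coord_rV_norm_le x i : `|x 0 i| <= `|x|.
Proof.
rewrite [leRHS]/Num.norm /= mx_normrE.
exact: (le_bigmax _ (fun ij => `|x ij.1 ij.2|) (0, i)).
Qed.

Lemma rV_norm_leP x e : 0 <= e -> `|x| <= e <-> forall i, `|x 0 i| <= e.
Proof.
move=> e0; split=> [xe i|xe]; first exact: le_trans (coord_rV_norm_le x i) xe.
rewrite [leLHS]/Num.norm /= mx_normrE; apply/bigmax_leP; split => // -[i j] _ /=.
by rewrite (ord1 i).
Qed.

Lemma rV_norm_ltP x e : 0 < e -> `|x| < e <-> forall i, `|x 0 i| < e.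
Proof.
move=> e0; split=> [xe i|xe]; first exact: le_lt_trans (coord_rV_norm_le x i) xe.
rewrite [ltLHS]/Num.norm /= mx_normrE; apply/bigmax_ltP; split => // -[i j] _ /=.
by rewrite (ord1 i).
Qed.

Lemma rV_openP U :
  open U <-> forall x, U x -> exists2 e, 0 < e & forall y, `|y - x| < e -> U y.
Proof.
split=> [oU x Ux|balls].
  have /nbhs_normP[e /= e0 ball_U] : nbhs x U by apply: open_nbhs_nbhs; split.
  by exists e => // y yx; apply: ball_U; rewrite /= distrC.
rewrite openE => x /balls[e e0 ball_U]; apply/nbhs_ballP; exists e => // y.
by rewrite mx_norm_ball /ball_ /= distrC; exact: ball_U.
Qed.

Lemma rational_mx_below (K : realType) m n (A : 'M[K]_(m, n)) (e : K) : 0 < e ->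
  exists q : 'M[rat]_(m, n), forall i j, A i j - e < ratr (q i j) < A i j.
Proof.
move=> e0; have below ij : exists q : rat, A ij.1 ij.2 - e < ratr q < A ij.1 ij.2.
  have : A ij.1 ij.2 - e < A ij.1 ij.2 by rewrite ltrBlDr ltrDl.
  by move=> /rat_in_itvoo[q]; rewrite in_itv/=; exists q.
have [q qP] := choice below; exists (\matrix_(i, j) q (i, j)) => i j.
by rewrite mxE; exact: (qP (i, j)).
Qed.

Lemma rational_box_nbhs x e : 0 < e -> exists p q : 'rV[rat]_k.+1,
  box (map_mx ratr p) (map_mx ratr q) x /\
  forall y, box (map_mx ratr p) (map_mx ratr q) y -> `|y - x| < e.
Proof.
move=> e0; have [p px] := rational_mx_below x e0.
have [q qx] := rational_mx_below (x + const_mx e) e0.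
have {}qx i : x 0 i < ratr (q 0 i) < x 0 i + e.
  by have := qx 0 i; rewrite !mxE addrK.
exists p, q; split=> [i|y pqy].
  by rewrite !mxE; have /andP[_ /ltW ->] := px 0 i; have /andP[] := qx i.
apply/rV_norm_ltP => // i; rewrite !mxE ltr_norml.
move: (px 0 i) (qx i) (pqy i); rewrite !mxE => /andP[? _] /andP[_ ?] /andP[? ?].
by apply/andP; split; lra.
Qed.

Lemma measurable_open U : open U -> measurable (U : set leb_space).
Proof.
move=> /rV_openP oU.
pose F (pq : 'rV[rat]_k.+1 * 'rV[rat]_k.+1) : set leb_space :=
  let B := box (map_mx ratr pq.1) (map_mx ratr pq.2) in
  if `[< B `<=` U >] then B else set0.
have -> : U = \bigcup_pq F pq.
  apply/seteqP; split => x; last first.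
    by move=> [pq _]; rewrite /F; case: asboolP => // pqU; exact: pqU.
  move=> /oU[e e0 ball_U]; have [p [q [pqx pq_ball]]] := rational_box_nbhs x e0.
  by exists (p, q) => //; rewrite /F asboolT// => y /pq_ball; exact: ball_U.
apply: countable_bigcupT_measurable; first exact: countableP.
by move=> pq; rewrite /F; case: asboolP => // _; exact: measurable_box.
Qed.

Lemma measurable_closed C : closed C -> measurable (C : set leb_space).
Proof.
by move=> cC; rewrite -[C]setCK; apply/measurableC/measurable_open; rewrite openC.
Qed.

Lemma measurable_compact C : compact C -> measurable (C : set leb_space).
Proof.
move=> cC; apply: measurable_closed; apply: compact_closed cC.
exact: norm_hausdorff.
Qed.

Definition supball x (r : R) : set V := [set y | `|y - x| < r].

Lemma open_supball x r : open (supball x r).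
Proof.
apply/rV_openP => y yx; exists (r - `|y - x|); first by rewrite subr_gt0.
by move=> z zy; rewrite /supball /=; have := ler_distD y z x; lra.
Qed.

Lemma supball_bigcup : \bigcup_n supball 0 n.+1%:R = [set: V].
Proof.
apply/seteqP; split => // x _; exists (Num.bound `|x|) => //=.
by rewrite /supball /= subr0 (lt_trans (archi_boundP _))// ltr_nat.
Qed.

Lemma leb_outer_supball_lty x r : (leb_outer (supball x r) < +oo)%E.
Proof.
apply: (@le_lt_trans _ _ (leb_outer (box (x - const_mx r) (x + const_mx r)))); last first.
  by apply: (le_lt_trans (leb_outer_box _ _)); rewrite ltry.
apply: le_leb_outer => y /= yx i; rewrite !mxE.
have := le_lt_trans (coord_rV_norm_le _ i) yx; rewrite !mxE ltr_norml => /andP[? ?].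
by apply/andP; split; lra.
Qed.

Lemma leb_outer_compact_lty C : compact C -> (leb_outer C < +oo)%E.
Proof.
move=> /compact_bounded[M [_ /(_ (M + 1))]]; rewrite ltrDl ltr01 => /(_ isT) C_le.
apply: (le_lt_trans _ (leb_outer_supball_lty 0 (M + 2))).
apply: le_leb_outer => x Cx; rewrite /supball/= subr0.
by apply: (le_lt_trans (C_le x Cx)); lra.
Qed.

Lemma leb_measure_sigma_finite : sigma_finite [set: leb_space] leb_measure.
Proof.
exists (fun n => supball 0 n.+1%:R); first by rewrite supball_bigcup.
move=> n; split; last exact: leb_outer_supball_lty.
exact/measurable_open/open_supball.
Qed.

HB.instance Definition _ :=
  @Measure_isSigmaFinite.Build _ leb_space R leb_measure leb_measure_sigma_finite.

Lemma open_obox a b : open [set x : V | forall i, a 0 i < x 0 i < b 0 i].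
Proof.
rewrite (_ : [set _ | _] = \bigcap_(i in [set` enum 'I_k.+1])
    ((fun x : V => x 0 i) @^-1` `]a 0 i, b 0 i[)); last first.
  apply/seteqP; split=> x abx i; first by move=> _; rewrite /= in_itv/=; exact: abx.
  by have := abx i; rewrite /= in_itv/= mem_enum; exact.
rewrite bigcap_seq; elim/big_ind: _ => [|A B|i _]; first exact: openT.
  exact: openI.
apply: open_comp => [x _|]; [exact: coord_continuous|exact: interval_open].
Qed.

End lebesgue_topology.

Section lebesgue_regularity.
Context {R : realType} (k : nat).
Local Notation V := 'rV[R]_k.+1.
Local Notation leb_space := (@leb_space R k).
Implicit Types (a b x : V) (A E : set V).
Local Open Scope ereal_scope.

Lemma box_open_hull a b (e : R) : (0 < e)%R ->
  exists U, [/\ open U, box a b `<=` U & leb_outer U <= (box_vol a b + e)%:E].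
Proof.
move=> e0; pose l i := Num.max 0%R (b 0%R i - a 0%R i)%R.
have [t t0] := prodr_addr_le (enum 'I_k.+1) l e0; rewrite !big_enum/= => vol_le.
pose a' : V := (\row_i (a 0 i - t))%R.
exists [set x : V | forall i, a' 0%R i < x 0%R i < b 0%R i]%R; split.
- exact: open_obox.
- move=> x abx i; have /andP[ax ->] := abx i; rewrite andbT mxE.
  by rewrite ltrBlDr (le_lt_trans ax)// ltrDl.
apply: (@le_trans _ _ (leb_outer (box a' b))).
  by apply: le_leb_outer => x a'bx i; have /andP[/ltW -> ->] := a'bx i.
apply: (le_trans (leb_outer_box _ _)); rewrite lee_fin; apply: le_trans vol_le.
apply: ler_prod => i _; rewrite le_max lexx/= mxE ge_max.
have l0 : (0 <= l i)%R by rewrite le_max lexx.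
have : (b 0 i - a 0 i <= l i)%R by rewrite le_max lexx orbT.
by rewrite addr_ge0 ?(ltW t0)//=; lra.
Qed.

Lemma leb_outer_open_hull A (e : R) : (0 < e)%R -> leb_outer A < +oo ->
  exists U, [/\ open U, A `<=` U & leb_outer U <= leb_outer A + e%:E].
Proof.
move=> e0 Afin; have e2 : (0 < e / 2)%R by rewrite divr_gt0.
have [a [b [Aab cost_ab]]] := leb_outer_approx e2 Afin.
have hull n : exists U, [/\ open U, box (a n) (b n) `<=` U &
    leb_outer U <= (box_vol (a n) (b n))%:E + ((e / 2) / (2 ^ n.+1)%:R)%:E].
  by rewrite -EFinD; apply: box_open_hull; rewrite divr_gt0// ltr0n expn_gt0.
have [U UP] := choice hull.
exists (\bigcup_n U n); split.
- by apply: bigcup_open => n _; have [] := UP n.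
- by move=> x /Aab[n _ abx]; exists n => //; have [_ + _] := UP n; apply.
apply: (le_trans (leb_outer_sigma_subadditive _)).
apply: (@le_trans _ _ (\sum_(0 <= n <oo) ((box_vol (a n) (b n))%:E +
   ((e / 2) / (2 ^ n.+1)%:R)%:E))).
  apply: lee_nneseries => [n _ _|n _]; first exact: leb_outer_ge0.
  by have [] := UP n.
apply: (le_trans (epsilon_trick _ _ (ltW e2))).
  by move=> n; rewrite lee_fin box_vol_ge0.
by rewrite [X in _ <= _ + X%:E]splitr EFinD addeA leeD2r.
Qed.

Lemma measurable_open_hull E (e : R) : measurable (E : set leb_space) -> (0 < e)%R ->
  exists U, [/\ open U, E `<=` U & leb_outer (U `\` E) <= e%:E].
Proof.
move=> mE e0; pose En n := E `&` supball 0 n.+1%:R.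
have mEn n : measurable (En n : set leb_space).
  by apply: measurableI => //; exact/measurable_open/open_supball.
have hull n : exists U, [/\ open U, En n `<=` U &
    leb_outer (U `\` En n) <= (e / (2 ^ n.+1)%:R)%:E].
  have en : (0 < e / (2 ^ n.+1)%:R)%R by rewrite divr_gt0// ltr0n expn_gt0.
  have Efin : leb_outer (En n) < +oo.
    apply: (le_lt_trans _ (leb_outer_supball_lty 0 n.+1%:R)).
    by apply: le_leb_outer => x [].
  have [U [oU EU Ue]] := leb_outer_open_hull en Efin; exists U; split => //.
  have Efn : leb_outer (En n) \is a fin_num by rewrite ge0_fin_numE ?leb_outer_ge0.
  rewrite -(leeD2lE _ _ Efn); apply: le_trans Ue.
  rewrite (mEn n U) setDE leeD2r// le_leb_outer// => x Ex; split => //; exact: EU.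
have [U UP] := choice hull.
exists (\bigcup_n U n); split.
- by apply: bigcup_open => n _; have [] := UP n.
- move=> x Ex; have [n _ xn] : (\bigcup_n supball (0 : V) n.+1%:R) x.
    by rewrite supball_bigcup.
  by exists n => //; have [_ + _] := UP n; apply.
apply: (@le_trans _ _ (leb_outer (\bigcup_n (U n `\` En n)))).
  by apply: le_leb_outer => x [[n _ Ux] nE]; exists n => //; split => // -[].
apply: (le_trans (leb_outer_sigma_subadditive _)).
apply: le_trans (epsilon_trick0 xpredT (ltW e0)).
apply: lee_nneseries => [n _ _|n _]; first exact: leb_outer_ge0.
by have [] := UP n.
Qed.

Lemma closed_sup_ball (r : R) : closed [set x : V | `|x| <= r]%R.
Proof.
rewrite -[X in closed X]setCK closedC; apply/rV_openP => x /negP; rewrite -ltNge => rx.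
exists (`|x| - r)%R => [|y yx]; first by rewrite subr_gt0.
by apply/negP; rewrite -ltNge; have := lerB_dist x y; rewrite distrC; lra.
Qed.

Lemma measurable_sigma_compact E : measurable (E : set leb_space) ->
  exists C : nat -> set V, [/\ forall n, compact (C n), forall n, C n `<=` E &
    leb_outer (E `\` \bigcup_n C n) = 0].
Proof.
move=> mE.
have hull (n : nat) : exists U, [/\ open U, ~` E `<=` U &
    leb_outer (U `\` ~` E) <= (n.+1%:R^-1)%:E].
  by apply: measurable_open_hull; [exact: measurableC|rewrite invr_gt0].
have [U UP] := choice hull; have [f f_surj _] := nneseries_pairing.
pose Q (m : nat) : set V := [set x | `|x| <= m%:R]%R.
exists (fun i => ~` U (f i).1 `&` Q (f i).2); split.
- move=> i; apply: bounded_closed_compact.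
    exists (f i).2%:R; split; first exact: num_real.
    by move=> M /ltW mM x [_ /le_trans]; apply.
  apply: closedI; last exact: closed_sup_ball.
  by apply: open_closedC; have [] := UP (f i).1.
- move=> i x [nU _]; apply: contrapT => nE; apply: nU.
  by have [_ + _] := UP (f i).1; apply.
apply: leb_outer_eq0; apply/lee_addgt0Pr => e e0; rewrite add0e.
have einv0 : (0 <= e^-1)%R by rewrite invr_ge0 ltW.
pose n := Num.bound e^-1; apply: (@le_trans _ _ (leb_outer (U n `\` ~` E))).
  apply: le_leb_outer => x [Ex nx]; split; last by [].
  apply: contrapT => nU; apply: nx.
  have [i fi] := f_surj (n, Num.bound `|x|); exists i => //; rewrite fi; split => //=.
  by apply/ltW; exact: archi_boundP.
have [_ _ /le_trans] := UP n; apply.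
rewrite lee_fin invf_ple ?posrE// ltW// (lt_trans (archi_boundP einv0))//.
by rewrite ltr_nat.
Qed.

End lebesgue_regularity.

Section lipschitz_image.
Context {R : realType} (k : nat).
Local Notation V := 'rV[R]_k.+1.
Implicit Types (a b : V).

Lemma box_cubes a b (e : R) : 0 < e ->
  exists (t : R) (s : seq V), [/\ 0 < t,
    forall x, box a b x -> exists2 c, c \in s & box c (c + const_mx t) x &
    (size s)%:R * t ^+ k.+1 <= box_vol a b + e].
Proof.
move=> e0; pose l i := Num.max 0 (b 0 i - a 0 i).
have l0 i : 0 <= l i by rewrite le_max lexx.
have [t t0] := prodr_addr_le (enum 'I_k.+1) l e0; rewrite !big_enum/= => vol_le.
pose steps i := Num.truncn (l i / t).
pose corner (m : {dffun forall i : 'I_k.+1, 'I_(steps i).+1}) : V :=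
  \row_i (a 0 i + (m i)%:R * t).
exists t, [seq corner m | m <- enum {dffun forall i : 'I_k.+1, 'I_(steps i).+1}].
split => //.
- move=> x abx.
  have xa i : 0 <= (x 0 i - a 0 i) / t.
    by have /andP[ax _] := abx i; rewrite divr_ge0 ?subr_ge0// ltW.
  pose m : {dffun forall i : 'I_k.+1, 'I_(steps i).+1} :=
    finfun (fun i => inord (Num.truncn ((x 0 i - a 0 i) / t)) : 'I_(steps i).+1).
  exists (corner m); first by rewrite map_f// mem_enum.
  move=> i; rewrite !mxE ffunE inordK; last first.
    rewrite ltnS; apply: le_truncn; rewrite ler_pM2r ?invr_gt0//.
    by have /andP[_ /ltW xb] := abx i; rewrite le_max lerB ?orbT.
  have := truncn_itv (xa i).
  rewrite ler_pdivlMr// ltr_pdivrMr// => /andP[?].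
  by rewrite -natr1 mulrDl mul1r => ?; apply/andP; split; lra.
apply: le_trans vol_le; rewrite size_map -cardE card_dep_ffun foldrE big_map enumT.
rewrite -[Finite.enum _]enumT big_enum/=.
rewrite natr_prod -[X in _ ^+ X](card_ord k.+1) -prodr_const -big_split/=.
apply: ler_prod => i _; rewrite mulr_ge0 ?ler0n ?(ltW t0)//=.
rewrite card_ord -natr1 mulrDl mul1r lerD2r -ler_pdivlMr//.
by rewrite truncn_le// divr_ge0// ltW.
Qed.

Local Open Scope ereal_scope.

Lemma leb_outer_image_le (X : Type) (S : set X) (p q : X -> V) (c : R) : (0 < c)%R ->
  (forall a b, leb_outer (p @` (S `&` q @^-1` box a b)) <= (c * box_vol a b)%:E) ->
  leb_outer (p @` S) <= c%:E * leb_outer (q @` S).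
Proof.
move=> c0 box_le; rewrite -lee_pdivrMl//.
apply: le_ereal_inf_tmp => _ [a [b [qab ->]]]; rewrite lee_pdivrMl//.
apply: (@le_trans _ _ (leb_outer (\bigcup_n (p @` (S `&` q @^-1` box (a n) (b n)))))).
  apply: le_leb_outer => _ [x Sx <-].
  by have [|n _ nx] := qab (q x); [exists x|exists n => //; exists x].
apply: (le_trans (leb_outer_sigma_subadditive _)).
rewrite -nneseriesZl => [|n _]; last by rewrite lee_fin box_vol_ge0.
apply: lee_nneseries => [n _ _|n _]; first exact: leb_outer_ge0.
by rewrite -EFinM box_le.
Qed.

Lemma lipschitz_cube_image (X : Type) (S : set X) (p q : X -> V) (L L' t : R) (c : V) :
  (0 < L)%R -> (L < L')%R -> (0 < t)%R ->
  (forall x y, S x -> S y -> `|p x - p y| <= L * `|q x - q y|)%R ->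
  exists a, p @` (S `&` q @^-1` box c (c + const_mx t)%R) `<=`
    box a (a + const_mx (L' * t))%R.
Proof.
move=> L0 LL' t0 pq; pose Sc : set X := S `&` q @^-1` box c (c + const_mx t)%R.
have osc x y i : Sc x -> Sc y -> (p x 0%R i - p y 0%R i <= L * t)%R.
  move=> [Sx qx] [Sy qy]; apply: (le_trans (ler_norm _)).
  have := coord_rV_norm_le (p x - p y)%R i; rewrite !mxE => /le_trans; apply.
  apply: (le_trans (pq _ _ Sx Sy)); rewrite ler_pM2l//.
  apply/(rV_norm_leP _ (ltW t0)) => j; rewrite !mxE ler_norml.
  by move: (qy j) (qx j); rewrite !mxE => /andP[? ?] /andP[? ?]; apply/andP; split; lra.
exists (\row_i inf [set p x 0 i | x in Sc])%R => _ [x Scx <-] i.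
rewrite !mxE; set I := [set _ | _ in _].
have lbI : lbound I (p x 0%R i - L * t)%R.
  by move=> _ [y Scy <-]; have := osc _ _ i Scx Scy; lra.
have -> /= : (inf I <= p x 0 i)%R.
  by apply: ge_inf; [exists (p x 0%R i - L * t)%R|exists x].
have : (p x 0%R i - L * t <= inf I)%R by apply: lb_le_inf => //; exists (p x 0%R i), x.
have : (L * t < L' * t)%R by rewrite ltr_pM2r.
lra.
Qed.

Lemma lipschitz_box_image_lt (X : Type) (S : set X) (p q : X -> V) (L L' : R) a b :
  (0 < L)%R -> (L < L')%R ->
  (forall x y, S x -> S y -> `|p x - p y| <= L * `|q x - q y|)%R ->
  leb_outer (p @` (S `&` q @^-1` box a b)) <= (L' ^+ k.+1 * box_vol a b)%:E.
Proof.
move=> L0 LL' pq; have L'0 := lt_trans L0 LL'.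
have L'k0 : (0 < L' ^+ k.+1)%R by rewrite exprn_gt0.
rewrite EFinM -lee_pdivrMl//; apply/lee_addgt0Pr => e e0; rewrite lee_pdivrMl//.
have [t [s [t0 s_cover s_vol]]] := box_cubes a b e0.
have [a' a'P] := choice (fun c => lipschitz_cube_image c L0 LL' t0 pq).
apply: (@le_trans _ _ (\sum_(c <- s) (box_vol (a' c) (a' c + const_mx (L' * t))%R)%:E)).
  apply: leb_outer_fin_cover => _ [x [Sx qx] <-].
  by have [c cs cx] := s_cover _ qx; exists c => //; apply: a'P; exists x.
rewrite (eq_bigr (fun=> (L' ^+ k.+1 * t ^+ k.+1)%:E)); last first.
  move=> c _; congr EFin; rewrite /box_vol (eq_bigr (fun=> (L' * t)%R)).
    by rewrite prodr_const card_ord exprMn.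
  move=> i _; rewrite !mxE addrAC subrr add0r; apply/max_idPr.
  by rewrite mulr_ge0 ?ltW.
rewrite sumEFin -EFinD -EFinM lee_fin big_const_seq count_predT iter_addr_0.
by rewrite -mulr_natl mulrCA ler_pM2l.
Qed.

Lemma lipschitz_leb_outer (X : Type) (S : set X) (p q : X -> V) (L : R) :
  (0 < L)%R ->
  (forall x y, S x -> S y -> `|p x - p y| <= L * `|q x - q y|)%R ->
  leb_outer (p @` S) <= (L ^+ k.+1)%:E * leb_outer (q @` S).
Proof.
move=> L0 pq; have Lk0 : (0 < L ^+ k.+1)%R by rewrite exprn_gt0.
apply: leb_outer_image_le => // a b.
apply: (@lee_mulgt1X _ k); first by rewrite lee_fin mulr_ge0 ?box_vol_ge0// ltW.
move=> r r1; rewrite -EFinM mulrA -exprMn; apply: lipschitz_box_image_lt pq => //.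
by rewrite ltr_pMl.
Qed.

End lipschitz_image.

Section linear_image.
Context {R : realType} (k : nat).
Local Notation V := 'rV[R]_k.+1.
Local Notation M := 'M[R]_k.+1.
Implicit Types (A B N : M) (S : set V).

Definition mx_image B S : set V := (fun x : V => x *m B) @` S.

Lemma mx_imageM B A S : mx_image (B *m A) S = mx_image A (mx_image B S).
Proof.
by rewrite /mx_image image_comp; apply: eq_imagel => x _ /=; rewrite mulmxA.
Qed.

Lemma mx_image1 S : mx_image 1%:M S = S.
Proof.
rewrite /mx_image -[RHS](image_id S); apply: eq_imagel => x _.
by rewrite mulmx1.
Qed.

Definition dilates_at_most B (c : R) : Prop :=
  forall S, (leb_outer (mx_image B S) <= c%:E * leb_outer S)%E.

Lemma dilates_at_mostM B A (c d : R) : 0 <= d ->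
  dilates_at_most B c -> dilates_at_most A d -> dilates_at_most (B *m A) (c * d).
Proof.
move=> d0 Bc Ad S; rewrite mx_imageM; apply: (le_trans (Ad _)).
by rewrite mulrC EFinM -muleA lee_wpmul2l ?lee_fin.
Qed.

Lemma dilates_at_most_norm B (L : R) : 0 < L ->
  (forall x : V, `|x *m B| <= L * `|x|) -> dilates_at_most B (L ^+ k.+1).
Proof.
move=> L0 BL S; rewrite -{2}(image_id S); apply: lipschitz_leb_outer => // x y _ _.
by rewrite -mulmxBl; exact: BL.
Qed.

Lemma mulmx_coord_norm_le (x : V) B j : `|(x *m B) 0 j| <= (\sum_i `|B i j|) * `|x|.
Proof.
rewrite mxE; apply: (le_trans (ler_norm_sum _ _ _)); rewrite mulr_suml.
by apply: ler_sum => i _; rewrite normrM mulrC ler_wpM2l// coord_rV_norm_le.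
Qed.

Lemma mulmx_norm_le (x : V) B (d : R) : 0 <= d -> (forall j, \sum_i `|B i j| <= d) ->
  `|x *m B| <= d * `|x|.
Proof.
move=> d0 Bd; apply/rV_norm_leP => [|j]; first by rewrite mulr_ge0.
by apply: (le_trans (mulmx_coord_norm_le x B j)); rewrite ler_wpM2r.
Qed.

Definition mx_sum_norm B : R := \sum_i \sum_j `|B i j|.

Lemma mx_sum_norm_ge0 B : 0 <= mx_sum_norm B.
Proof. by apply: sumr_ge0 => i _; exact: sumr_ge0. Qed.

Lemma mulmx_sum_norm_le (x : V) B : `|x *m B| <= mx_sum_norm B * `|x|.
Proof.
apply: mulmx_norm_le (mx_sum_norm_ge0 B) _ => j; apply: ler_sum => i _.
by rewrite (bigD1 j)//= lerDl sumr_ge0.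
Qed.

Lemma dilates_at_most_diag (d : V) : (forall i, 0 < d 0 i) ->
  dilates_at_most (diag_mx d) (\prod_i d 0 i).
Proof.
move=> d0 S; rewrite -{2}(image_id S).
apply: leb_outer_image_le => [|a b]; first by apply: prodr_gt0.
pose scale (u : V) := u *m diag_mx d.
apply: (@le_trans _ _ (leb_outer (box (scale a) (scale b)))).
  apply: le_leb_outer => _ [x [_ abx] <-] i.
  by rewrite /scale !mul_mx_diag !mxE ler_pM2r ?ltr_pM2r//; exact: abx.
apply: (le_trans (leb_outer_box _ _)); rewrite lee_fin /box_vol -big_split/=.
apply: ler_prod => i _; rewrite le_max lexx/= /scale !mul_mx_diag !mxE -mulrBl mulrC.
rewrite ge_max mulr_ge0 ?(ltW (d0 i)) ?le_max ?lexx//=.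
by rewrite ler_pM2l// le_max lexx orbT.
Qed.

Lemma dilates_at_most_perm (s : 'S_k.+1) : dilates_at_most (perm_mx s) 1.
Proof.
rewrite -(expr1n R k.+1); apply: dilates_at_most_norm => // x; rewrite mul1r.
by apply/rV_norm_leP => // i; rewrite -[s]invgK -col_permE mxE coord_rV_norm_le.
Qed.

Section triangular.
Variables (B : M) (w : 'I_k.+1 -> nat).
Hypothesis B_triangular : forall i j, i != j -> (w i <= w j)%N -> B i j = 0.
Hypothesis B_diag : forall i, B i i != 0.

Definition weight_conj (t : R) : M :=
  \matrix_(i, j) (`|B i i|^-1 * (t ^+ w i * B i j * t ^- w j)).

Lemma weight_conjE t : 0 < t ->
  B = diag_mx (\row_i t ^- w i) *m (diag_mx (\row_i `|B i i|) *m
    (weight_conj t *m diag_mx (\row_i t ^+ w i))).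
Proof.
move=> t0; apply/matrixP => i j; rewrite !mul_diag_mx mul_mx_diag !mxE.
have tw n : t ^+ n != 0 by rewrite expf_neq0// gt_eqF.
have := tw (w i); have := tw (w j); have : `|B i i| != 0 by rewrite normr_eq0.
move: (t ^+ w i) (t ^+ w j) (`|B i i|) => x y z z0 y0 x0.
by field; rewrite x0 y0 z0.
Qed.

Lemma weight_conj_col_sum t j : 0 < t -> t <= 1 ->
  \sum_i `|weight_conj t i j| <= 1 + t * \sum_i `|B i j| / `|B i i|.
Proof.
move=> t0 t1; have tw0 n : 0 < t ^+ n by rewrite exprn_gt0.
rewrite (bigD1 j)//=; apply: lerD.
  rewrite mxE mulrAC divff ?gt_eqF// mul1r normrM normfV normr_id.
  by rewrite mulVf// normr_eq0.
apply: (@le_trans _ _ (\sum_(i | i != j) t * (`|B i j| / `|B i i|))).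
  apply: ler_sum => i ij; rewrite mxE.
  have [wij|wij] := leqP (w i) (w j).
    by rewrite (B_triangular ij wij) !(mulr0, mul0r, normr0).
  rewrite !normrM !normfV normr_id !(gtr0_norm (tw0 _)) mulrC mulrA ler_wpM2r ?invr_ge0//.
  rewrite mulrAC ler_wpM2r// -expfB//.
  by rewrite -[leRHS]expr1 ler_wiXn2l ?(ltW t0)// subn_gt0.
rewrite -mulr_sumr ler_wpM2l ?(ltW t0)// [leRHS](bigD1 j)//= lerDr.
by rewrite divr_ge0.
Qed.

Lemma weight_conj_dilates_at_most (r : R) : 1 < r ->
  exists2 t, 0 < t & dilates_at_most (weight_conj t) (r ^+ k.+1).
Proof.
move=> r1; have r0 : 0 < r by apply: lt_trans r1.
have col0 j : 0 <= \sum_i `|B i j| / `|B i i| by apply: sumr_ge0 => i _; rewrite divr_ge0.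
pose C := \sum_j \sum_i `|B i j| / `|B i i|; have C0 : 0 <= C by apply: sumr_ge0.
pose t := Num.min 1 ((r - 1) / (C + 1)).
have t0 : 0 < t by rewrite lt_min ltr01 divr_gt0 ?subr_gt0// ltr_wpDl.
have t1 : t <= 1 by rewrite ge_min lexx.
have tC : t * (C + 1) <= r - 1.
  by rewrite -ler_pdivlMr ?ltr_wpDl// ge_min lexx orbT.
exists t => //; apply: dilates_at_most_norm => // x.
apply: mulmx_norm_le => [|j]; first exact: ltW.
apply: (le_trans (weight_conj_col_sum j t0 t1)).
have : t * (\sum_i `|B i j| / `|B i i|) <= t * C.
  by rewrite ler_wpM2l ?(ltW t0)// /C [leRHS](bigD1 j)//= lerDl sumr_ge0.
by move: tC; lra.
Qed.

(* Conjugating by [diag (t ^ w i)] multiplies the off-diagonal entries by at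
   most [t], so that [B] becomes nearly diagonal as [t -> 0]. *)
Lemma dilates_at_most_triangular : dilates_at_most B (\prod_i `|B i i|).
Proof.
move=> S; have prod_gt0 (d : V) : (forall i, 0 < d 0 i) -> 0 < \prod_i d 0 i.
  by move=> d0; apply: prodr_gt0.
apply: (@lee_mulgt1X _ k).
  by rewrite mule_ge0 ?leb_outer_ge0// lee_fin prodr_ge0.
move=> r r1; have [t t0 conj_le] := weight_conj_dilates_at_most r1.
have rk0 : 0 < r ^+ k.+1 by rewrite exprn_gt0// (lt_trans ltr01).
pose u : V := \row_i t ^- w i; pose v : V := \row_i t ^+ w i.
pose bd : V := \row_i `|B i i|.
have u0 i : 0 < u 0 i by rewrite mxE invr_gt0 exprn_gt0.
have v0 i : 0 < v 0 i by rewrite mxE exprn_gt0.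
have bd0 i : 0 < bd 0 i by rewrite mxE normr_gt0.
have : dilates_at_most B (\prod_i u 0 i * (\prod_i bd 0 i *
    (r ^+ k.+1 * \prod_i v 0 i))).
  rewrite [B in dilates_at_most B](weight_conjE t0).
  by do 3![apply: dilates_at_mostM; rewrite ?mulr_ge0 ?ltW ?prod_gt0//;
    try exact: dilates_at_most_diag].
move=> /(_ S); rewrite muleA -EFinM; congr (_ <= _%:E * _)%E.
have -> : \prod_i bd 0 i = \prod_i `|B i i| by apply: eq_bigr => i _; rewrite mxE.
have uv : (\prod_i u 0 i) * (\prod_i v 0 i) = 1.
  by rewrite -big_split/= big1// => i _; rewrite !mxE mulVf// gt_eqF// exprn_gt0.
by rewrite !mulrA mulrAC [X in X * _]mulrAC uv mul1r mulrC.
Qed.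

End triangular.

Lemma dilates_at_most_det B : \det B != 0 -> dilates_at_most B `|\det B|.
Proof.
move=> B0; have := cormen_lup_perm B; have := cormen_lup_correct B.
have := cormen_lup_detL B; have := cormen_lup_lower B; have := @cormen_lup_upper R k B.
case: (cormen_lup B) => [[P L] U] /= U_upper L_lower detL PB /is_perm_mxP[s Ps].
have L_diag i : L i i = 1 by rewrite L_lower// eqxx.
have detU : `|\det U| = `|\det B|.
  have := congr1 determinant PB; rewrite !det_mulmx detL mul1r => <-.
  by rewrite normrM Ps det_perm normrX normrN1 expr1n mul1r.
have detUE : \det U = \prod_i U i i.
  rewrite -det_tr det_trig; first by apply: eq_bigr => i _; rewrite mxE.
  by apply/is_trig_mxP => i j ij; rewrite mxE U_upper.
have U_diag i : U i i != 0.
  have : \det U != 0 by rewrite -normr_eq0 detU normr_eq0.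
  by rewrite detUE => /prodf_neq0 /(_ i isT).
have BE : B = perm_mx (s^-1)%g *m (L *m U).
  rewrite (_ : L *m U = P *m B) //; rewrite Ps mulmxA -perm_mxM mulVg perm_mx1.
  by rewrite mul1mx.
have L_le : dilates_at_most L 1.
  rewrite (_ : 1 = \prod_(i < k.+1) `|L i i|); last first.
    by rewrite big1// => i _; rewrite L_diag normr1.
  apply: (@dilates_at_most_triangular L (fun i => i)) => [i j ij wij|i].
    by rewrite L_lower// (negbTE ij).
  by rewrite L_diag oner_neq0.
have U_le : dilates_at_most U `|\det U|.
  rewrite detUE normr_prod.
  apply: (@dilates_at_most_triangular U (fun i => (k - i)%N)) => // i j ij wij.
  apply: U_upper; rewrite ltn_neqAle eq_sym ij /=.
  by move: wij; rewrite leq_sub2lE// -ltnS.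
have := dilates_at_mostM _ (dilates_at_most_perm (s^-1)%g)
  (dilates_at_mostM (normr_ge0 _) L_le U_le).
by rewrite -BE !mul1r detU; apply.
Qed.

Lemma leb_outer_mx_image_ge B S : \det B != 0 ->
  (`|\det B|%:E * leb_outer S <= leb_outer (mx_image B S))%E.
Proof.
move=> B0; have uB : B \in unitmx by rewrite unitmxE unitfE.
have detB0 : 0 < `|\det B| by rewrite normr_gt0.
have := @dilates_at_most_det (invmx B) _ (mx_image B S).
rewrite -mx_imageM mulmxV// mx_image1 det_inv normfV.
by rewrite -lee_pdivlMl// => ->//; rewrite invr_eq0.
Qed.

Lemma almost_linear_leb_outer_ge B S (f : V -> V) (L : R) : \det B != 0 -> 0 < L ->
  (forall x y, S x -> S y -> `|(x - y) *m B| <= L * `|f x - f y|) ->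
  (`|\det B|%:E * leb_outer S <= (L ^+ k.+1)%:E * leb_outer (f @` S))%E.
Proof.
move=> B0 L0 Bf; apply: (le_trans (leb_outer_mx_image_ge S B0)).
by apply: lipschitz_leb_outer => // x y Sx Sy; rewrite -mulmxBl; exact: Bf.
Qed.

End linear_image.

(** * The area inequality *)

Section separable_measurability.
Context {R : realType} (k : nat).
Local Notation V := 'rV[R]_k.+1.
Local Notation leb_space := (@leb_space R k).

Definition separable (X : normedZmodType R) : Prop :=
  exists d : nat -> X, forall x (e : R), 0 < e -> exists n, `|x - d n| < e.

Lemma kopen_ball (X : normedZmodType R) (z : X) (r : R) :
  kopen [set w : X | `|w - z| < r].
Proof.
move=> w /= wr; exists (r - `|w - z|); first by rewrite subr_gt0.
by move=> u uw; have := ler_distD w u z; lra.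
Qed.

Definition open_rel (X Y : normedZmodType R) (W : X -> Y -> Prop) : Prop :=
  forall x y, W x y -> exists2 e : R, 0 < e &
    forall x' y', `|x' - x| < e -> `|y' - y| < e -> W x' y'.

Lemma open_rel_lipschitz_lt0 (X Y : normedZmodType R) (D : X -> Y -> R) (C : R) :
  (forall x y x' y', D x' y' <= D x y + C * (`|x' - x| + `|y' - y|)) ->
  open_rel (fun x y => D x y < 0).
Proof.
move=> lipD x y Dxy; have C0 : 0 < `|C| + 1 by rewrite ltr_wpDl.
exists (- D x y / (2 * (`|C| + 1))); first by rewrite divr_gt0 ?mulr_gt0// oppr_gt0.
move=> x' y'; rewrite !ltr_pdivlMr ?mulr_gt0// => xx' yy'.
apply: (le_lt_trans (lipD x y x' y')).
have := ler_norm C; have := normr_ge0 (x' - x); have := normr_ge0 (y' - y).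
nra.
Qed.

Lemma measurable_open_rel (X Y : normedZmodType R) (Om : set V) (u : V -> X)
    (v : V -> Y) (W : X -> Y -> Prop) :
  separable X -> separable Y -> kmeasurable Om u -> kmeasurable Om v -> open_rel W ->
  measurable (Om `&` [set x | W (u x) (v x)] : set leb_space).
Proof.
move=> [dX dXP] [dY dYP] mu_ mv oW; pose r (j : nat) : R := j.+1%:R^-1.
pose BX (p : nat * nat * nat) : set X := [set w : X | `|w - dX p.1.1| < r p.2].
pose BY (p : nat * nat * nat) : set Y := [set w : Y | `|w - dY p.1.2| < r p.2].
pose F (p : nat * nat * nat) : set leb_space :=
  if `[< forall x y, BX p x -> BY p y -> W x y >] then
    (Om `&` u @^-1` (BX p)) `&` (Om `&` v @^-1` (BY p)) else set0.
have -> : Om `&` [set x | W (u x) (v x)] = \bigcup_p F p.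
  apply/seteqP; split => x; last first.
    move=> [p _]; rewrite /F; case: asboolP => // pW [[Ox ux] [_ vx]].
    by split => //; exact: pW.
  move=> [Ox /oW[e e0 eW]]; have e20 : 0 <= 2 / e by rewrite divr_ge0// ltW.
  pose j := Num.bound (2 / e); have rj0 : 0 < r j by rewrite invr_gt0.
  have rj : 2 * r j < e.
    rewrite /r ltr_pdivrMr// mulrC -ltr_pdivrMr//.
    by rewrite (lt_trans (archi_boundP e20))// ltr_nat.
  have [n xn] := dXP (u x) _ rj0; have [m ym] := dYP (v x) _ rj0.
  exists (n, m, j) => //; rewrite /F asboolT//.
  move=> x' y'; rewrite /BX /BY /= => x'n y'm; apply: eW.
    by have := ler_distD (dX n) x' (u x); rewrite (distrC (dX n)); lra.
  by have := ler_distD (dY m) y' (v x); rewrite (distrC (dY m)); lra.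
apply: countable_bigcupT_measurable; first exact: countableP.
move=> p; rewrite /F; case: asboolP => // _; apply: measurableI.
  by apply: mu_; exact: kopen_ball.
by apply: mv; exact: kopen_ball.
Qed.

Lemma separable_rV : separable (V : normedZmodType R).
Proof.
exists (fun n => if unpickle n is Some p then map_mx ratr (p : 'rV[rat]_k.+1) else 0).
move=> x e e0; have [p px] := rational_mx_below x e0.
exists (pickle p); rewrite pickleK; apply/rV_norm_ltP => // i.
by have /andP[? ?] := px 0 i; rewrite !mxE ltr_norml; apply/andP; split; lra.
Qed.

Lemma kopen_openP (U : set V) : kopen (K := (V : normedZmodType R)) U <-> open U.
Proof. by rewrite rV_openP. Qed.

Lemma vmeasurable_kmeasurable (Om : set V) (f : V -> V) :
  vmeasurable Om f -> kmeasurable (K := (V : normedZmodType R)) Om f.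
Proof. by move=> mf U /kopen_openP; exact: mf. Qed.

Lemma kmeasurable_id (Om : set V) : open Om ->
  kmeasurable (K := (V : normedZmodType R)) Om id.
Proof.
by move=> oOm U /kopen_openP oU; apply: (measurable_open (U := Om `&` U)); exact: openI.
Qed.

Lemma measurable_open_rel_graph (Om : set V) (f : V -> V) (W : V -> V -> Prop) :
  open Om -> vmeasurable Om f ->
  open_rel (X := (V : normedZmodType R)) (Y := (V : normedZmodType R)) W ->
  measurable (Om `&` [set x | W x (f x)] : set leb_space).
Proof.
move=> oOm mf; apply: (measurable_open_rel (u := id)); first exact: separable_rV.
- exact: separable_rV.
- exact: kmeasurable_id.
- exact: vmeasurable_kmeasurable.
Qed.

End separable_measurability.

Section balls.
Context {R : realType} (k : nat).
Local Notation V := 'rV[R]_k.+1.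
Local Notation M := 'M[R]_k.+1.
Implicit Types (x y z : V) (A B : M).

Lemma rV_norm_le_enorm x : `|x| <= enorm x.
Proof.
apply/rV_norm_leP => [|i]; first exact: sqrtr_ge0.
rewrite -sqrtr_sqr; apply: ler_wsqrtr; rewrite (bigD1 i)//= lerDl.
by apply: sumr_ge0 => j _; exact: sqr_ge0.
Qed.

Lemma enorm_le_rV_norm x : enorm x <= k.+1%:R * `|x|.
Proof.
rewrite -[leRHS]ger0_norm ?mulr_ge0// -sqrtr_sqr; apply: ler_wsqrtr.
apply: (@le_trans _ _ (\sum_(i < k.+1) `|x| ^+ 2)).
  apply: ler_sum => i _; rewrite -real_normK ?num_real//.
  by rewrite lerXn2r ?nnegrE ?coord_rV_norm_le.
rewrite sumr_const card_ord -[leLHS]mulr_natl exprMn ler_wpM2r ?sqr_ge0//.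
by rewrite -natrX ler_nat expnS expn1 leq_pmull.
Qed.

Lemma leb_outer_supball_scale x y (r s : R) : 0 < r -> 0 < s ->
  (leb_outer (supball y s) <= ((s / r) ^+ k.+1)%:E * leb_outer (supball x r))%E.
Proof.
move=> r0 s0; have sr0 : 0 < s / r by rewrite divr_gt0.
pose h z := y + (s / r) *: (z - x).
apply: (@le_trans _ _ (leb_outer (h @` supball x r))).
  apply: le_leb_outer => z /= zy; exists (x + (r / s) *: (z - y)).
    rewrite /supball /= addrAC subrr add0r normrZ gtr0_norm ?divr_gt0//.
    by rewrite mulrAC ltr_pdivrMr// ltr_pM2l.
  rewrite /h [x + _]addrC addrK scalerA mulf_div [s * r]mulrC divff.
    by rewrite scale1r addrC subrK.
  by rewrite mulf_neq0// gt_eqF.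
rewrite -{2}(image_id (supball x r)); apply: lipschitz_leb_outer => // u v _ _.
rewrite /h opprD addrACA subrr add0r -scalerBr opprB addrA addrNK.
by rewrite normrZ gtr0_norm.
Qed.

Lemma leb_outer_null_supball x (r : R) (S : set V) : 0 < r ->
  leb_outer (supball x r) = 0%E -> leb_outer S = 0%E.
Proof.
move=> r0 x0; apply: leb_outer_eq0.
apply: (@le_trans _ _ (leb_outer (\bigcup_n supball (0 : V) n.+1%:R))).
  by rewrite supball_bigcup; exact: le_leb_outer.
apply: (le_trans (leb_outer_sigma_subadditive _)).
rewrite eseries0// => n _ _; apply: leb_outer_eq0.
by apply: (le_trans (leb_outer_supball_scale x 0 r0 _)) => //; rewrite x0 mule0.
Qed.

Hypothesis ball_gt0 : (0 < leb_outer (supball (0 : V) 1))%E.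

Lemma leb_outer_supball_gt0 x (r : R) : 0 < r -> (0 < leb_outer (supball x r))%E.
Proof.
move=> r0; rewrite lt0e leb_outer_ge0 andbT; apply/eqP => null_ball.
by move: ball_gt0; rewrite (leb_outer_null_supball _ r0 null_ball) ltxx.
Qed.

Lemma det_le_dominated A B (L : R) : 0 < L -> \det A != 0 -> \det B != 0 ->
  (forall v : V, `|v *m B| <= L * `|v *m A|) ->
  `|\det B| <= L ^+ k.+1 * `|\det A|.
Proof.
move=> L0 A0 B0 BA; pose S := supball (0 : V) 1.
have Sf : leb_outer S \is a fin_num.
  by rewrite ge0_fin_numE ?leb_outer_ge0// leb_outer_supball_lty.
have S0 : 0 < fine (leb_outer S) by rewrite fine_gt0// ball_gt0 leb_outer_supball_lty.
have BA_image : (leb_outer (mx_image B S) <= (L ^+ k.+1)%:E * leb_outer (mx_image A S))%E.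
  by apply: lipschitz_leb_outer => // x y _ _; rewrite -!mulmxBl; exact: BA.
have := le_trans (leb_outer_mx_image_ge S B0) BA_image.
move=> /le_trans /(_ (lee_wpmul2l _ (dilates_at_most_det A0 S))).
rewrite lee_fin exprn_ge0 ?(ltW L0)// => /(_ isT).
by rewrite -(fineK Sf) -!EFinM lee_fin mulrA ler_pM2r.
Qed.

End balls.

Section density_overlap.
Context {R : realType} (k : nat).
Local Notation V := 'rV[R]_k.+1.
Local Notation M := 'M[R]_k.+1.
Local Notation leb_space := (@leb_space R k).
Local Notation dim := (k.+1%:R : R).
Implicit Types (x y z : V) (A : M).

Variables (Om : set V) (f : V -> V).

Definition almost_affine_set A (e : R) x : set V :=
  [set z | Om z /\ `|f z - f x - (z - x) *m A| < e * `|z - x|].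

(* A ball of radius [2 * dim * rho] and a sup-norm ball of radius [rho] have
   measures of ratio at most [(2 * dim) ^ k.+1]: a quarter of the latter ball
   remains when the bad points around two nearby centres are removed. *)
Definition overlap_cst : R := (4 * (2 * dim) ^+ k.+1)^-1.

Definition almost_affine_dense A (e : R) (m : nat) x : Prop :=
  forall r : R, 0 < r -> r < m.+1%:R^-1 ->
    ((1 - overlap_cst)%:E * leb_outer (eball x r) <=
     leb_outer (almost_affine_set A e x `&` eball x r))%E.

Lemma overlap_cst_gt0 : 0 < overlap_cst.
Proof. by rewrite invr_gt0 mulr_gt0// exprn_gt0// mulr_gt0. Qed.

Hypothesis oOm : open Om.
Hypothesis mf : vmeasurable Om f.

Lemma measurable_almost_affine_set A e x :
  measurable (almost_affine_set A e x : set leb_space).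
Proof.
rewrite (_ : almost_affine_set A e x = Om `&` [set z |
    `|f z - f x - (z - x) *m A| - e * `|z - x| < 0]); last first.
  by apply/seteqP; split => z [? /=] ?; split => //=; rewrite ?subr_lt0// -subr_lt0.
pose D (z w : V) := `|w - f x - (z - x) *m A| - e * `|z - x|.
apply: (measurable_open_rel_graph (W := fun z w => D z w < 0)) => //.
apply: (@open_rel_lipschitz_lt0 _ _ _ D (mx_sum_norm A + `|e| + 1)) => z w z' w'.
have affine_le : `|w' - f x - (z' - x) *m A| <=
    `|w - f x - (z - x) *m A| + `|w' - w| + mx_sum_norm A * `|z' - z|.
  rewrite [X in `|X| <= _](_ : _ = (w - f x - (z - x) *m A) + (w' - w) - (z' - z) *m A).
    rewrite (le_trans (ler_normB _ _))// lerD ?ler_normD//; exact: mulmx_sum_norm_le.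
  by apply/rowP => i; rewrite !mulmxBl !mxE; ring.
have dist_le : - (e * `|z' - x|) <= - (e * `|z - x|) + `|e| * `|z' - z|.
  have : `|e * (`|z' - x| - `|z - x|)| <= `|e| * `|z' - z|.
    rewrite normrM ler_wpM2l// (le_trans (ler_dist_dist _ _))//.
    by rewrite opprB addrA addrNK.
  by rewrite ler_norml mulrBr => /andP[]; lra.
have sA0 := mx_sum_norm_ge0 A; have e0 := normr_ge0 e.
have := mulr_ge0 sA0 (normr_ge0 (w' - w)); have := mulr_ge0 e0 (normr_ge0 (w' - w)).
have := normr_ge0 (z' - z); rewrite /D; move: affine_le dist_le; lra.
Qed.

Lemma not_almost_affine_le A e m x r :
  almost_affine_dense A e m x -> 0 < r -> r < m.+1%:R^-1 ->
  (leb_outer (eball x r `\` almost_affine_set A e x) <=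
   overlap_cst%:E * leb_outer (eball x r))%E.
Proof.
move=> dense_x r0 /(dense_x _ r0); set G := almost_affine_set A e x.
have ball_split : leb_outer (eball x r) =
    (leb_outer (G `&` eball x r) + leb_outer (eball x r `\` G))%E.
  by rewrite [G `&` _]setIC setDE; exact: measurable_almost_affine_set.
have ball_fin : leb_outer (eball x r) \is a fin_num.
  rewrite ge0_fin_numE ?leb_outer_ge0//.
  apply: (le_lt_trans _ (leb_outer_supball_lty x r)); apply: le_leb_outer => z.
  exact: le_lt_trans (rV_norm_le_enorm _).
have part_fin (S : set V) : S `<=` eball x r -> leb_outer S \is a fin_num.
  move=> Sx; rewrite ge0_fin_numE ?leb_outer_ge0//.
  by apply: (le_lt_trans (le_leb_outer Sx)); rewrite -ge0_fin_numE ?leb_outer_ge0.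
move: ball_split; rewrite -(fineK ball_fin) -(fineK (part_fin _ (@subIsetr _ G _))).
rewrite -(fineK (part_fin _ (@subDsetl _ _ G))) -!EFinM -EFinD => -[].
by rewrite !lee_fin; lra.
Qed.

Hypothesis ball_gt0 : (0 < leb_outer (supball (0 : V) 1))%E.

Lemma not_almost_affine_quarter A e m x y (rho : R) : almost_affine_dense A e m x ->
  0 < rho -> 2 * dim * rho < m.+1%:R^-1 ->
  (leb_outer (eball x (2 * dim * rho) `\` almost_affine_set A e x) <=
   4^-1%:E * leb_outer (supball y rho))%E.
Proof.
move=> dense_x rho0 rho_m; have r0 : 0 < 2 * dim * rho by rewrite !mulr_gt0.
apply: (le_trans (not_almost_affine_le dense_x r0 rho_m)).
have eball_le : (leb_outer (eball x (2 * dim * rho)) <=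
    ((2 * dim) ^+ k.+1)%:E * leb_outer (supball y rho))%E.
  apply: (@le_trans _ _ (leb_outer (supball x (2 * dim * rho)))).
    by apply: le_leb_outer => z; exact: le_lt_trans (rV_norm_le_enorm _).
  by have := leb_outer_supball_scale y x rho0 r0; rewrite mulfK// gt_eqF.
apply: (le_trans (lee_wpmul2l _ eball_le)).
  by rewrite lee_fin ltW// overlap_cst_gt0.
by rewrite muleA -EFinM /overlap_cst invfM mulfVK// gt_eqF// exprn_gt0.
Qed.

Lemma almost_affine_overlap A e m x y : x != y ->
  almost_affine_dense A e m x -> almost_affine_dense A e m y ->
  2 * dim * `|x - y| < m.+1%:R^-1 ->
  exists z, [/\ `|z - x| < `|x - y|, almost_affine_set A e x z
    & almost_affine_set A e y z].
Proof.
move=> xy dense_x dense_y xym; pose rho := `|x - y|.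
have rho0 : 0 < rho by rewrite normr_gt0 subr_eq0.
pose Q := supball x rho; pose r := 2 * dim * rho.
have Qfin : leb_outer Q \is a fin_num.
  by rewrite ge0_fin_numE ?leb_outer_ge0// leb_outer_supball_lty.
have Q_eball u : `|x - u| <= rho -> Q `<=` eball u r.
  move=> xu z Qz; apply: (le_lt_trans (enorm_le_rV_norm _)).
  rewrite /r [2 * dim]mulrC -mulrA ltr_pM2l//.
  by have := ler_distD x z u; move: Qz; rewrite /Q /supball/=; lra.
apply: contrapT => no_overlap.
have Q_sub : Q `<=` (eball x r `\` almost_affine_set A e x) `|`
    (eball y r `\` almost_affine_set A e y).
  move=> z Qz; have [Gx|nGx] := pselect (almost_affine_set A e x z); [right|left].
    by split=> [|Gy]; [exact: (Q_eball y)|apply: no_overlap; exists z].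
  by split => //; apply: Q_eball => //; rewrite subrr normr0 ltW.
have : (leb_outer Q <= 4^-1%:E * leb_outer Q + 4^-1%:E * leb_outer Q)%E.
  apply: (le_trans (le_leb_outer Q_sub)); apply: (le_trans (outer_measureU2 _ _ _)).
  exact: leeD (not_almost_affine_quarter x dense_x rho0 xym)
    (not_almost_affine_quarter x dense_y rho0 xym).
have : 0 < fine (leb_outer Q).
  by rewrite fine_gt0// leb_outer_supball_gt0//= leb_outer_supball_lty.
by rewrite -(fineK Qfin) -!EFinM -EFinD lee_fin /=; lra.
Qed.

Lemma almost_affine_pair A e m x y : 0 < e ->
  almost_affine_dense A e m x -> almost_affine_dense A e m y ->
  2 * dim * `|x - y| < m.+1%:R^-1 ->
  `|f x - f y - (x - y) *m A| <= 3 * e * `|x - y|.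
Proof.
move=> e0 dense_x dense_y xym.
have [->|xy] := eqVneq x y; first by rewrite !subrr mul0mx subr0 normr0 mulr0.
have [z [zx [_ affine_x] [_ affine_y]]] := almost_affine_overlap xy dense_x dense_y xym.
have -> : f x - f y - (x - y) *m A =
   (f z - f y - (z - y) *m A) - (f z - f x - (z - x) *m A).
  by apply/rowP => i; rewrite !mulmxBl !mxE; ring.
apply: (le_trans (ler_normB _ _)).
have zy : e * `|z - y| <= e * (2 * `|x - y|).
  by rewrite ler_pM2l//; have := ler_distD x z y; lra.
have : e * `|z - x| <= e * `|x - y| by rewrite ler_pM2l// ltW.
by lra.
Qed.

End density_overlap.

Section rational_approximation.
Context {R : realType} (k : nat).
Local Notation V := 'rV[R]_k.+1.
Local Notation M := 'M[R]_k.+1.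
Implicit Types (x : V) (A B : M).

Lemma mulmx_expanding_det_neq0 A (c : R) : (forall x, `|x| <= c * `|x *m A|) ->
  \det A != 0.
Proof.
move=> expA; apply/negP => /det0P[v v0 vA].
by have := expA v; rewrite vA normr0 mulr0 normr_le0; exact/negP.
Qed.

Lemma mulmx_expanding B : \det B != 0 ->
  exists2 b, 0 < b & forall x, `|x| <= b * `|x *m B|.
Proof.
move=> B0; have uB : B \in unitmx by rewrite unitmxE unitfE.
exists (mx_sum_norm (invmx B) + 1); first by rewrite ltr_wpDl// mx_sum_norm_ge0.
move=> x; rewrite -{1}(mulmxK uB x); apply: (le_trans (mulmx_sum_norm_le _ _)).
by rewrite ler_wpM2r// lerDl.
Qed.

Lemma mulmx_expanding_perturb A B (b d : R) x : 0 <= b -> b * d <= 2^-1 ->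
  `|x| <= b * `|x *m B| -> `|x *m (B - A)| <= d * `|x| ->
  `|x| <= 2 * b * `|x *m A|.
Proof.
move=> b0 bd expB BA; have B_le : `|x *m B| <= `|x *m A| + d * `|x|.
  rewrite (_ : x *m B = x *m A + x *m (B - A)).
    by rewrite (le_trans (ler_normD _ _))// lerD2l.
  by rewrite mulmxBr addrC subrK.
have : b * `|x *m B| <= b * (`|x *m A| + d * `|x|) by rewrite ler_wpM2l.
have : b * d * `|x| <= 2^-1 * `|x| by rewrite ler_wpM2r.
by move: expB; lra.
Qed.

Lemma rational_mx_approx B (d : R) : 0 < d ->
  exists A : 'M[rat]_k.+1, forall x, `|x *m (B - map_mx ratr A)| <= d * `|x|.
Proof.
move=> d0; have dk0 : 0 < d / k.+1%:R by rewrite divr_gt0.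
have [A AP] := rational_mx_below B dk0; exists A => x.
apply: mulmx_norm_le => [|j]; first exact: ltW.
apply: (@le_trans _ _ (\sum_(i < k.+1) d / k.+1%:R)).
  apply: ler_sum => i _; have /andP[lt_q q_lt] := AP i j.
  by rewrite !mxE ger0_norm ?subr_ge0 ?(ltW q_lt)// lerBlDl -lerBlDr ltW.
by rewrite sumr_const card_ord -[leLHS]mulr_natr mulfVK.
Qed.

Hypothesis ball_gt0 : (0 < leb_outer (supball (0 : V) 1))%E.

Lemma rational_mx_dominates B (eta : R) : 0 < eta -> \det B != 0 ->
  exists (A : 'M[rat]_k.+1) (j : nat), let A' : M := map_mx ratr A in
    [/\ \det A' != 0,
        forall x, 3 * j.+1%:R^-1 * `|x| <= eta * `|x *m A'|,
        forall x, `|x *m (B - A')| <= j.+1%:R^-1 / 2 * `|x| &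
        `|\det B| <= (1 + eta) ^+ k.+1 * `|\det A'|].
Proof.
move=> eta0 B0; have [b b0 expB] := mulmx_expanding B0.
have ratio0 : 0 <= 6 * b / eta by rewrite divr_ge0 ?mulr_ge0// ltW.
pose j := Num.bound (6 * b / eta); pose e : R := j.+1%:R^-1.
have e0 : 0 < e by rewrite invr_gt0.
have e_eta : 6 * b * e <= eta.
  rewrite /e ler_pdivrMr// [eta * _]mulrC -ler_pdivrMr// ltW//.
  by rewrite (lt_trans (archi_boundP ratio0))// ltr_nat.
pose d := Num.min (e / 2) (Num.min (2 * b)^-1 (eta / (2 * b))).
have b20 : 0 < 2 * b by rewrite mulr_gt0.
have d0 : 0 < d by rewrite !lt_min divr_gt0//= invr_gt0 b20/= divr_gt0.
have [A BA] := rational_mx_approx B d0; exists A, j => A'.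
have expA x : `|x| <= 2 * b * `|x *m A'|.
  apply: mulmx_expanding_perturb (expB x) (BA x); first exact: ltW.
  apply: (@le_trans _ _ (b * (2 * b)^-1)).
    by rewrite ler_pM2l// !ge_min lexx orbT.
  by rewrite invfM mulrCA divff ?mulr1// gt_eqF.
have A0 : \det A' != 0 by exact: mulmx_expanding_det_neq0 expA.
split=> // [x|x|].
- apply: (@le_trans _ _ (3 * e * (2 * b * `|x *m A'|))).
    by rewrite ler_pM2l ?mulr_gt0.
  by rewrite mulrA ler_wpM2r//; move: e_eta; rewrite -/e; lra.
- by apply: (le_trans (BA x)); rewrite ler_wpM2r// ge_min lexx.
apply: det_le_dominated => //; first by rewrite addr_gt0.
move=> x; rewrite (_ : x *m B = x *m A' + x *m (B - A')); last first.
  by rewrite mulmxBr addrC subrK.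
rewrite (le_trans (ler_normD _ _))// mulrDl mul1r lerD2l (le_trans (BA x))//.
apply: (@le_trans _ _ (eta / (2 * b) * `|x|)).
  by rewrite ler_wpM2r// !ge_min lexx !orbT.
by rewrite mulrAC ler_pdivrMr// -mulrA ler_pM2l// mulrC.
Qed.

End rational_approximation.

Section graph_closure.
Context {R : realType} (k : nat).
Local Notation V := 'rV[R]_k.+1.
Local Notation M := 'M[R]_k.+1.
Local Notation leb_space := (@leb_space R k).
Implicit Types (x y : V) (E : set V).
Variables (Om : set V) (f : V -> V).

(* A measurable hull of [E] that inherits every closed condition on pairs
   [(x, f x)] holding on [E]. *)
Definition graph_closure E : set V :=
  [set x | Om x /\ forall e : R, 0 < e ->
     exists y, [/\ E y, `|y - x| < e & `|f y - f x| < e]].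

Lemma sub_graph_closure E : E `<=` Om -> E `<=` graph_closure E.
Proof.
by move=> EO x Ex; split; [exact: EO|move=> e e0; exists x; rewrite !subrr normr0].
Qed.

Lemma measurable_graph_closure E : open Om -> vmeasurable Om f ->
  measurable (graph_closure E : set leb_space).
Proof.
move=> oO mf.
pose isolated (x w : V) := exists2 e : R, 0 < e &
  forall y, E y -> `|y - x| < e -> `|f y - w| < e -> False.
have -> : graph_closure E = Om `\` (Om `&` [set x | isolated x (f x)]).
  apply/seteqP; split => x.
    move=> [Ox xE]; split => // -[_ [e e0 sep]].
    by have [y [Ey yx fy]] := xE e e0; exact: sep fy.
  move=> [Ox not_isolated]; split => // e e0; apply: contrapT => no_pair.
  apply: not_isolated; split => //.
  by exists e => // y Ey yx fy; apply: no_pair; exists y.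
apply: measurableD; first exact: measurable_open.
apply: (measurable_open_rel_graph (W := isolated)) => // x w [e e0 sep].
exists (e / 2); first by rewrite divr_gt0.
move=> x' w' xx ww; exists (e / 2); first by rewrite divr_gt0.
move=> y Ey yx yw; apply: (sep y) => //.
  by have := ler_distD x' y x; lra.
by have := ler_distD w' (f y) w; lra.
Qed.

Lemma graph_closure_pair E (A : M) (c s : R) : 0 <= c ->
  (forall x y, E x -> E y -> `|x - y| < s ->
     `|f x - f y - (x - y) *m A| <= c * `|x - y|) ->
  forall x y, graph_closure E x -> graph_closure E y -> `|x - y| < s ->
     `|f x - f y - (x - y) *m A| <= c * `|x - y|.
Proof.
move=> c0 pairE x y [_ xE] [_ yE] xys; apply/ler_addgt0Pr => e e0.
pose a := mx_sum_norm A; have a0 : 0 <= a by exact: mx_sum_norm_ge0.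
pose C := 2 * c + 2 + 2 * a; have C0 : 0 < C by rewrite /C; lra.
pose t := Num.min (e / C) ((s - `|x - y|) / 2).
have t0 : 0 < t by rewrite lt_min divr_gt0//= divr_gt0// subr_gt0.
have tC : t * C <= e by rewrite -ler_pdivlMr// ge_min lexx.
have ts : t <= (s - `|x - y|) / 2 by rewrite ge_min lexx orbT.
have [x' [Ex' xx' fx']] := xE t t0; have [y' [Ey' yy' fy']] := yE t t0.
have x'y' : `|x' - y'| <= `|x - y| + `|x' - x| + `|y' - y|.
  have := ler_distD x x' y'; have := ler_distD y x y'.
  by rewrite (distrC y y'); lra.
have pair' : `|f x' - f y' - (x' - y') *m A| <= c * `|x' - y'|.
  by apply: pairE => //; lra.
have -> : f x - f y - (x - y) *m A =
   (f x' - f y' - (x' - y') *m A) - (f x' - f x) + (f y' - f y)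
   + (x' - x) *m A - (y' - y) *m A.
  by apply/rowP => i; rewrite !mulmxBl !mxE; ring.
have xA : `|(x' - x) *m A| <= a * t.
  by apply: (le_trans (mulmx_sum_norm_le _ _)); rewrite ler_wpM2l// ltW.
have yA : `|(y' - y) *m A| <= a * t.
  by apply: (le_trans (mulmx_sum_norm_le _ _)); rewrite ler_wpM2l// ltW.
have cx'y' : c * `|x' - y'| <= c * (`|x - y| + 2 * t) by rewrite ler_wpM2l//; lra.
apply: (le_trans (ler_normB _ _)); apply: (le_trans (lerD (ler_normD _ _) (lexx _))).
have := ler_normD ((f x' - f y' - (x' - y') *m A) - (f x' - f x)) (f y' - f y).
have := ler_normB (f x' - f y' - (x' - y') *m A) (f x' - f x).
by move: tC; rewrite /C; lra.
Qed.

End graph_closure.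

Section almost_linear_pieces.
Context {R : realType} (k : nat).
Local Notation V := 'rV[R]_k.+1.
Local Notation M := 'M[R]_k.+1.
Local Notation leb_space := (@leb_space R k).
Local Notation dim := (k.+1%:R : R).
Implicit Types (x y : V).
Variables (Om : set V) (f : V -> V).

Lemma approx_diff_dense (A B : M) (e : R) x : 0 < e ->
  (forall y, `|y *m (B - A)| <= e / 2 * `|y|) -> approx_diff Om f x B ->
  exists m, almost_affine_dense Om f A e m x.
Proof.
move=> e0 BA dB; have ek0 : 0 < e / (2 * dim) by rewrite divr_gt0// mulr_gt0.
have [d d0 dP] := dB _ ek0 _ (@overlap_cst_gt0 R k).
have d_inv0 : 0 <= d^-1 by rewrite invr_ge0 ltW.
exists (Num.bound d^-1) => r r0 rm; have rd : r < d.
  apply: (lt_trans rm); rewrite invf_plt ?posrE//.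
  by rewrite (lt_trans (archi_boundP d_inv0))// ltr_nat.
apply: (le_trans (dP r r0 rd)); apply: le_leb_outer => z [[Oz [zx diff_z]] bz].
split => //; split => //.
have zx0 : 0 < `|z - x| by rewrite normr_gt0 subr_eq0; apply/eqP.
move: diff_z; rewrite ltr_pdivrMr ?(lt_le_trans zx0 (rV_norm_le_enorm _))// => diff_z.
have -> : f z - f x - (z - x) *m A = (f z - f x - (z - x) *m B) + (z - x) *m (B - A).
  by rewrite mulmxBr addrA addrNK.
have enorm_le : e / (2 * dim) * enorm (z - x) <= e / 2 * `|z - x|.
  apply: (@le_trans _ _ (e / (2 * dim) * (dim * `|z - x|))).
    by rewrite ler_pM2l// enorm_le_rV_norm.
  by rewrite mulrA invfM mulrA mulfVK ?gt_eqF.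
apply: (le_lt_trans (ler_normD _ _)); have := BA (z - x).
by have := lt_le_trans (le_lt_trans (rV_norm_le_enorm _) diff_z) enorm_le; lra.
Qed.

Record almost_linear_piece (L c : R) (a : V -> R) (S : set V) (A : M) : Prop :=
  AlmostLinearPiece {
    piece_measurable : measurable (S : set leb_space);
    piece_sub : S `<=` Om;
    piece_det : \det A != 0;
    piece_expand : forall x y, S x -> S y -> `|(x - y) *m A| <= L * `|f x - f y|;
    piece_lipschitz : exists C, forall x y, S x -> S y -> `|f x - f y| <= C * `|x - y|;
    piece_weight : forall x, S x -> a x <= c * `|\det A| }.

Lemma almost_linear_piece_subset L c a S D A : D `<=` S ->
  measurable (D : set leb_space) ->
  almost_linear_piece L c a S A -> almost_linear_piece L c a D A.
Proof.
move=> DS mD [_ SO A0 expS [C lipS] aS]; split=> //.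
- exact: subset_trans SO.
- by move=> x y /DS Sx /DS Sy; exact: expS.
- by exists C => x y /DS Sx /DS Sy; exact: lipS.
- by move=> x /DS; exact: aS.
Qed.

Lemma almost_linear_piece0 L c a : almost_linear_piece L c a set0 1%:M.
Proof. by split=> //; [rewrite det1 oner_neq0|exists 0]. Qed.

Variables (eta c : R) (a : V -> R).
Hypothesis oOm : open Om.
Hypothesis mf : vmeasurable Om f.
Hypothesis ma : measurable_fun [set: leb_space] a.
Hypothesis c0 : 0 <= c.
Hypothesis eta0 : 0 < eta.
Hypothesis eta1 : eta < 1.
Hypothesis ball_gt0 : (0 < leb_outer (supball (0 : V) 1))%E.

Definition piece_radius (m : nat) : R := (8 * dim * m.+1%:R)^-1.

Definition piece_core (A : M) (e : R) (m : nat) : set V :=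
  [set x | Om x /\ almost_affine_dense Om f A e m x].

Definition piece (A : M) (e : R) (m : nat) (centre : V) : set V :=
  graph_closure Om f (piece_core A e m) `&` supball centre (piece_radius m) `&`
  [set x | a x <= c * (1 + eta) ^+ k.+1 * `|\det A|].

Lemma piece_radius_gt0 m : 0 < piece_radius m.
Proof. by rewrite invr_gt0 !mulr_gt0. Qed.

Lemma measurable_piece A e m centre : measurable (piece A e m centre : set leb_space).
Proof.
apply: measurableI; first apply: measurableI.
- exact: measurable_graph_closure.
- exact/measurable_open/open_supball.
rewrite -[X in measurable X]setTI.
have := ma measurableT (measurable_itv `]-oo, c * (1 + eta) ^+ k.+1 * `|\det A|]%R).
by congr (measurable _); apply/seteqP; split => x [_ ax]; split => //;
  move: ax; rewrite /= in_itv.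
Qed.

Lemma piece_pair A e m centre x y : 0 < e ->
  piece A e m centre x -> piece A e m centre y ->
  `|f x - f y - (x - y) *m A| <= 3 * e * `|x - y|.
Proof.
move=> e0 [[gx cx] _] [[gy cy] _].
have xy : `|x - y| < (2 * dim * m.+1%:R)^-1.
  have radiusE : (2 * dim * m.+1%:R)^-1 = 4 * piece_radius m.
    rewrite /piece_radius.
    have -> : 8 * dim * m.+1%:R = 4 * (2 * dim * m.+1%:R) by ring.
    by rewrite [in RHS]invfM mulVKf.
  have := piece_radius_gt0 m; have := ler_distD centre x y; rewrite (distrC centre).
  by move: cx cy; rewrite radiusE /supball/=; lra.
move: xy; apply: (graph_closure_pair (Om := Om) (E := piece_core A e m)) => //.
  by rewrite mulr_ge0// ltW.
move=> u v [_ du] [_ dv] uv; apply: almost_affine_pair du dv _ => //.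
by rewrite mulrC -ltr_pdivlMr ?mulr_gt0// -invfM mulrC.
Qed.

Lemma almost_linear_piece_piece A e m centre : 0 < e -> \det A != 0 ->
  (forall x, 3 * e * `|x| <= eta * `|x *m A|) ->
  almost_linear_piece (1 - eta)^-1 (c * (1 + eta) ^+ k.+1) a (piece A e m centre) A.
Proof.
move=> e0 A0 expA; split=> //.
- exact: measurable_piece.
- by move=> x [[[]]].
- move=> x y Sx Sy; rewrite ler_pdivlMl ?subr_gt0//.
  have := ler_normB (f x - f y) (f x - f y - (x - y) *m A); rewrite subKr.
  by have := piece_pair e0 Sx Sy; have := expA (x - y); lra.
- exists (3 * e + mx_sum_norm A) => x y Sx Sy.
  have := ler_normD (f x - f y - (x - y) *m A) ((x - y) *m A); rewrite subrK mulrDl.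
  by have := piece_pair e0 Sx Sy; have := mulmx_sum_norm_le (x - y) A; lra.
- by move=> x [_].
Qed.

Lemma almost_linear_cover :
  exists (S : nat -> set V) (A : nat -> M),
    (forall i, almost_linear_piece (1 - eta)^-1 (c * (1 + eta) ^+ k.+1) a (S i) (A i)) /\
    forall x, Om x -> approx_differentiable Om f x -> Defs.jacobian Om f x != 0 ->
      a x <= c * `|Defs.jacobian Om f x| -> exists i, S i x.
Proof.
have [centre centreP] := @separable_rV R k.
pose I := ('M[rat]_k.+1 * nat * nat * nat)%type.
pose mat (p : I) : M := map_mx ratr p.1.1.1.
pose eps (p : I) : R := p.1.1.2.+1%:R^-1.
pose admissible (p : I) := \det (mat p) != 0 /\
  forall x, 3 * eps p * `|x| <= eta * `|x *m mat p|.
pose SA (n : nat) : set V * M := if unpickle n is Some p then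
  if `[< admissible p >] then (piece (mat p) (eps p) p.1.2 (centre p.2), mat p)
  else (set0, 1%:M) else (set0, 1%:M).
exists (fun n => (SA n).1), (fun n => (SA n).2); split=> [n|x Ox dx].
  rewrite /SA; case: unpickle => [p|]; last exact: almost_linear_piece0.
  case: asboolP => [[A0 expA]|_]; last exact: almost_linear_piece0.
  by apply: almost_linear_piece_piece => //; rewrite invr_gt0.
rewrite /Defs.jacobian; case: pselect => // {}dx; case: cid => B dB /= J0 aJ.
have [A [j [A0 expA AB detB]]] := rational_mx_dominates ball_gt0 eta0 J0.
have e0 : 0 < j.+1%:R^-1 :> R by rewrite invr_gt0.
have [m mP] := approx_diff_dense e0 AB dB.
have [n xn] := centreP x _ (piece_radius_gt0 m).
exists (pickle (A, j, m, n)); rewrite /SA pickleK asboolT//=.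
split; first split.
- by apply: sub_graph_closure; [move=> y []|split].
- exact: xn.
- by rewrite /=; apply: (le_trans aJ); rewrite -mulrA ler_wpM2l.
Qed.

End almost_linear_pieces.

Section multiplicity.
Context d (T : measurableType d) {R : realType}.
Variable mu : {measure set T -> \bar R}.
Local Open Scope ereal_scope.

Lemma sumr_indic_count I (s : seq I) (B : I -> set T) x :
  (\sum_(i <- s) \1_(B i) x = (count (fun i => `[< B i x >]) s)%:R :> R)%R.
Proof.
rewrite -sum1_count natr_sum [RHS]big_mkcond/=; apply: eq_bigr => i _.
by rewrite indicE; case: asboolP => Bix; [rewrite mem_set|rewrite memNset].
Qed.

Lemma sum_measure_multiplicity_le I (s : seq I) (B : I -> set T) (A C : set T) (K : nat) :
  (forall i, measurable (B i)) -> measurable A -> measurable C ->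
  (forall i, B i `<=` C) ->
  {ae mu, forall x, (count (fun i => `[< B i x >]) s <= K)%N} ->
  \sum_(i <- s) mu (A `&` B i) <= K%:R%:E * mu (A `&` C).
Proof.
move=> mB mA mC BC countK.
have mind D : measurable D -> measurable_fun A (EFin \o \1_D : T -> \bar R).
  by move=> mD; apply/measurable_EFinP; exact: measurable_indic.
have indic0 D x : 0 <= (EFin \o \1_D : T -> \bar R) x by rewrite lee_fin.
under eq_bigr do rewrite setIC -integral_indic//.
rewrite setIC -integral_indic// -ge0_integral_sum//; last first.
  by move=> i; exact: mind.
rewrite -ge0_integralZl//; last exact: mind.
apply: ae_ge0_le_integral => //.
- by move=> x _; apply: sume_ge0 => i _; exact: indic0.
- by apply: emeasurable_sum => i; exact: mind.
- by apply: measurable_funeM; exact: mind.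
apply: filterS countK => x countK _; rewrite sumEFin -EFinM lee_fin sumr_indic_count.
have [Cx|nCx] := pselect (C x); first by rewrite indicE mem_set// mulr1 ler_nat.
rewrite indicE memNset// mulr0 (eq_count (a2 := pred0)) ?count_pred0// => i.
by apply/asboolP => /BC.
Qed.

Lemma ge0_integral_ae_bigcup (X : set T) (D : nat -> set T) (u : T -> \bar R) :
  measurable X -> (forall i, measurable (D i)) -> trivIset setT D ->
  measurable_fun X u -> (forall x, X x -> 0 <= u x) ->
  {ae mu, forall x, X x -> u x = 0 \/ (\bigcup_i D i) x} ->
  \int[mu]_(x in X) u x = \sum_(0 <= i <oo) \int[mu]_(x in X `&` D i) u x.
Proof.
move=> mX mD disjD mX_u u0 cover.
have mDU : measurable (\bigcup_i D i) by exact: bigcupT_measurable.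
have disjXD : trivIset setT (fun i => X `&` D i) by exact: trivIset_setIl.
have mXD i : measurable (X `&` D i) by exact: measurableI.
rewrite -ge0_integral_bigcup//; last 2 first.
- by apply: measurable_funS mX_u => // x [i _ []].
- by move=> x [i _ [Xx _]]; exact: u0.
rewrite -setI_bigcupr integral_mkcondr; apply: ge0_ae_eq_integral => //.
- by apply/(measurable_restrict _ mDU mX); apply: measurable_funS mX_u => // x [].
- by move=> x Xx; rewrite patchE; case: ifP => // _; exact: u0.
apply: filterS cover => x cover Xx; rewrite patchE; case: ifPn => // /negP nDx.
by have [//|Dx] := cover Xx; case: nDx; rewrite inE.
Qed.

End multiplicity.

Section area_inequality.
Context {R : realType} (k : nat).
Local Notation V := 'rV[R]_k.+1.
Local Notation M := 'M[R]_k.+1.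
Local Notation leb_space := (@leb_space R k).
Local Notation leb_measure := (@leb_measure R k).

Lemma lipschitz_compact_image (C : set V) (f : V -> V) (c : R) :
  compact C -> (forall x y, C x -> C y -> `|f x - f y| <= c * `|x - y|) ->
  measurable (f @` C : set leb_space).
Proof.
move=> cC lipC; apply: measurable_compact.
apply: continuous_compact => //; apply/subspace_continuousP => x Cx.
apply/cvgrPdist_lt => e e0; have c0 : 0 < `|c| + 1 by rewrite ltr_wpDl.
have near_x : \forall y \near x, `|x - y| < e / (`|c| + 1).
  by apply: (@cvgr_dist_lt _ _ _ (nbhs x) _ id) => //; rewrite divr_gt0.
apply: filterS near_x => y /= yx Cy; apply: (le_lt_trans (lipC _ _ Cx Cy)).
apply: (@le_lt_trans _ _ ((`|c| + 1) * `|x - y|)).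
  by rewrite ler_wpM2r// (le_trans (ler_norm _))// lerDl.
by rewrite mulrC -ltr_pdivlMr.
Qed.

Lemma lipschitz_sigma_compact_image (S : set V) (f : V -> V) (c : R) :
  measurable (S : set leb_space) ->
  (forall x y, S x -> S y -> `|f x - f y| <= c * `|x - y|) ->
  exists D : set V, [/\ D `<=` S, leb_null (S `\` D),
    measurable (D : set leb_space) & measurable (f @` D : set leb_space)].
Proof.
move=> mS lipS; have [C [cC CS SC]] := measurable_sigma_compact mS.
exists (\bigcup_n C n); split=> //.
- by move=> x [n _]; exact: CS.
- by apply: bigcupT_measurable => n; exact: measurable_compact.
rewrite image_bigcup; apply: bigcupT_measurable => n.
by apply: (lipschitz_compact_image (c := c)) => // x y /CS Sx /CS Sy; exact: lipS.
Qed.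

Variables (Om : set V) (f : V -> V) (a : V -> R).
Hypothesis oOm : open Om.
Hypothesis mf : vmeasurable Om f.
Hypothesis a0 : forall x, 0 <= a x.
Hypothesis ma : measurable_fun [set: leb_space] a.

Lemma integral_almost_linear_piece_le (L C : R) D A X : 0 < L -> 0 <= C ->
  almost_linear_piece Om f L C a D A -> measurable (X : set leb_space) ->
  (\int[leb_measure]_(x in (X `&` D : set leb_space)) (a x)%:E <=
   (C * L ^+ k.+1)%:E * leb_outer (f @` (X `&` D)))%E.
Proof.
move=> L0 C0 pieceD mX.
have mXD : measurable (X `&` D : set leb_space).
  by apply: measurableI => //; exact: piece_measurable pieceD.
under eq_integral do rewrite -[(_)%:E]gee0_abs ?lee_fin//.
apply: (@le_trans _ _ ((C * `|\det A|)%:E * leb_measure (X `&` D))%E).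
  apply: integral_le_bound => //; [|by rewrite lee_fin mulr_ge0|].
    by apply: measurable_funTS; exact/measurable_EFinP.
  apply: aeW => x [_ Dx]; rewrite gee0_abs ?lee_fin//; exact: piece_weight pieceD _ Dx.
rewrite !EFinM -!muleA; apply: lee_wpmul2l; first by rewrite lee_fin.
apply: almost_linear_leb_outer_ge => //; first exact: piece_det pieceD.
by move=> x y [_ Dx] [_ Dy]; exact: piece_expand pieceD _ _ Dx Dy.
Qed.

Variable c : R.
Hypothesis c0 : 0 <= c.
Hypothesis aJ : ae_on Om (fun x => a x <= c * `|Defs.jacobian Om f x|).

Lemma almost_linear_partition (eta : R) : 0 < eta -> eta < 1 ->
  (0 < leb_outer (supball (0 : V) 1))%E ->
  exists (D : nat -> set V) (A : nat -> M),
    [/\ trivIset setT D,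
        forall i, almost_linear_piece Om f (1 - eta)^-1 (c * (1 + eta) ^+ k.+1) a
          (D i) (A i),
        forall i, measurable (f @` D i : set leb_space) &
        ae_on Om (fun x => a x = 0 \/ (\bigcup_i D i) x)].
Proof.
move=> eta0 eta1 ball_gt0.
have [S [A [pieceS cover]]] := almost_linear_cover oOm mf ma c0 eta0 eta1 ball_gt0.
have mS i : measurable (S i : set leb_space) by exact: piece_measurable (pieceS i).
have mseqDU i : measurable (seqDU S i : set leb_space) by exact: seqDU_measurable.
have core i : exists D : set V, [/\ D `<=` seqDU S i, leb_null (seqDU S i `\` D),
    measurable (D : set leb_space) & measurable (f @` D : set leb_space)].
  have [C lipS] := piece_lipschitz (pieceS i).
  apply: (lipschitz_sigma_compact_image (c := C)) => // x y Sx Sy.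
  by apply: lipS; exact: subset_seqDU.
have [D DP] := choice core; exists D, A; split=> [|i|i|].
- have /trivIsetP disjS := trivIset_seqDU S.
  apply/trivIsetP => i j _ _ ij; apply/seteqP; split => // x [Dix Djx].
  rewrite -(disjS i j I I ij); split.
    by have [+ _ _ _] := DP i; apply.
  by have [+ _ _ _] := DP j; apply.
- have [DS _ mD _] := DP i; apply: almost_linear_piece_subset (pieceS i) => //.
  by apply: subset_trans DS _; exact: subset_seqDU.
- by have [] := DP i.
have core_null i : leb_measure.-negligible (seqDU S i `\` D i).
  by apply/negligible_leb_nullP; have [] := DP i.
have aJ_null := (negligible_leb_nullP _).2 aJ.
apply/negligible_leb_nullP.
apply: negligibleS (negligibleU aJ_null (negligible_bigcup core_null)).
move=> x [Ox /not_orP[/eqP ax nDx]].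
have [xJ|xJ] := pselect (a x <= c * `|Defs.jacobian Om f x|); [right|by left].
have J0 : Defs.jacobian Om f x != 0.
  apply/eqP => J0; move: xJ; rewrite J0 normr0 mulr0 leNgt.
  by rewrite lt_neqAle eq_sym ax a0.
have dx : approx_differentiable Om f x.
  by apply: contrapT => nd; move/eqP: J0; apply; rewrite /Defs.jacobian; case: pselect.
have : (\bigcup_i S i) x by have [i Six] := cover x Ox dx J0 xJ; exists i.
rewrite seqDU_bigcup_eq => -[i _ Dix]; exists i => //.
by split => // Dx; apply: nDx; exists i.
Qed.

Hypothesis fOm : forall x, Om x -> Om (f x).

Lemma count_images_le (D : nat -> set V) (s : seq nat) K y : uniq s ->
  trivIset setT D -> (forall i, D i `<=` Om) -> ~ many_preimages Om f K y ->
  (count (fun i => `[< (f @` D i) y >]) s <= K)%N.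
Proof.
move=> uniq_s /trivIsetP disjD DO few; rewrite -size_filter leqNgt.
set s' := [seq i <- s | _]; apply/negP => K_lt; apply: few.
have preimage i : exists x, i \in s' -> D i x /\ f x = y.
  have [[x Dx fx]|nfDy] := pselect ((f @` D i) y); first by exists x.
  by exists 0; rewrite mem_filter => /andP[/asboolP].
have [g gP] := choice preimage.
have {}gP i : i \in take K.+1 s' -> D i (g i) /\ f (g i) = y by move=> /mem_take/gP.
split.
  have : nth 0%N s' 0 \in s' by apply: mem_nth; exact: leq_trans K_lt.
  by rewrite mem_filter => /andP[/asboolP[x Dx <-] _]; exact/fOm/(DO _ _ Dx).
exists (map g (take K.+1 s')); split.
- rewrite map_inj_in_uniq ?take_uniq ?filter_uniq// => i j si sj gij.
  apply: contrapT => /eqP ij; have /seteqP[disj _] := disjD i j I I ij.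
  by apply: (disj (g i)); split; [exact: (gP i si).1|rewrite gij; exact: (gP j sj).1].
- by rewrite size_map size_takel.
- by move=> _ /mapP[i si ->]; have [Di fi] := gP i si; split => //; exact: DO Di.
Qed.

Lemma leb_measure_null_ball (S : set leb_space) :
  ~ (0 < leb_outer (supball (0 : V) 1))%E -> leb_measure S = 0%E.
Proof.
move=> /negP nball; apply: (@leb_outer_null_supball R k 0 1) => //.
by apply/eqP; rewrite eq_le leb_outer_ge0 andbT leNgt.
Qed.

Lemma sum_images_le (D : nat -> set V) (Y : set V) K n : trivIset setT D ->
  (forall i, D i `<=` Om) -> (forall i, measurable (f @` D i : set leb_space)) ->
  measurable (Y : set leb_space) -> leb_null (many_preimages Om f K) ->
  (\sum_(0 <= i < n) leb_measure (Y `&` f @` D i) <=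
   K%:R%:E * leb_measure (Y `&` \bigcup_i (f @` D i)))%E.
Proof.
move=> disjD DO mfD mY /negligible_leb_nullP manyK.
apply: sum_measure_multiplicity_le => //.
- exact: bigcupT_measurable.
- by move=> i y fDy; exists i.
apply: negligibleS manyK => y /= not_le; apply: contrapT => few; apply: not_le.
by apply: count_images_le => //; exact: iota_uniq.
Qed.

Lemma integral_pieces_le (D : nat -> set V) (A : nat -> M) (L C : R) (Y : set V) K :
  trivIset setT D -> 0 < L -> 0 <= C ->
  (forall i, almost_linear_piece Om f L C a (D i) (A i)) ->
  (forall i, measurable (f @` D i : set leb_space)) ->
  ae_on Om (fun x => a x = 0 \/ (\bigcup_i D i) x) ->
  leb_null (many_preimages Om f K) -> measurable (Y : set leb_space) ->
  measurable (Om `&` f @^-1` Y : set leb_space) ->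
  (\int[leb_measure]_(x in (Om `&` f @^-1` Y : set leb_space)) (a x)%:E <=
   (C * L ^+ k.+1 * K%:R)%:E * leb_measure (Y `&` \bigcup_i (f @` D i)))%E.
Proof.
move=> disjD L0 C0 pieceD mfD coverD manyK mY mX.
have CL0 : 0 <= C * L ^+ k.+1 by rewrite mulr_ge0// exprn_ge0// ltW.
rewrite (ge0_integral_ae_bigcup (D := D : nat -> set leb_space))//; last 4 first.
- by move=> i; exact: piece_measurable (pieceD i).
- by apply: measurable_funTS; exact/measurable_EFinP.
- by move=> x _; rewrite lee_fin.
- apply: negligibleS ((negligible_leb_nullP _).2 coverD) => x /not_implyP[[Ox _] ax].
  by split => // -[a_x|Dx]; apply: ax; [left; rewrite a_x|right].
have piece_le i :
    (\int[leb_measure]_(x in (Om `&` f @^-1` Y `&` D i : set leb_space)) (a x)%:E <=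
    (C * L ^+ k.+1)%:E * leb_measure (Y `&` f @` D i))%E.
  apply: (le_trans (integral_almost_linear_piece_le L0 C0 (pieceD i) mX)).
  apply: lee_wpmul2l; first by rewrite lee_fin.
  by apply: le_leb_outer => _ [x [[Ox Yx] Dx] <-]; split => //; exists x.
apply: lime_le.
  by apply: is_cvg_nneseries => i _ _; apply: integral_ge0 => x _; rewrite lee_fin.
apply: nearW => n; apply: (le_trans (lee_sum _ (fun i _ => piece_le i))).
rewrite -ge0_sume_distrr// [in leRHS]EFinM -muleA.
apply: lee_wpmul2l; first by rewrite lee_fin.
by apply: sum_images_le => // i; exact: piece_sub (pieceD i).
Qed.

Lemma area_inequality (K : nat) (r : R) : 1 < r -> leb_null (many_preimages Om f K) ->
  exists B : set V, [/\ measurable (B : set leb_space), B `<=` f @` Om &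
    forall Y : set V, measurable (Y : set leb_space) ->
      measurable (Om `&` f @^-1` Y : set leb_space) ->
      (\int[leb_measure]_(x in (Om `&` f @^-1` Y : set leb_space)) (a x)%:E <=
       (c * r * K%:R)%:E * leb_measure (Y `&` B))%E].
Proof.
move=> r1 manyK; have [q q1 qr] := exprn_root_gt1 k r1.
(* If the unit ball were null, all sets would be: this spares the proof that
   Lebesgue measure does not vanish. *)
have [ball_gt0|null_ball] := pselect (0 < leb_outer (supball (0 : V) 1%R))%E; last first.
  exists set0; split => // Y mY mX.
  have maX : measurable_fun (Om `&` f @^-1` Y : set leb_space) (EFin \o a).
    by apply: measurable_funTS; exact/measurable_EFinP.
  have X0 := leb_measure_null_ball (Om `&` f @^-1` Y) null_ball.
  rewrite (ge0_negligible_integral mX mX maX _ X0) => [|x _]; last by rewrite /= lee_fin.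
  by rewrite setDv integral_set0 setI0 measure0 mule0.
pose eta := (q - 1) / (q + 1); have q_pos : 0 < q + 1 by lra.
have eta0 : 0 < eta by rewrite divr_gt0// subr_gt0.
have eta1 : eta < 1 by rewrite ltr_pdivrMr//; lra.
have etaE : (1 + eta) / (1 - eta) = q.
  apply: (canLR (mulfK _)); first by rewrite subr_eq0 gt_eqF.
  by rewrite /eta; field; rewrite gt_eqF.
have [D [A [disjD pieceD mfD coverD]]] := almost_linear_partition eta0 eta1 ball_gt0.
exists (\bigcup_i (f @` D i)); split=> [|y [i _ [x Dx <-]]|Y mY mX].
- exact: bigcupT_measurable.
- by exists x => //; exact: piece_sub (pieceD i) _ Dx.
rewrite -qr -etaE exprMn mulrA; apply: integral_pieces_le mX => //.
- by rewrite invr_gt0 subr_gt0.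
- by rewrite mulr_ge0// exprn_ge0// addr_ge0// ltW.
Qed.

End area_inequality.

(** * The space $L^{\psi,1}$ *)

Section tau_inverse.
Context {R : realType}.
Variable psi : R -> R.
Hypothesis adm : admissible_psi psi.

Lemma psi_increasing s t : 0 <= s -> s < t -> psi s < psi t.
Proof. by case: adm => _ + _ _ _; apply. Qed.

Lemma psi0 : psi 0 = 0.
Proof. by case: adm => -[_ [_ [_ [_ []]]]]. Qed.

Lemma psi_gt0 t : 0 < t -> 0 < psi t.
Proof. by move=> t0; rewrite -psi0 psi_increasing. Qed.

Lemma psi_ge0 t : 0 <= t -> 0 <= psi t.
Proof. by case: adm => -[+ _] _ _ _ _; apply. Qed.

Lemma psi_convex s t l : 0 <= s -> 0 <= t -> 0 <= l <= 1 ->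
  psi (l * s + (1 - l) * t) <= l * psi s + (1 - l) * psi t.
Proof. by case: adm => -[_ [_ [_ [convex _]]]] _ _ _ _; exact: convex. Qed.

Lemma psi_le_of_left_approx u c : 0 < u ->
  (forall d, 0 < d -> exists2 v, u - d < v <= u & psi v <= c) -> psi u <= c.
Proof.
move=> u0 near_u; rewrite leNgt; apply/negP; rewrite -subr_gt0 => cu.
case: adm => -[_ [_ [left_cont _]]] _ _ _ _.
have [d d0 dP] := left_cont u u0 _ cu; have [v /andP[uv vu] vc] := near_u d d0.
by have := dP v uv vu; rewrite ltr_norml => /andP[]; lra.
Qed.

Lemma psi_increment_le u d : 0 <= u -> 0 <= d <= 1 ->
  psi (u + d) <= psi u + d * psi (u + 1).
Proof.
move=> u0 /andP[d0 d1]; have u1 : 0 <= u + 1 by rewrite addr_ge0.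
have := psi_convex u1 u0 (l := d); rewrite d0 d1 => /(_ isT).
rewrite (_ : d * (u + 1) + (1 - d) * u = u + d); last by ring.
by have := mulr_ge0 d0 (psi_ge0 u0); lra.
Qed.

Lemma psi_surjective c : 0 < c -> exists2 u, 0 < u & psi u = c.
Proof.
move=> c0; case: (adm) => -[_ [_ [_ [_ [_ [_ unbounded]]]]]] _ _ _ _.
have [T TP] := unbounded (c + 1); pose E := [set u | 0 <= u /\ psi u <= c].
have supE : has_sup E.
  split; first by exists 0; split=> //; rewrite psi0 ltW.
  exists T => u [u0 uc]; rewrite leNgt; apply/negP => Tu.
  by have := TP u (ltW Tu); lra.
pose u := sup E.
have u0 : 0 <= u by apply: sup_upper_bound => //; split=> //; rewrite psi0 ltW.
have cu : c <= psi u.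
  rewrite leNgt; apply/negP => uc; have psi1 : 0 < psi (u + 1) by rewrite psi_gt0 ?ltr_wpDl.
  pose d := Num.min 1 ((c - psi u) / psi (u + 1)).
  have d0 : 0 < d by rewrite lt_min ltr01 divr_gt0// subr_gt0.
  have dc : d * psi (u + 1) <= c - psi u by rewrite -ler_pdivlMr// ge_min lexx orbT.
  have : E (u + d).
    split; first by rewrite addr_ge0// ltW.
    apply: (le_trans (psi_increment_le u0 _)); last by lra.
    by rewrite ltW//= ge_min lexx.
  by move=> /(sup_upper_bound supE); rewrite -/u; lra.
have {}u0 : 0 < u.
  by rewrite lt_neqAle u0 andbT; apply/eqP => u_eq0; move: cu; rewrite -u_eq0 psi0 leNgt c0.
exists u => //; apply/eqP; rewrite eq_le cu andbT; apply: psi_le_of_left_approx => // d d0.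
have [v Ev uv] := sup_adherent d0 supE; exists v; last by case: Ev.
by rewrite uv; exact: sup_upper_bound.
Qed.

Lemma tau0 : tau psi 0 = 0.
Proof. by rewrite /tau eqxx. Qed.

Lemma tauE t : 0 < t -> tau psi t = (psi t^-1)^-1.
Proof. by move=> t0; rewrite /tau gt_eqF. Qed.

Lemma tau_gt0 t : 0 < t -> 0 < tau psi t.
Proof. by move=> t0; rewrite tauE// invr_gt0 psi_gt0// invr_gt0. Qed.

Lemma tau_ge0 t : 0 <= t -> 0 <= tau psi t.
Proof. by rewrite le_eqVlt => /predU1P[<-|/tau_gt0/ltW//]; rewrite tau0. Qed.

Lemma tau_increasing s t : 0 <= s -> s < t -> tau psi s < tau psi t.
Proof.
move=> s0 st; have t0 : 0 < t by exact: le_lt_trans st.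
move: s0; rewrite le_eqVlt => /predU1P[<-|s0]; first by rewrite tau0 tau_gt0.
rewrite !tauE// ltf_pV2 ?posrE ?psi_gt0 ?invr_gt0//.
by apply: psi_increasing; rewrite ?invr_ge0 ?(ltW t0)// ltf_pV2 ?posrE.
Qed.

Lemma tau_le s t : 0 <= s -> 0 <= t -> (tau psi s <= tau psi t) = (s <= t).
Proof.
move=> s0 t0; case: (ltgtP s t) => [st|ts|->]; last exact: lexx.
  by rewrite ltW// tau_increasing.
by apply/negbTE; rewrite -ltNge tau_increasing.
Qed.

Lemma tau_ratio s t : 0 < s -> s <= t -> t * tau psi s <= s * tau psi t.
Proof.
move=> s0 st; have t0 : 0 < t by exact: lt_le_trans st.
have psi_s : 0 < psi s^-1 by rewrite psi_gt0// invr_gt0.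
have psi_t : 0 < psi t^-1 by rewrite psi_gt0// invr_gt0.
have st01 : 0 <= s / t <= 1 by rewrite divr_ge0 ?(ltW s0) ?(ltW t0)//= ler_pdivrMr// mul1r.
have s_inv0 : 0 <= s^-1 by rewrite invr_ge0 ltW.
have := psi_convex s_inv0 (lexx 0) st01.
rewrite psi0 !mulr0 !addr0 mulrAC divff ?gt_eqF// mul1r => psi_le.
rewrite !tauE// ler_pdivrMr// mulrAC ler_pdivlMr//.
by move: psi_le; rewrite mulrAC ler_pdivlMr// mulrC.
Qed.

Definition tau_inv_fin (r : R) : R := fine (tau_inv psi r%:E).

Lemma tau_invE u : (0 <= u)%E -> tau_inv psi u = er_map tau_inv_fin u.
Proof. by case: u. Qed.

Lemma tau_inv_finP r : 0 <= r -> 0 <= tau_inv_fin r /\ tau psi (tau_inv_fin r) = r.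
Proof.
move=> r0; apply: (@xgetPex _ 0 [set t | 0 <= t /\ tau psi t = r]).
move: r0; rewrite le_eqVlt => /predU1P[<-|r0]; first by exists 0; rewrite /= tau0.
have [|u u0 psi_u] := @psi_surjective r^-1; first by rewrite invr_gt0.
exists u^-1; split; first by rewrite invr_ge0 ltW.
by rewrite tauE ?invr_gt0// invrK psi_u invrK.
Qed.

Lemma tauK t : 0 <= t -> tau_inv_fin (tau psi t) = t.
Proof.
move=> t0; have [inv0 tau_inv] := tau_inv_finP (tau_ge0 t0).
by apply/eqP; rewrite eq_le -tau_le// tau_inv lexx -tau_le// tau_inv lexx.
Qed.

Lemma quasiconcave_tau_inv : quasiconcave tau_inv_fin.
Proof.
have tau_inv_gt0 r : 0 < r -> 0 < tau_inv_fin r.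
  move=> r0; have [inv0 tau_inv] := tau_inv_finP (ltW r0).
  rewrite lt_neqAle inv0 andbT; apply/eqP => inv_eq0.
  by move: r0; rewrite -tau_inv -inv_eq0 tau0 ltxx.
have tau_inv_le s t : 0 <= s -> s <= t -> tau_inv_fin s <= tau_inv_fin t.
  move=> s0 st; have [inv_s0 tau_s] := tau_inv_finP s0.
  by have [inv_t0 tau_t] := tau_inv_finP (le_trans s0 st); rewrite -tau_le// tau_s tau_t.
split=> // [|a b b0 ba|M]; first by rewrite -[X in tau_inv_fin X]tau0 tauK.
- have := tau_ratio (tau_inv_gt0 b b0) (tau_inv_le b a (ltW b0) ba).
  have [_ ->] := tau_inv_finP (ltW b0).
  by have [_ ->] := tau_inv_finP (le_trans (ltW b0) ba).
- have M0 : 0 <= `|M| + 1 by rewrite addr_ge0.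
  exists (tau psi (`|M| + 1)); first exact: tau_ge0.
  by rewrite tauK// (le_trans (ler_norm _))// lerDl.
Qed.

End tau_inverse.

Section functions_on_open_sets.
Context {R : realType} (k : nat).
Local Notation V := 'rV[R]_k.+1.
Local Notation leb_space := (@leb_space R k).
Local Notation leb_measure := (@leb_measure R k).
Variable Om : set V.
Hypothesis oOm : open Om.

Lemma ae_onP (P : V -> Prop) :
  ae_on Om P <-> {ae leb_measure, forall x : leb_space, Om x -> P x}.
Proof.
rewrite /ae_on -negligible_leb_nullP.
rewrite (_ : [set x | Om x /\ ~ P x] = ~` [set x | Om x -> P x])//.
by apply/seteqP; split => x /=; [move=> [Ox nP] /(_ Ox)|move/not_implyP].
Qed.

Lemma measurable_preimage (f : V -> V) (A : set V) : vmeasurable Om f ->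
  null_preimages Om f -> measurable (A : set leb_space) ->
  measurable (Om `&` f @^-1` A : set leb_space).
Proof.
move=> mf nf mA; have [C [cC CA C0]] := measurable_sigma_compact mA.
have -> : Om `&` f @^-1` A = (\bigcup_n (Om `\` (Om `&` f @^-1` (~` C n)))) `|`
    (Om `&` f @^-1` (A `\` \bigcup_n C n)).
  apply/seteqP; split => x.
    move=> [Ox Ax]; have [[n _ Cn]|nC] := pselect ((\bigcup_n C n) (f x)).
      by left; exists n => //; split => // -[_]; apply.
    by right; split.
  move=> [[n _ [Ox nC]]|[Ox [Ax _]]]; split => //.
  by apply: (CA n); apply: contrapT => nCx; apply: nC.
apply: measurableU; last by apply: measurable_leb_null; exact: nf.
apply: bigcupT_measurable => n; apply: measurableD; first exact: measurable_open.
apply: mf; rewrite openC; apply: compact_closed => //; exact: norm_hausdorff.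
Qed.

Definition extend_id (f : V -> V) (x : leb_space) : leb_space :=
  if `[< Om x >] then f x else x.

Lemma extend_idE f x : Om x -> extend_id f x = f x.
Proof. by move=> Ox; rewrite /extend_id asboolT. Qed.

Lemma measurable_extend_id (f : V -> V) : vmeasurable Om f ->
  null_preimages Om f -> measurable_fun setT (extend_id f).
Proof.
move=> mf nf _ A mA; rewrite setTI.
have -> : extend_id f @^-1` A = (Om `&` f @^-1` A) `|` (A `\` Om).
  apply/seteqP; split => x; rewrite /extend_id /=; case: asboolP => Ox.
  - by left.
  - by right.
  - by move=> [[]//|[_ /(_ Ox)]].
  - by move=> [[/Ox]//|[]].
apply: measurableU; first exact: measurable_preimage.
by apply: measurableD => //; exact: measurable_open.
Qed.

Lemma negligible_extend_id (f : V -> V) (A : set leb_space) : null_preimages Om f ->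
  leb_measure.-negligible A -> leb_measure.-negligible (extend_id f @^-1` A).
Proof.
move=> nf A0; have OmA0 : leb_measure.-negligible (Om `&` f @^-1` A).
  by apply/negligible_leb_nullP; apply: nf; exact/negligible_leb_nullP.
apply: negligibleS (negligibleU OmA0 A0) => x; rewrite /extend_id /=.
by case: asboolP => Ox; [left|right].
Qed.

Lemma nn_integral_le (C : set V) (u : V -> \bar R) : measurable (C : set leb_space) ->
  measurable_fun (C : set leb_space) u -> (forall x, C x -> 0 <= u x)%E ->
  (nn_integral C u <= \int[leb_measure]_(x in (C : set leb_space)) u x)%E.
Proof.
move=> mC mu_C u0; apply: ge_ereal_sup => _ [s [sP su ->]].
pose p (i : 'I_(size s)) := nth (0, set0) s i.
have pP i : 0 <= (p i).1 /\ measurable ((p i).2 : set leb_space) /\ (p i).2 `<=` C.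
  by apply: sP; exact: mem_nth.
have mp i : measurable_fun (C : set leb_space) (EFin \o \1_((p i).2) : leb_space -> \bar R).
  by apply/measurable_EFinP; apply: measurable_indic; have [_ []] := pP i.
have mcp i : measurable_fun (C : set leb_space)
    (fun x : leb_space => (p i).1%:E * (\1_((p i).2) x)%:E)%E.
  exact: (measurable_funeM _ (mp i)).
have p0 i x : (0 <= (p i).1%:E * (\1_((p i).2) x)%:E)%E.
  by rewrite mule_ge0// lee_fin; case: (pP i).
rewrite (big_nth (0, set0)) big_mkord (eq_bigr (fun i =>
  \int[leb_measure]_(x in (C : set leb_space)) ((p i).1%:E * (\1_((p i).2) x)%:E))%E).
  rewrite -ge0_integral_sum//; apply: ge0_le_integral => //.
  - by move=> x _; apply: sume_ge0.
  - exact: emeasurable_sum.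
  move=> x Cx; apply: le_trans (su x Cx).
  by rewrite (big_nth (0, set0)) big_mkord -sumEFin lee_sum.
move=> i _; have [ci [mi iC]] := pP i.
rewrite ge0_integralZl ?lee_fin//; last exact: mp.
by rewrite integral_indic// setIidl.
Qed.

Section norm_on.
Context {Kf : normedZmodType R}.
Implicit Types u : V -> Kf.

Definition norm_on u (x : leb_space) : R := if `[< Om x >] then `|u x| else 0.

Lemma norm_on_ge0 u x : 0 <= norm_on u x.
Proof. by rewrite /norm_on; case: asboolP. Qed.

Lemma norm_onE u x : Om x -> norm_on u x = `|u x|.
Proof. by move=> Ox; rewrite /norm_on asboolT. Qed.

Lemma norm_on0 u x : ~ Om x -> norm_on u x = 0.
Proof. by move=> Ox; rewrite /norm_on asboolF. Qed.

Lemma norm_on_superlevel u (r : R) : 0 <= r ->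
  [set x | r < norm_on u x] = [set x | Om x /\ r < `|u x|].
Proof.
move=> r0; apply/seteqP; split => x /=; last by move=> [Ox]; rewrite norm_onE.
have [Ox|nOx] := pselect (Om x); first by rewrite norm_onE.
by rewrite norm_on0// ltNge r0.
Qed.

Lemma measurable_norm_on u : kmeasurable Om u -> measurable_fun setT (norm_on u).
Proof.
move=> mu_Om; apply: (measurability _ (RGenOInfty.measurableE R)) => _ [_ [r ->] <-].
rewrite setTI (_ : _ @^-1` _ = [set x | r < norm_on u x]); last first.
  by apply/seteqP; split => x; rewrite /= in_itv/= andbT.
have [r0|r0] := leP 0 r; last first.
  rewrite (_ : mkset _ = setT)//; apply/seteqP; split => // x _ /=.
  by rewrite (lt_le_trans r0)// norm_on_ge0.
rewrite norm_on_superlevel//; apply: (mu_Om [set z | r < `|z|]) => z /= rz.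
exists (`|z| - r); first by rewrite subr_gt0.
by move=> w wz; have := ler_normB w (w - z); rewrite subKr; lra.
Qed.

Lemma lorentz_normE (psi : R -> R) u :
  lorentz_norm psi Om u = lorentz leb_measure (tau_inv_fin psi) (EFin \o norm_on u).
Proof.
apply: eq_integral => s; rewrite inE/= in_itv/= andbT => s0.
by rewrite tau_invE ?leb_outer_ge0// /Defs.distribution -norm_on_superlevel.
Qed.

Lemma L1loc_of_lorentz (psi : R -> R) u : admissible_psi psi -> kmeasurable Om u ->
  (lorentz_norm psi Om u < +oo)%E -> L1loc Om u.
Proof.
move=> adm mu_Om; rewrite lorentz_normE => u_fin; split=> // C cC CO.
have qc := quasiconcave_tau_inv adm.
have mn : measurable_fun setT (EFin \o norm_on u).
  by apply/measurable_EFinP; exact: measurable_norm_on.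
have mC : measurable (C : set leb_space) by exact: measurable_compact.
have n0 x : (0 <= (EFin \o norm_on u) x)%E by rewrite lee_fin norm_on_ge0.
have norm_fin : (layer_norm leb_measure (tau_inv_fin psi) (EFin \o norm_on u) < +oo)%E.
  apply: (le_lt_trans (layer_norm_le_lorentz leb_measure qc mn n0)).
  by rewrite lte_mul_pinfty// ?lee_fin.
have := layer_norm_lty_integral qc mn n0 norm_fin mC (leb_outer_compact_lty cC).
apply: le_lt_trans; have eq_norm x : C x -> (`|u x|%:E = (EFin \o norm_on u) x)%E.
  by move=> /CO Ox; rewrite /= norm_onE.
have <- : (\int[leb_measure]_(x in (C : set leb_space)) `|u x|%:E =
    \int[leb_measure]_(x in (C : set leb_space)) (EFin \o norm_on u) x)%E.
  by apply: eq_integral => x; rewrite inE => /eq_norm.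
apply: nn_integral_le => //; apply: eq_measurable_fun (measurable_funTS mn) => x.
by rewrite inE => /eq_norm.
Qed.

End norm_on.
End functions_on_open_sets.

Section weighted_transfer.
Context {R : realType} (k N : nat) {Kf : normedZmodType R}.
Local Notation V := 'rV[R]_k.+1.
Local Notation leb_space := (@leb_space R k).
Local Notation leb_measure := (@leb_measure R k).
Variables (Om : set V) (f : 'I_N -> V -> V) (L : nat).
Hypothesis isL : is_L Om f L.

Lemma is_L_gt0 : (0 < L)%N.
Proof. by have [[s [[_ s0] <- _]] _] := isL. Qed.

Lemma images_cap_null (A : {set 'I_N}) : (L < #|A|)%N ->
  leb_null (images_cap Om f (enum A)).
Proof.
move=> LA; apply/eqP; rewrite eq_le leb_outer_ge0 andbT leNgt; apply/negP => images_gt0.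
have [_ /(_ (enum A))] := isL; rewrite -cardE leqNgt LA /= => max_size.
suff : incr_tuple (enum A) by move=> /max_size /(_ images_gt0).
split; last by rewrite -cardE (leq_trans _ LA).
rewrite {1}/enum_mem -enumT; apply: sorted_filter => [i j l|]; first exact: ltn_trans.
have := iota_ltn_sorted 0 N; rewrite -val_enum_ord sorted_map.
by [].
Qed.

Lemma ae_images_count_le (B : 'I_N -> set V) : (forall n, B n `<=` f n @` Om) ->
  {ae leb_measure, forall y, (count (fun n => `[< B n y >]) (index_enum 'I_N) <= L)%N}.
Proof.
move=> Bf; have few : {ae leb_measure, forall (y : leb_space) (A : {set 'I_N}),
    (L < #|A|)%N -> ~ images_cap Om f (enum A) y}.
  apply: filter_forall => A; have [LA|LA] := ltnP L #|A|; last by apply: aeW.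
  apply: negligibleS ((negligible_leb_nullP _).2 (images_cap_null LA)) => y /= yA.
  by apply: contrapT => notin; apply: yA.
apply: filterS few => y few; rewrite leqNgt; apply/negP => L_lt.
apply: (few [set n | `[< B n y >]]%SET).
  apply: leq_trans L_lt _; rewrite -sum1_count -sum1_card.
  by under [leqRHS]eq_bigl do rewrite inE.
by move=> n; rewrite mem_enum inE => /asboolP; exact: Bf.
Qed.

Variables (g : 'I_N -> V -> Kf) (K : nat) (alpha : R).
Hypothesis oOm : open Om.
Hypothesis K_gt0 : (0 < K)%N.
Hypothesis alpha_ge0 : 0 <= alpha.
Hypothesis fOm : forall n x, Om x -> Om (f n x).
Hypothesis mf : forall n, vmeasurable Om (f n).
Hypothesis nf : forall n, null_preimages Om (f n).
Hypothesis manyK : forall n, leb_null (many_preimages Om (f n) K).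
Hypothesis mg : forall n, kmeasurable Om (g n).
Hypothesis gJ : forall n, ae_on Om (fun x =>
   `|g n x| <= alpha * Num.min (`|Defs.jacobian Om (f n) x| / (K * L)%:R) (N%:R^-1)).

Definition weight n (x : leb_space) : R := Num.min (norm_on Om (g n) x) (alpha / N%:R).

Lemma weight_bounds n x : 0 <= weight n x <= alpha / N%:R.
Proof. by rewrite le_min norm_on_ge0 divr_ge0//= ge_min lexx orbT. Qed.

Lemma weight_ge0 n x : 0 <= weight n x.
Proof. by case/andP: (weight_bounds n x). Qed.

Lemma measurable_weight n : measurable_fun setT (weight n).
Proof. by apply: measurable_minr => //; exact: measurable_norm_on. Qed.

Lemma weight0 n x : ~ Om x -> weight n x = 0.
Proof. by move=> nOx; rewrite /weight norm_on0//; apply/min_idPl; rewrite divr_ge0. Qed.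

Lemma weight_ae n : {ae leb_measure, forall x : leb_space, Om x -> weight n x = `|g n x|}.
Proof.
have gJ_ae := (ae_onP Om _).1 (gJ n); apply: filterS gJ_ae => x gx Ox.
rewrite /weight norm_onE//; apply/min_idPl; apply: (le_trans (gx Ox)).
by rewrite ler_wpM2l// ge_min lexx orbT.
Qed.

Lemma weight_jacobian_le n : ae_on Om (fun x =>
  weight n x <= alpha / (K * L)%:R * `|Defs.jacobian Om (f n) x|).
Proof.
have gJ_ae := (ae_onP Om _).1 (gJ n); apply/ae_onP; apply: filterS gJ_ae => x gx Ox.
rewrite ge_min norm_onE// mulrAC -mulrA (le_trans (gx Ox))//.
by rewrite ler_wpM2l// ge_min lexx.
Qed.

Local Open Scope ereal_scope.

Lemma integral_weight_indic n (A : set leb_space) :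
  \int[leb_measure]_x ((weight n x)%:E * (\1_A (extend_id Om (f n) x))%:E) =
  \int[leb_measure]_(x in (Om `&` f n @^-1` A : set leb_space)) (weight n x)%:E.
Proof.
rewrite [RHS]integral_mkcond; apply: eq_integral => x _; rewrite patchE indicE.
have [Ox|nOx] := pselect (Om x); last first.
  by rewrite weight0// mul0e memNset// => -[].
rewrite extend_idE//; have [Ax|nAx] := pselect (A (f n x)).
  by rewrite !mem_set// mule1.
by rewrite !memNset ?mule0// => -[].
Qed.

Lemma weight_area_inequality n (r : R) : (1 < r)%R ->
  exists B : set V, [/\ measurable (B : set leb_space), B `<=` f n @` Om &
    forall A : set leb_space, measurable A ->
      \int[leb_measure]_x ((weight n x)%:E * (\1_A (extend_id Om (f n) x))%:E) <=
      (r * alpha / L%:R)%:E * leb_measure (A `&` B)].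
Proof.
move=> r1; have c0 : (0 <= alpha / (K * L)%:R)%R by rewrite divr_ge0.
have [B [mB Bf areaB]] := area_inequality oOm (mf n) (weight_ge0 n)
  (measurable_weight n) c0 (weight_jacobian_le n) (fOm n) r1 (manyK n).
exists B; split=> // A mA.
have cE : (r * alpha / L%:R = alpha / (K * L)%:R * r * K%:R)%R.
  have L0 : (L%:R != 0 :> R)%R by rewrite pnatr_eq0 -lt0n is_L_gt0.
  have K0 : (K%:R != 0 :> R)%R by rewrite pnatr_eq0 -lt0n.
  by rewrite natrM; field; rewrite L0.
rewrite integral_weight_indic cE; apply: areaB => //.
exact: measurable_preimage.
Qed.

Lemma integral_transfer_indic_le (A : set leb_space) : measurable A ->
  \int[leb_measure]_x transfer (fun n => extend_id Om (f n)) weight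
    (fun y => (\1_A y)%:E) x <= alpha%:E * leb_measure A.
Proof.
move=> mA; have indicA0 n x : 0 <= (\1_A (extend_id Om (f n) x))%:E :> \bar R.
  by rewrite lee_fin.
apply: lee_mulgt1 => [|r r1]; first by rewrite mule_ge0.
have [B areaB] := choice (fun n => weight_area_inequality n r1).
have ra0 : (0 <= r * alpha)%R by rewrite mulr_ge0// ltW// (lt_trans ltr01).
rewrite /transfer ge0_integral_sum//; last 2 first.
- move=> n; apply: emeasurable_funM; first exact/measurable_EFinP/measurable_weight.
  apply/measurable_EFinP; apply: measurableT_comp; last exact: measurable_extend_id.
  exact: measurable_indic.
- by move=> n x _; rewrite mule_ge0 ?lee_fin ?weight_ge0.
apply: (@le_trans _ _ (\sum_(n < N) (r * alpha / L%:R)%:E * leb_measure (A `&` B n))).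
  by apply: lee_sum => n _; have [_ _] := areaB n; apply.
rewrite -ge0_sume_distrr//.
apply: (@le_trans _ _ ((r * alpha / L%:R)%:E * (L%:R%:E * leb_measure (A `&` setT)))).
  rewrite lee_wpmul2l// ?lee_fin ?divr_ge0//; apply: sum_measure_multiplicity_le => //.
    by move=> n; have [] := areaB n.
  by apply: ae_images_count_le => n; have [] := areaB n.
rewrite setIT muleA -EFinM mulfVK ?pnatr_eq0 -?lt0n ?is_L_gt0//.
by rewrite EFinM muleA.
Qed.

Lemma integral_weighted_transfer_le w : measurable_fun [set: leb_space] w ->
  (forall x, 0 <= w x) ->
  \int[leb_measure]_x transfer (fun n => extend_id Om (f n)) weight w x <=
  alpha%:E * \int[leb_measure]_x w x.
Proof.
move=> mw w0; apply: integral_transfer_le => //.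
- by move=> n; exact: measurable_extend_id.
- by move=> n; exact: measurable_weight.
- exact: weight_ge0.
- exact: integral_transfer_indic_le.
Qed.

End weighted_transfer.

(** * The elementary solution *)

Section norm_convergence.
Context {R : realType} {Kf : normedZmodType R}.
Implicit Types (u : nat -> Kf) (l : Kf) (U : set Kf).

Definition normcvg u l : Prop := (fun m => `|l - u m|) @ \oo --> (0 : R).

Lemma normcvg_near u l (e : R) : normcvg u l -> 0 < e ->
  \forall m \near \oo, `|l - u m| < e.
Proof.
move=> ul e0; have /cvgrPdist_lt/(_ e e0) := ul; apply: filterS => m.
by rewrite sub0r normrN normr_id.
Qed.

Lemma normcvg_exists u l (e : R) n : normcvg u l -> 0 < e ->
  exists2 m, `|l - u m| < e & (n <= m)%N.
Proof.
move=> ul e0; have [m [? ?]] : exists m, `|l - u m| < e /\ (n <= m)%N; last by exists m.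
apply: (@filter_ex _ \oo); apply: filterI; first exact: normcvg_near.
exact: nbhs_infty_ge.
Qed.

Lemma normcvg_unique u l l' : normcvg u l -> normcvg u l' -> l = l'.
Proof.
move=> ul ul'; apply/eqP; rewrite -subr_eq0 -normr_le0; apply/ler_addgt0Pr => e e0.
have e20 : 0 < e / 2 by rewrite divr_gt0.
have [m [lm l'm]] : exists m, `|l - u m| < e / 2 /\ `|l' - u m| < e / 2.
  by apply: (@filter_ex _ \oo); apply: filterI; exact: normcvg_near.
by have := ler_distD (u m) l l'; rewrite (distrC (u m)) add0r; lra.
Qed.

Lemma normcvgDr u l c : normcvg u l -> normcvg (fun m => u m + c) (l + c).
Proof.
rewrite /normcvg; under [in X in _ -> X]eq_fun do rewrite opprD addrACA subrr addr0.
by [].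
Qed.

Lemma normcvgS u l : normcvg u l -> normcvg (fun m => u m.+1) l.
Proof. by rewrite /normcvg -(cvg_shiftS (fun m => `|l - u m|)). Qed.

(* Points of [U] with a margin: a norm-convergent sequence may enter [U] without
   its limit being in [U], but not so if it stays in one of these sets. *)
Definition shrink U (j : nat) : set Kf :=
  [set z | exists2 t : R, j.+1%:R^-1 < t & forall w, `|w - z| < t -> U w].

Lemma kopen_shrink U j : kopen (shrink U j).
Proof.
rewrite /shrink; set r := j.+1%:R^-1; move=> z [t rt tU].
exists ((t - r) / 2); first by rewrite divr_gt0// subr_gt0.
move=> w wz; exists (t - (t - r) / 2); first by lra.
by move=> y yw; apply: tU; have := ler_distD w y z; lra.
Qed.

Lemma normcvg_kopenP U u l : kopen U -> normcvg u l ->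
  U l <-> exists j n, forall m, (n <= m)%N -> shrink U j (u m).
Proof.
move=> oU ul; split=> [/oU[e e0 eU]|[j [n shrinkU]]]; last first.
  have j0 : 0 < j.+1%:R^-1 :> R by rewrite invr_gt0.
  have [m lm nm] := normcvg_exists n ul j0.
  by have [t jt tU] := shrinkU m nm; apply: tU; exact: lt_trans jt.
have e_inv0 : 0 <= 2 / e by rewrite divr_ge0// ltW.
have e40 : 0 < e / 4 by rewrite divr_gt0.
have [n _ nP] := normcvg_near ul e40; exists (Num.bound (2 / e)), n => m nm.
exists (3 * e / 4).
  rewrite (@lt_trans _ _ (e / 2))//; last by lra.
  rewrite invf_plt ?posrE ?divr_gt0// invf_div.
  by rewrite (lt_trans (archi_boundP e_inv0))// ltr_nat.
move=> w wu; apply: eU; have := ler_distD (u m) w l.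
by have := nP m nm; rewrite /= (distrC l); lra.
Qed.

Lemma normcvg_sum_tail_le (u : nat -> Kf) l m :
  normcvg (fun n => \sum_(0 <= i < n) u i) l ->
  ((`|l - \sum_(0 <= i < m) u i|)%:E <= \sum_(0 <= i <oo) (`|u (m + i)%N|)%:E)%E.
Proof.
move=> ul; apply/lee_addgt0Pr => e e0.
have [n ln mn] := normcvg_exists m ul e0.
have sumE : \sum_(0 <= i < n) u i - \sum_(0 <= i < m) u i =
    \sum_(0 <= i < n - m) u (m + i)%N.
  rewrite (big_cat_nat (leq0n m) mn)/= addrAC subrr add0r -{1}[m]add0n big_addn.
  by apply: eq_bigr => i _; rewrite addnC.
have l_le : `|l - \sum_(0 <= i < m) u i| <= e + \sum_(0 <= i < n - m) `|u (m + i)%N|.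
  apply: (le_trans (ler_distD (\sum_(0 <= i < n) u i) _ _)).
  by rewrite lerD ?(ltW ln)// sumE; exact: ler_norm_sum.
apply: (@le_trans _ _ (e + \sum_(0 <= i < n - m) `|u (m + i)%N|)%:E).
  by rewrite lee_fin.
rewrite EFinD addeC leeD2r// -sumEFin.
by apply: nneseries_lim_ge => i _ _; rewrite lee_fin.
Qed.

End norm_convergence.

Record scalar_algebra {R : realType} (Kf : normedZmodType R)
    (mul : Kf -> Kf -> Kf) : Prop := ScalarAlgebra {
  scalar_separable : separable Kf;
  scalar_mulDl : forall x y z, mul (x + y) z = mul x z + mul y z;
  scalar_mulDr : forall x y z, mul x (y + z) = mul x y + mul x z;
  scalar_normM : forall x y, `|mul x y| = `|x| * `|y|;
  scalar_complete : forall u : nat -> Kf,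
    (\sum_(0 <= i <oo) (`|u i|)%:E < +oo)%E ->
    exists l, normcvg (fun m => \sum_(0 <= i < m) u i) l }.

Section scalar_algebra_theory.
Context {R : realType} {Kf : normedZmodType R} {mul : Kf -> Kf -> Kf}.
Hypothesis alg : scalar_algebra mul.

Lemma scalar_mulr0 x : mul x 0 = 0.
Proof. by apply: (addrI (mul x 0)); rewrite -(scalar_mulDr alg) !addr0. Qed.

Lemma scalar_mulBl x y z : mul (x - y) z = mul x z - mul y z.
Proof. by apply: (addIr (mul y z)); rewrite -(scalar_mulDl alg) !subrK. Qed.

Lemma scalar_mulBr x y z : mul x (y - z) = mul x y - mul x z.
Proof. by apply: (addIr (mul x z)); rewrite -(scalar_mulDr alg) !subrK. Qed.

Lemma scalar_mul_continuous x y (e : R) : 0 < e -> exists2 d : R, 0 < d &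
  forall x' y', `|x' - x| < d -> `|y' - y| < d -> `|mul x' y' - mul x y| < e.
Proof.
move=> e0; have C0 : 0 < `|x| + `|y| + 2 by rewrite ltr_wpDl// addr_ge0.
exists (Num.min 1 (e / (`|x| + `|y| + 2))); first by rewrite lt_min ltr01 divr_gt0.
move=> x' y'; rewrite !lt_min => /andP[_ xx'] /andP[yy'1 yy'].
have -> : mul x' y' - mul x y = mul (x' - x) y' + mul x (y' - y).
  by rewrite scalar_mulBl scalar_mulBr addrA subrK.
apply: (le_lt_trans (ler_normD _ _)); rewrite !(scalar_normM alg).
have y'_le : `|y'| <= `|y| + 1.
  by have := ler_normD (y' - y) y; rewrite subrK; lra.
move: xx' yy'; set d := e / _ => xx' yy'; have d0 : 0 < d by rewrite divr_gt0.
have : `|x' - x| * `|y'| <= d * (`|y| + 1) by apply: ler_pM => //; exact: ltW.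
have : `|x| * `|y' - y| <= `|x| * d by rewrite ler_wpM2l// ltW.
have : d * (`|x| + `|y| + 2) = e by rewrite mulfVK// gt_eqF.
lra.
Qed.

End scalar_algebra_theory.

Section kmeasurable_functions.
Context {R : realType} (k : nat) {Kf : normedZmodType R}.
Local Notation V := 'rV[R]_k.+1.
Local Notation leb_space := (@leb_space R k).
Local Notation leb_measure := (@leb_measure R k).
Variable Om : set V.
Hypothesis oOm : open Om.
Implicit Types u v : V -> Kf.

Lemma kmeasurable0 : kmeasurable Om (fun=> 0 : Kf).
Proof.
move=> U _; have [U0|U0] := pselect (U 0).
  rewrite (_ : Om `&` _ = Om); first exact: (measurable_open oOm).
  by apply/seteqP; split => x; [move=> []|split].
rewrite (_ : Om `&` _ = set0); first exact: (@measurable0 _ leb_space).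
by apply/seteqP; split => x // [].
Qed.

Lemma kmeasurable_comp (f : V -> V) u : vmeasurable Om f -> null_preimages Om f ->
  (forall x, Om x -> Om (f x)) -> kmeasurable Om u -> kmeasurable Om (u \o f).
Proof.
move=> mf nf fOm mu_Om U oU.
have := measurable_preimage oOm mf nf (mu_Om U oU).
congr (measurable (_ : set leb_space)); apply/seteqP; split => x [Ox].
  by move=> [_ Ux]; split.
by move=> Ux; split => //; split => //; exact: fOm.
Qed.

Lemma measurable_ae_eq (A B : set leb_space) : measurable A ->
  {ae leb_measure, forall x, A x <-> B x} -> measurable B.
Proof.
move=> mA AB_ae; pose N := ~` [set x | A x <-> B x].
have N0 : leb_measure.-negligible N by exact: AB_ae.
have mN C : C `<=` N -> measurable C.
  move=> CN; apply: measurable_leb_null; apply/negligible_leb_nullP.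
  exact: negligibleS N0.
have AB x : ~ N x -> A x <-> B x by move=> /contrapT.
have -> : B = (A `\` N) `|` (B `&` N).
  apply/seteqP; split => x; last by move=> [[Ax /AB <-]|[]].
  by move=> Bx; have [Nx|nNx] := pselect (N x); [right|left; split=> //; apply/AB].
by apply: measurableU; [apply: measurableD => //|]; apply: mN => // x [].
Qed.

Lemma kmeasurable_normcvg (S : nat -> V -> Kf) u : (forall m, kmeasurable Om (S m)) ->
  {ae leb_measure, forall x : leb_space, Om x -> normcvg (S ^~ x) (u x)} ->
  kmeasurable Om u.
Proof.
move=> mS Su U oU.
pose A : set leb_space :=
  Om `&` [set x | exists j n, forall m, (n <= m)%N -> shrink U j (S m x)].
apply: (@measurable_ae_eq A); last first.
  apply: filterS Su => x Sux; split=> -[Ox /=].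
    by move/(normcvg_kopenP oU (Sux Ox)).
  by move=> Ux; split=> //; exact/(normcvg_kopenP oU (Sux Ox)).
have -> : A = \bigcup_j \bigcup_n \bigcap_(m >= n) (Om `&` S m @^-1` (shrink U j)).
  apply/seteqP; split => x.
    by move=> [Ox [j [n shrinkU]]]; exists j => //; exists n => // m /= /shrinkU.
  move=> [j _ [n _ shrinkU]]; split; first by have [] := shrinkU n (leqnn n).
  by exists j, n => m /shrinkU[].
do 2![apply: bigcupT_measurable => ?]; apply: bigcap_measurable => [|m _].
  by eexists; exact: leqnn.
by apply: mS; exact: kopen_shrink.
Qed.

Variable mul : Kf -> Kf -> Kf.
Hypothesis alg : scalar_algebra mul.

Lemma kmeasurable_continuous2 (op : Kf -> Kf -> Kf) u v :
  (forall x y (e : R), 0 < e -> exists2 d : R, 0 < d & forall x' y',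
     `|x' - x| < d -> `|y' - y| < d -> `|op x' y' - op x y| < e) ->
  kmeasurable Om u -> kmeasurable Om v -> kmeasurable Om (fun x => op (u x) (v x)).
Proof.
move=> op_cont mu_Om mv U oU; have sepK := scalar_separable alg.
apply: (measurable_open_rel (W := fun x y => U (op x y)) sepK sepK mu_Om mv).
move=> x y /oU[e e0 eU]; have [d d0 dP] := op_cont x y e e0.
by exists d => // x' y' xx' yy'; apply: eU; exact: dP.
Qed.

Lemma kmeasurableD u v : kmeasurable Om u -> kmeasurable Om v ->
  kmeasurable Om (fun x => u x + v x).
Proof.
apply: kmeasurable_continuous2 => x y e e0; exists (e / 2); first by rewrite divr_gt0.
move=> x' y' xx' yy'; rewrite opprD addrACA.
by have := ler_normD (x' - x) (y' - y); lra.
Qed.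

Lemma kmeasurableB u v : kmeasurable Om u -> kmeasurable Om v ->
  kmeasurable Om (fun x => u x - v x).
Proof.
apply: (@kmeasurable_continuous2 (fun x y => x - y)) => x y e e0.
exists (e / 2) => [|x' y' xx' yy']; first by rewrite divr_gt0.
have -> : x' - y' - (x - y) = (x' - x) - (y' - y) by rewrite !opprD !opprK addrACA.
by have := ler_normB (x' - x) (y' - y); lra.
Qed.

Lemma kmeasurableM u v : kmeasurable Om u -> kmeasurable Om v ->
  kmeasurable Om (fun x => mul (u x) (v x)).
Proof. by apply: kmeasurable_continuous2; exact: scalar_mul_continuous alg. Qed.

Lemma kmeasurable_sum (I : Type) (s : seq I) (u : I -> V -> Kf) :
  (forall i, kmeasurable Om (u i)) -> kmeasurable Om (fun x => \sum_(i <- s) u i x).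
Proof.
move=> mu_Om; elim: s => [|i s IHs].
  rewrite (_ : (fun x => _) = fun=> 0); first exact: kmeasurable0.
  by apply/funext => x; rewrite big_nil.
rewrite (_ : (fun x => _) = fun x => u i x + \sum_(j <- s) u j x).
  exact: kmeasurableD.
by apply/funext => x; rewrite big_cons.
Qed.

End kmeasurable_functions.

Section operator_bound.
Context {R : realType} (k N : nat) {Kf : normedZmodType R}.
Local Notation V := 'rV[R]_k.+1.
Local Notation leb_space := (@leb_space R k).
Local Notation leb_measure := (@leb_measure R k).
Variables (mul : Kf -> Kf -> Kf) (Om : set V) (f : 'I_N -> V -> V) (g : 'I_N -> V -> Kf).
Variables (K L : nat) (psi : R -> R) (alpha : R).
Hypothesis alg : scalar_algebra mul.
Hypothesis adm : admissible_psi psi.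
Hypothesis oOm : open Om.
Hypothesis N_gt0 : (0 < N)%N.
Hypothesis K_gt0 : (0 < K)%N.
Hypothesis isL : is_L Om f L.
Hypothesis alpha_ge0 : 0 <= alpha.
Hypothesis fOm : forall n x, Om x -> Om (f n x).
Hypothesis mf : forall n, vmeasurable Om (f n).
Hypothesis nf : forall n, null_preimages Om (f n).
Hypothesis manyK : forall n, leb_null (many_preimages Om (f n) K).
Hypothesis mg : forall n, kmeasurable Om (g n).
Hypothesis gJ : forall n, ae_on Om (fun x =>
   `|g n x| <= alpha * Num.min (`|Defs.jacobian Om (f n) x| / (K * L)%:R) (N%:R^-1)).
Local Notation P := (opP mul f g).
Local Notation ext_norm u := (EFin \o norm_on Om u).
Local Notation layer_norm := (layer_norm leb_measure (tau_inv_fin psi)).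
Local Open Scope ereal_scope.

Lemma norm_opP_le u : {ae leb_measure, forall x : leb_space,
  ext_norm (P u) x <=
  transfer (fun n => extend_id Om (f n)) (weight Om g alpha) (ext_norm u) x}.
Proof.
have weightE : {ae leb_measure, forall (x : leb_space) n,
    Om x -> weight Om g alpha n x = `|g n x|%R}.
  by apply: filter_forall => n; exact: weight_ae gJ n.
apply: filterS weightE => x weightE; have [Ox|nOx] := pselect (Om x); last first.
  rewrite /= norm_on0//; apply: transfer_ge0 => [n y|y].
    exact: weight_ge0.
  by rewrite lee_fin norm_on_ge0.
rewrite /transfer /= norm_onE// (eq_bigr (fun n => (`|mul (g n x) (u (f n x))|)%:E)).
  by rewrite sumEFin lee_fin; exact: ler_norm_sum.
move=> n _; rewrite (scalar_normM alg) EFinM weightE// extend_idE// norm_onE//.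
exact: fOm.
Qed.

Lemma layer_norm_opP_le u : layer_norm (ext_norm u) < +oo ->
  layer_norm (ext_norm (P u)) <= alpha%:E * layer_norm (ext_norm u).
Proof.
move=> u_fin; apply: (le_trans (layer_norm_ae_le _ (norm_opP_le u))).
apply: layer_norm_transfer_le u_fin => //.
- exact: quasiconcave_tau_inv.
- by move=> n; exact: measurable_extend_id.
- by move=> n A; exact: negligible_extend_id.
- by move=> n; exact: measurable_weight.
- by move=> n x; exact: weight_bounds.
- by move=> w mw w0; exact: integral_weighted_transfer_le gJ _ mw w0.
Qed.

End operator_bound.

Section elementary_solution.
Context {R : realType} (k N : nat) {Kf : normedZmodType R}.
Local Notation V := 'rV[R]_k.+1.
Local Notation leb_space := (@leb_space R k).
Local Notation leb_measure := (@leb_measure R k).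
Variables (mul : Kf -> Kf -> Kf) (Om : set V) (f : 'I_N -> V -> V) (g : 'I_N -> V -> Kf).
Variables (h0 : V -> Kf) (psi : R -> R) (alpha : R).
Hypothesis alg : scalar_algebra mul.
Hypothesis adm : admissible_psi psi.
Hypothesis oOm : open Om.
Hypothesis fOm : forall n x, Om x -> Om (f n x).
Hypothesis mf : forall n, vmeasurable Om (f n).
Hypothesis nf : forall n, null_preimages Om (f n).
Hypothesis mg : forall n, kmeasurable Om (g n).
Hypothesis h0_in : in_Lpsi1 psi Om h0.
Hypothesis alpha_ge0 : 0 <= alpha.
Local Notation P := (opP mul f g).
Local Notation S := (partial_sum mul f g h0).
Local Notation ext_norm u := (EFin \o norm_on Om u).
Local Notation lorentz := (lorentz leb_measure (tau_inv_fin psi)).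
Local Notation layer_norm := (layer_norm leb_measure (tau_inv_fin psi)).
Hypothesis opP_le : forall u, (layer_norm (ext_norm u) < +oo ->
  layer_norm (ext_norm (P u)) <= alpha%:E * layer_norm (ext_norm u))%E.
Implicit Types (u v : V -> Kf).

Let qc : quasiconcave (tau_inv_fin psi). Proof. exact: quasiconcave_tau_inv. Qed.
Let mh0 : kmeasurable Om h0. Proof. by case: h0_in => -[]. Qed.
Let h0_fin : (lorentz (ext_norm h0) < +oo)%E.
Proof. by rewrite -lorentz_normE; case: h0_in. Qed.
Let norm0 u x : (0 <= (ext_norm u) x)%E. Proof. by rewrite lee_fin norm_on_ge0. Qed.
Let mnorm u : kmeasurable Om u -> measurable_fun setT (ext_norm u).
Proof. by move=> mu_Om; apply/measurable_EFinP; exact: measurable_norm_on. Qed.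

Lemma norm_on_le u x (t : \bar R) : (0 <= t)%E -> (Om x -> `|u x|%:E <= t)%E ->
  ((ext_norm u) x <= t)%E.
Proof.
move=> t0 ut; have [Ox|nOx] := pselect (Om x); last by rewrite /= norm_on0.
by rewrite /= norm_onE//; exact: ut.
Qed.

Lemma ae_on_comp n (Q : V -> Prop) : ae_on Om Q -> ae_on Om (fun x => Q (f n x)).
Proof.
move=> /nf nQ; apply: leb_outer_eq0; rewrite -(nQ n); apply: le_leb_outer => x [Ox nQx].
by split=> //; split=> //; exact: fOm.
Qed.

Lemma ae_on_comp_all (Q : V -> Prop) : ae_on Om Q ->
  {ae leb_measure, forall (x : leb_space) n, Om x -> Q (f n x)}.
Proof. by move=> OQ; apply: filter_forall => n; exact/ae_onP/ae_on_comp. Qed.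

Lemma kmeasurable_opP u : kmeasurable Om u -> kmeasurable Om (P u).
Proof.
move=> mu_Om; apply: (kmeasurable_sum oOm alg) => n; apply: (kmeasurableM alg) => //.
by apply: (kmeasurable_comp oOm (mf n) (@nf n)) => //; exact: fOm.
Qed.

Lemma kmeasurable_iter i u : kmeasurable Om u -> kmeasurable Om (iter i P u).
Proof. by move=> mu_Om; elim: i => //= i; exact: kmeasurable_opP. Qed.

Lemma kmeasurable_partial_sum j m : kmeasurable Om (S j m).
Proof. by apply: (kmeasurable_sum oOm alg) => i; exact: kmeasurable_iter. Qed.

Lemma ae_opP u v : ae_on Om (fun x => u x = v x) -> ae_on Om (fun x => P u x = P v x).
Proof.
move=> /ae_on_comp_all uv; apply/ae_onP; apply: filterS uv => x uv Ox.
by apply: eq_bigr => n _; rewrite uv.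
Qed.

Lemma opPD u v x : P (fun y => u y + v y) x = P u x + P v x.
Proof. by rewrite -big_split/=; apply: eq_bigr => n _; rewrite (scalar_mulDr alg). Qed.

Lemma opP_sum (I : Type) (s : seq I) (u : I -> V -> Kf) x :
  P (fun y => \sum_(i <- s) u i y) x = \sum_(i <- s) P (u i) x.
Proof.
elim: s => [|i s IHs].
  by rewrite big_nil /opP big1// => n _; rewrite big_nil (scalar_mulr0 alg).
rewrite big_cons -IHs -opPD; congr (P _ x); apply/funext => y.
by rewrite big_cons.
Qed.

Lemma partial_sumE j m x : S j m x = \sum_(0 <= i < m) iter (j + i) P h0 x.
Proof.
rewrite /partial_sum -{1}[j]add0n big_addn addKn.
by apply: eq_bigr => i _; rewrite addnC.
Qed.

Lemma opP_partial_sum m x : P (S 0 m) x + h0 x = S 0 m.+1 x.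
Proof. by rewrite /partial_sum opP_sum !add0n big_nat_recl// addrC. Qed.

Lemma normcvg_opP (s : nat -> V -> Kf) u x :
  (forall n, normcvg (fun m => s m (f n x)) (u (f n x))) ->
  normcvg (fun m => P (s m) x) (P u x).
Proof.
move=> su; apply: (@squeeze_cvgr _ _ _ _ (fun=> 0)
    (fun m => \sum_(n < N) `|g n x| * `|u (f n x) - s m (f n x)|)).
- apply: nearW => m; rewrite normr_ge0/= -sumrB; apply: (le_trans (ler_norm_sum _ _ _)).
  by apply: ler_sum => n _; rewrite -(scalar_mulBr alg) (scalar_normM alg).
- exact: cvg_cst.
have sum0 : \sum_(n < N) `|g n x| * 0 = 0 by rewrite big1// => n _; rewrite mulr0.
rewrite -[X in _ --> X]sum0; apply: (cvg_big (@add_continuous R)) => n _.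
by apply: cvgMr; exact: su.
Qed.

Lemma layer_norm_iter_le i u : kmeasurable Om u -> (lorentz (ext_norm u) < +oo)%E ->
  (layer_norm (ext_norm (iter i P u)) <= (2 * alpha ^+ i)%:E * lorentz (ext_norm u))%E.
Proof.
move=> mu_Om u_fin; have bound_fin j : ((2 * alpha ^+ j)%:E * lorentz (ext_norm u) < +oo)%E.
  by rewrite lte_mul_pinfty ?lee_fin// mulr_ge0// exprn_ge0.
elim: i => [|i IHi].
  by rewrite expr0 mulr1; exact: (layer_norm_le_lorentz _ qc (mnorm mu_Om) (norm0 u)).
apply: (le_trans (opP_le (le_lt_trans IHi (bound_fin i)))).
by rewrite exprS mulrCA EFinM -muleA lee_wpmul2l// lee_fin.
Qed.

Lemma lorentz_limit_unique (s : nat -> V -> Kf) u v : (forall m, kmeasurable Om (s m)) ->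
  kmeasurable Om u -> kmeasurable Om v ->
  (fun m => lorentz_norm psi Om (fun x => u x - s m x)) @ \oo --> 0%E ->
  (fun m => lorentz_norm psi Om (fun x => v x - s m x)) @ \oo --> 0%E ->
  ae_on Om (fun x => u x = v x).
Proof.
move=> ms mu_Om mv su sv.
have muv : kmeasurable Om (fun x => u x - v x) by exact: (kmeasurableB alg).
have uv0 : lorentz (ext_norm (fun x => u x - v x)) = 0%E.
  have su_sv : (fun m => lorentz_norm psi Om (fun x => (u x - s m x)%R) +
      2%:E * lorentz_norm psi Om (fun x => (v x - s m x)%R))%E @ \oo --> 0%E.
    rewrite -[X in _ --> X](adde0 0%E); apply: cvgeD => //.
    by rewrite -[X in _ --> X](mule0 2%:E); exact: cvgeZl.
  apply: cvge_le0_eq0 su_sv => [|m]; first exact: lorentz_ge0.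
  rewrite !lorentz_normE.
  have mus : kmeasurable Om (fun x => u x - s m x) by exact: (kmeasurableB alg).
  have mvs : kmeasurable Om (fun x => v x - s m x) by exact: (kmeasurableB alg).
  apply: le_trans (lorentzD_le _ qc (mnorm mus) (mnorm mvs) _ _) => //.
  apply: (lorentz_ae_le qc (mnorm muv)).
    by apply: emeasurable_funD; exact: mnorm.
  apply: aeW => x; apply: norm_on_le => [|Ox]; first by rewrite adde_ge0.
  rewrite /= !norm_onE// -EFinD lee_fin (distrC (v x)).
  exact: ler_distD.
apply/ae_onP; apply: filterS (lorentz_eq0_ae qc (mnorm muv) uv0) => x uvx Ox.
by move: uvx; rewrite /= lee_fin norm_onE// normr_le0 subr_eq0 => /eqP.
Qed.

Hypothesis alpha_lt1 : alpha < 1.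
Let one_sub_alpha_gt0 : 0 < 1 - alpha. Proof. by rewrite subr_gt0. Qed.

Definition tail_norm j (x : leb_space) : \bar R :=
  (\sum_(0 <= i <oo) (ext_norm (iter (j + i) P h0)) x)%E.

Lemma tail_norm_ge0 j x : (0 <= tail_norm j x)%E.
Proof. by apply: nneseries_ge0 => i _ _; exact: norm0. Qed.

Lemma measurable_tail_norm j : measurable_fun setT (tail_norm j).
Proof.
apply: ge0_emeasurable_sum => [i x _ _|i _]; first exact: norm0.
exact/mnorm/kmeasurable_iter.
Qed.

Lemma tail_norm_recl x : (tail_norm 0 x = (ext_norm h0) x + tail_norm 1 x)%E.
Proof.
rewrite /tail_norm nneseries_recl// -(nneseries_addn 1)//.
by congr (_ + _)%E; apply: eq_eseriesr => i _; rewrite addn1.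
Qed.

Lemma lorentzD_tail_norm_le w j : measurable_fun setT w -> (forall x, 0 <= w x)%E ->
  (lorentz (fun x => w x + tail_norm j x) <=
   lorentz w + (2 * alpha ^+ j / (1 - alpha))%:E * lorentz (ext_norm h0))%E.
Proof.
move=> mw w0; pose u i := iter (j + i) P h0.
have mu_Om i : kmeasurable Om (u i) by exact: kmeasurable_iter.
have addv i w' : measurable_fun setT w' -> (forall x, 0 <= w' x)%E ->
    (lorentz (w' \+ ext_norm (u i)) <= lorentz w' + layer_norm (ext_norm (u i)))%E.
  by move=> mw' w'0; apply: lorentzD_layer_norm_le => //; exact: mnorm.
apply: (le_trans (lorentzD_nneseries_le qc mw w0 (fun i => mnorm (mu_Om i))
  (fun i => norm0 (u i)) (fun i => layer_norm_ge0 _ qc _) addv)).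
rewrite leeD2l//; apply: lime_le.
  by apply: is_cvg_nneseries => i _ _; exact: layer_norm_ge0.
apply: nearW => n.
apply: (@le_trans _ _ (\sum_(0 <= i < n) (geometric (2 * alpha ^+ j) alpha i)%:E *
    lorentz (ext_norm h0))%E).
  apply: lee_sum => i _; rewrite /= -mulrA -exprD; exact: layer_norm_iter_le.
rewrite -ge0_sume_distrl => [|i _]; last by rewrite lee_fin mulr_ge0 ?mulr_ge0 ?exprn_ge0.
apply: lee_wpmul2r; first exact: lorentz_ge0.
rewrite sumEFin lee_fin -[leLHS]/(series (geometric (2 * alpha ^+ j) alpha) n).
rewrite geometric_seriesE ?lt_eqF//=.
by rewrite ler_pM2r ?invr_gt0// ler_piMr ?mulr_ge0 ?exprn_ge0// gerBl exprn_ge0.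
Qed.

Lemma lorentz_tail_norm_le j : (lorentz (tail_norm j) <=
  (2 * alpha ^+ j / (1 - alpha))%:E * lorentz (ext_norm h0))%E.
Proof.
have := lorentzD_tail_norm_le j (measurable_cst (0%E : \bar R)) (fun=> lexx _).
rewrite (lorentz0 _ qc) add0e; congr (lorentz _ <= _)%E.
by apply/funext => x; rewrite /= add0e.
Qed.

Lemma tail_norm_lty_ae j : {ae leb_measure, forall x, (tail_norm j x < +oo)%E}.
Proof.
apply: (lorentz_lty_ae qc); first exact: measurable_tail_norm.
apply: (le_lt_trans (lorentz_tail_norm_le j)).
by rewrite lte_mul_pinfty// lee_fin divr_ge0 ?mulr_ge0 ?exprn_ge0// ltW.
Qed.

Definition tail_sum j (x : V) : Kf := xget 0 [set l | normcvg (fun m => S j m x) l].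

Lemma normcvg_tail_sum j :
  {ae leb_measure, forall x : leb_space, Om x -> normcvg (fun m => S j m x) (tail_sum j x)}.
Proof.
apply: filterS (tail_norm_lty_ae j) => x x_fin Ox.
apply: (@xgetPex _ 0 [set l | normcvg (fun m => S j m x) l]).
have [|l lP] := scalar_complete alg (u := fun i => iter (j + i) P h0 x).
  apply: le_lt_trans x_fin; apply: lee_nneseries => [i _ _|i _]; first by rewrite lee_fin.
  by rewrite /= norm_onE.
by exists l => /=; under eq_fun do rewrite partial_sumE.
Qed.

Lemma norm_tail_sum_sub_le j m : {ae leb_measure, forall x : leb_space,
  ((ext_norm (fun y => tail_sum j y - S j m y)%R) x <= tail_norm (j + m) x)%E}.
Proof.
apply: filterS (normcvg_tail_sum j) => x x_cvg; apply: norm_on_le => [|Ox].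
  exact: tail_norm_ge0.
rewrite partial_sumE; have := x_cvg Ox; under eq_fun do rewrite partial_sumE.
move=> /(normcvg_sum_tail_le m)/le_trans; apply.
apply: lee_nneseries => [i _ _|i _]; first by rewrite lee_fin.
by rewrite /= norm_onE// addnA.
Qed.

Lemma norm_tail_sum_le j : {ae leb_measure, forall x : leb_space,
  ((ext_norm (tail_sum j)) x <= tail_norm j x)%E}.
Proof.
have := norm_tail_sum_sub_le j 0; rewrite addn0 (_ : (fun y => _) = tail_sum j)//.
by apply/funext => y; rewrite partial_sumE big_geq// subr0.
Qed.

Lemma kmeasurable_tail_sum j : kmeasurable Om (tail_sum j).
Proof.
apply: (kmeasurable_normcvg (S := S j)); last exact: normcvg_tail_sum.
by move=> m; exact: kmeasurable_partial_sum.
Qed.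

Lemma lorentz_norm_tail_sum_le j :
  (lorentz_norm psi Om (tail_sum j) <= lorentz (tail_norm j))%E.
Proof.
rewrite lorentz_normE; apply: (lorentz_ae_le qc); last exact: norm_tail_sum_le.
  exact/mnorm/kmeasurable_tail_sum.
exact: measurable_tail_norm.
Qed.

Lemma lorentz_norm_tail_sum_sub_le j m :
  (lorentz_norm psi Om (fun x => tail_sum j x - S j m x)%R <=
   (2 * alpha ^+ (j + m) / (1 - alpha))%:E * lorentz (ext_norm h0))%E.
Proof.
apply: le_trans (lorentz_tail_norm_le (j + m)); rewrite lorentz_normE.
apply: (lorentz_ae_le qc); last exact: norm_tail_sum_sub_le.
  apply/mnorm/(kmeasurableB alg); first exact: kmeasurable_tail_sum.
  exact: kmeasurable_partial_sum.
exact: measurable_tail_norm.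
Qed.

Lemma cvg_geometric_mule (c : R) (y : \bar R) : (0 <= y < +oo)%E ->
  (fun m => (c * alpha ^+ m)%:E * y)%E @ \oo --> 0%E.
Proof.
move=> /andP[y0 y_fin]; have fin_y : y \is a fin_num by rewrite ge0_fin_numE.
rewrite -[X in _ --> X](mul0e y); apply: cvgeZr => //; apply: cvg_EFin.
  exact: nearW.
by apply: cvg_geometric; rewrite ger0_norm.
Qed.

Lemma tail_sum_converges j : tail_converges psi mul Om f g h0 j (tail_sum j).
Proof.
apply: (cvge0_squeeze (u := fun m => (2 * alpha ^+ j / (1 - alpha) * alpha ^+ m)%:E *
    lorentz (ext_norm h0))%E).
- by move=> m; rewrite lorentz_normE; exact: lorentz_ge0.
- move=> m; apply: (le_trans (lorentz_norm_tail_sum_sub_le j m)).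
  by rewrite exprD mulrA mulrAC.
- by apply: cvg_geometric_mule; rewrite lorentz_ge0.
Qed.

Lemma tail_sum_in_Lpsi1 j : in_Lpsi1 psi Om (tail_sum j).
Proof.
have fin : (lorentz_norm psi Om (tail_sum j) < +oo)%E.
  apply: (le_lt_trans (le_trans (lorentz_norm_tail_sum_le j) (lorentz_tail_norm_le j))).
  by rewrite lte_mul_pinfty// lee_fin divr_ge0 ?mulr_ge0 ?exprn_ge0// ltW.
by split=> //; exact: (L1loc_of_lorentz adm (kmeasurable_tail_sum j) fin).
Qed.

Lemma tail_sum_solves : solves mul Om f g h0 (tail_sum 0).
Proof.
have cvg_x := normcvg_tail_sum 0.
have cvg_fx := ae_on_comp_all ((ae_onP _ _).2 cvg_x).
apply/ae_onP; apply: filterS2 cvg_x cvg_fx => x cvg_x cvg_fx Ox.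
apply: normcvg_unique (normcvgS (cvg_x Ox)) _.
under eq_fun do rewrite -opP_partial_sum; apply: normcvgDr.
by apply: normcvg_opP => n; exact: cvg_fx.
Qed.

Lemma solution_iter v m : solves mul Om f g h0 v ->
  ae_on Om (fun x => v x = iter m P v x + S 0 m x).
Proof.
move=> v_sol; elim: m => [|m /ae_opP/ae_onP IHm].
  by apply/ae_onP; apply: aeW => x _; rewrite partial_sumE big_geq// addr0.
apply/ae_onP; move/ae_onP: v_sol => v_sol.
apply: filterS2 v_sol IHm => x vx Pvx Ox.
by rewrite (vx Ox) (Pvx Ox) opPD -addrA opP_partial_sum.
Qed.

Lemma solution_converges v : in_Lpsi1 psi Om v -> solves mul Om f g h0 v ->
  tail_converges psi mul Om f g h0 0 v.
Proof.
move=> [[mv _]]; rewrite lorentz_normE => v_fin v_sol.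
apply: (cvge0_squeeze (u := fun m => (2 * alpha ^+ m)%:E * lorentz (ext_norm v))%E).
- by move=> m; rewrite lorentz_normE; exact: lorentz_ge0.
- move=> m; apply: le_trans (layer_norm_iter_le m mv v_fin); rewrite lorentz_normE.
  have mPv : kmeasurable Om (iter m P v) by exact: kmeasurable_iter.
  apply: le_trans (lorentz_le_layer_norm _ qc (mnorm mPv) (norm0 _)).
  apply: (lorentz_ae_le qc) (mnorm mPv) _.
    by apply/mnorm/(kmeasurableB alg) => //; exact: kmeasurable_partial_sum.
  have /ae_onP v_iter := solution_iter m v_sol; apply: filterS v_iter => x vx.
  by apply: norm_on_le => // Ox; rewrite {1}(vx Ox) addrK /= norm_onE.
- by apply: cvg_geometric_mule; rewrite lorentz_ge0.
Qed.

Lemma tail_limit_unique j u v : in_Lpsi1 psi Om u -> in_Lpsi1 psi Om v ->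
  tail_converges psi mul Om f g h0 j u -> tail_converges psi mul Om f g h0 j v ->
  ae_on Om (fun x => u x = v x).
Proof.
move=> [[mu_Om _] _] [[mv _] _]; apply: lorentz_limit_unique => // m.
exact: kmeasurable_partial_sum.
Qed.

Hypothesis alpha_lt_half : alpha < 2^-1.

Lemma geometric_factor_le j :
  2 * alpha ^+ j.+1 / (1 - alpha) <= (2 * alpha) ^+ j.+1 / (1 - 2 * alpha).
Proof.
apply: ler_pM; rewrite ?invr_ge0 ?mulr_ge0 ?exprn_ge0 ?(ltW one_sub_alpha_gt0)//.
  by rewrite exprMn ler_wpM2r ?exprn_ge0// exprS ler_peMr// exprn_ege1// ler1n.
by rewrite lef_pV2 ?posrE//; move: alpha_ge0 alpha_lt_half; lra.
Qed.

Lemma lorentz_tail_norm_geometric_le j : (lorentz (tail_norm j) <=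
  ((2 * alpha) ^+ j / (1 - 2 * alpha))%:E * lorentz (ext_norm h0))%E.
Proof.
case: j => [|j]; last first.
  apply: (le_trans (lorentz_tail_norm_le j.+1)); apply: lee_wpmul2r.
    exact: lorentz_ge0.
  by rewrite lee_fin geometric_factor_le.
rewrite (funext tail_norm_recl).
apply: (le_trans (lorentzD_tail_norm_le 1 (mnorm mh0) (norm0 h0))).
rewrite -[X in (X + _ <= _)%E]mul1e -ge0_muleDl ?lee_fin//; last first.
  by rewrite divr_ge0 ?mulr_ge0 ?expr1// ltW.
apply: lee_wpmul2r; first exact: lorentz_ge0.
rewrite -EFinD lee_fin expr0 expr1 mul1r.
have -> : 1 + 2 * alpha / (1 - alpha) = (1 + alpha) / (1 - alpha).
  by field; rewrite gt_eqF.
rewrite ler_pdivrMr// mulrC ler_pdivlMr; last by move: alpha_lt_half; lra.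
by move: alpha_ge0; nra.
Qed.

Lemma lorentz_norm_tail_limit_le j u : in_Lpsi1 psi Om u ->
  tail_converges psi mul Om f g h0 j u ->
  (lorentz_norm psi Om u <=
    ((2 * alpha) ^+ j / (1 - 2 * alpha))%:E * lorentz_norm psi Om h0)%E.
Proof.
move=> u_in u_lim; rewrite !lorentz_normE.
have /ae_onP uT :=
  tail_limit_unique u_in (tail_sum_in_Lpsi1 j) u_lim (@tail_sum_converges j).
apply: le_trans (lorentz_tail_norm_geometric_le j).
apply: (lorentz_ae_le qc); [|exact: measurable_tail_norm|].
  by apply: mnorm; case: u_in => -[].
apply: filterS2 uT (norm_tail_sum_le j) => x ux T_le.
by apply: norm_on_le => [|Ox]; [exact: tail_norm_ge0|move: T_le; rewrite /= norm_onE// ux].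
Qed.

End elementary_solution.

Lemma theorem3p6_scalar_algebra {R : realType} (Kf : normedZmodType R)
    (mul : Kf -> Kf -> Kf) : scalar_algebra mul -> theorem3p6_claim mul.
Proof.
move=> alg [//|k] N Om f g h0 K L psi alpha _ N0 K0 oOm fOm hyps adm h0_in a0 a_half gJ.
have [mf [_ [_ [nf [manyK [mg [_ isL]]]]]]] := hyps.
have a1 : alpha < 1 by lra.
have opP_le := layer_norm_opP_le alg adm oOm N0 K0 isL a0 fOm mf nf manyK mg gJ.
have T_in := tail_sum_in_Lpsi1 alg adm oOm fOm mf nf mg h0_in a0 opP_le a1.
have T_lim := tail_sum_converges alg adm oOm fOm mf nf mg h0_in a0 opP_le a1.
split; [|split=> [u v u_in v_in u_lim v_sol|j]].
- exists (tail_sum mul f g h0 0); split=> //.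
  exact: (tail_sum_solves alg adm oOm fOm mf nf mg h0_in a0 opP_le a1).
- have v_lim := solution_converges alg adm oOm fOm mf nf mg h0_in a0 opP_le a1 v_in v_sol.
  exact: (tail_limit_unique alg adm oOm fOm mf nf mg h0_in u_in v_in u_lim v_lim).
- split; first by exists (tail_sum mul f g h0 j).
  exact: (lorentz_norm_tail_limit_le alg adm oOm fOm mf nf mg h0_in a0 opP_le a1 a_half).
Qed.

Lemma real_abs_series_normcvg {R : realType} (u : nat -> R) :
  (\sum_(0 <= i <oo) (`|u i|)%:E < +oo)%E ->
  exists l : R, normcvg (fun m => \sum_(0 <= i < m) u i) l.
Proof.
move=> u_fin; have u_cvg : cvgn (series u).
  apply: normed_cvg; apply: nondecreasing_is_cvgn.
    by apply: nondecreasing_series => i _ _; exact: normr_ge0.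
  exists (fine (\sum_(0 <= i <oo) (`|u i|)%:E)%E) => _ [n _ <-].
  have sum0 : (0 <= \sum_(0 <= i <oo) (`|u i|)%:E)%E.
    by apply: nneseries_ge0 => i _ _; rewrite lee_fin.
  rewrite -lee_fin fineK ?ge0_fin_numE// /series /= -sumEFin.
  by apply: nneseries_lim_ge => i _ _; rewrite lee_fin.
exists (limn (series u)); rewrite /normcvg -[X in _ --> X](@normr0 _ R); apply: cvg_norm.
by rewrite -[X in _ --> X](subrr (limn (series u))); apply: cvgB => //; exact: cvg_cst.
Qed.

Lemma scalar_algebra_real (R : realType) :
  @scalar_algebra R (R : normedZmodType R) (fun x y : R => x * y).
Proof.
split.
- have [d dP] := @separable_rV R 0; exists (fun n => d n 0 0) => x e e0.
  have [n /rV_norm_ltP nP] := dP (\row__ x) e e0; exists n.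
  by have := nP e0 0; rewrite !mxE.
- by move=> x y z; rewrite mulrDl.
- by move=> x y z; rewrite mulrDr.
- by move=> x y; rewrite normrM.
- exact: real_abs_series_normcvg.
Qed.

Section complex_scalars.
Context {R : realType}.
Implicit Types z : Rcomplex R.

Lemma Rcomplex_normE z : `|z| = Num.sqrt (complex.Re z ^+ 2 + complex.Im z ^+ 2).
Proof. by case: z. Qed.

Lemma Re_le_norm z : `|complex.Re z| <= `|z|.
Proof. by rewrite Rcomplex_normE -sqrtr_sqr ler_wsqrtr// lerDl sqr_ge0. Qed.

Lemma Im_le_norm z : `|complex.Im z| <= `|z|.
Proof. by rewrite Rcomplex_normE -sqrtr_sqr ler_wsqrtr// lerDr sqr_ge0. Qed.

Lemma Rcomplex_norm_le z : `|z| <= `|complex.Re z| + `|complex.Im z|.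
Proof.
rewrite Rcomplex_normE -[leRHS]ger0_norm ?addr_ge0// -sqrtr_sqr ler_wsqrtr//.
by rewrite sqrrD !real_normK ?num_real// lerD2r lerDl mulrn_wge0// mulr_ge0.
Qed.

Lemma Rcomplex_normM (x y : Rcomplex R) : `|x * y : Rcomplex R| = `|x| * `|y|.
Proof.
case: x y => [a b] [c d]; rewrite !Rcomplex_normE -sqrtrM ?addr_ge0 ?sqr_ge0//=.
by congr Num.sqrt; ring.
Qed.

Lemma separable_Rcomplex : separable (Rcomplex R : normedZmodType R).
Proof.
have [d dP] := @separable_rV R 1.
exists (fun n => (d n 0 0 +i* d n 0 1)%C : Rcomplex R) => z e e0.
have e20 : 0 < e / 2 by rewrite divr_gt0.
have [n /rV_norm_ltP nP] :=
  dP (\row_i if i == 0 then complex.Re z else complex.Im z) _ e20; exists n.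
have := nP e20 0; have := nP e20 1; rewrite !mxE/= => Im_close Re_close.
by apply: (le_lt_trans (Rcomplex_norm_le _)); rewrite !raddfB /=; lra.
Qed.

Lemma normcvg_Rcomplex (u : nat -> Rcomplex R) (a b : R) :
  normcvg (fun m => complex.Re (u m)) a -> normcvg (fun m => complex.Im (u m)) b ->
  normcvg u ((a +i* b)%C : Rcomplex R).
Proof.
move=> ua ub; apply: (@squeeze_cvgr _ _ _ _ (fun=> 0)
    (fun m => `|a - complex.Re (u m)| + `|b - complex.Im (u m)|)).
- apply: nearW => m; rewrite normr_ge0/=.
  by apply: (le_trans (Rcomplex_norm_le _)); rewrite !raddfB.
- exact: cvg_cst.
- by rewrite -[X in _ --> X]addr0; apply: cvgD.
Qed.

Lemma scalar_algebra_Rcomplex :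
  @scalar_algebra R (Rcomplex R : normedZmodType R) (fun x y : Rcomplex R => x * y).
Proof.
split.
- exact: separable_Rcomplex.
- by move=> x y z; rewrite mulrDl.
- by move=> x y z; rewrite mulrDr.
- exact: Rcomplex_normM.
move=> u u_fin.
have [|a aP] := @real_abs_series_normcvg R (fun i => complex.Re (u i)).
  apply: le_lt_trans u_fin; apply: lee_nneseries => i _; rewrite lee_fin//.
  exact: Re_le_norm.
have [|b bP] := @real_abs_series_normcvg R (fun i => complex.Im (u i)).
  apply: le_lt_trans u_fin; apply: lee_nneseries => i _; rewrite lee_fin//.
  exact: Im_le_norm.
exists (a +i* b)%C; apply: normcvg_Rcomplex.
  by under eq_fun do rewrite raddf_sum.
by under eq_fun do rewrite raddf_sum.
Qed.

End complex_scalars.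

Theorem theorem3p6 (R : realType) :
  @theorem3p6_claim R (R : normedZmodType R) (fun x y : R => x * y) /\
  @theorem3p6_claim R (Rcomplex R : normedZmodType R) (fun x y : Rcomplex R => x * y).
Proof.
split; apply: theorem3p6_scalar_algebra; first exact: scalar_algebra_real.
exact: scalar_algebra_Rcomplex.
Qed.
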